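(* For every $t>0$ and $P=z+rj$, $P'=z'+r'j\in\mathcal{F}^Y$, $$K_\Gamma(P,P',t,\chi)=\mathbf{P}_\infty\, rr'\frac{e^{-t}}{|\mathcal{P}|\sqrt{4\pi t}}\exp\Big(-\frac{\log^2(r/r')}{4t}\Big)+O(1),$$ where $O(1)$ denotes an endomorphism of $V$ that remains bounded as $r\to\infty$.
   Context: $\mathbb{H}^3=\{z+rj:z\in\mathbb{C},r>0\}$ with metric $(dx^2+dy^2+dr^2)/r^2$. $\Gamma$ is a cofinite Kleinian group with exactly one class of cusps, at $\infty$; $\Gamma_\infty$ its stabilizer, $\Gamma'_\infty=\{\begin{pmatrix}1&b\\0&1\end{pmatrix}:b\in\Lambda_\infty\}$ its maximal torsion-free parabolic subgroup, $\Lambda_\infty=\mathbb{Z}\oplus\mathbb{Z}\tau$. $\mathcal{P}\subset\mathbb{C}$ is a fundamental domain of $\Gamma_\infty$ acting on $\mathbb{C}$, with area $|\mathcal{P}|$; $\mathcal{F}^Y=\{z+rj:z\in\mathcal{P},r\ge Y\}$ with $Y$ large enough that $\mathcal{F}=\mathcal{F}_Y\cup\mathcal{F}^Y$ is a fundamental domain with $\mathcal{F}_Y$ compact. $\chi:\Gamma\to U(V)$ is a finite-dimensional unitary representation, $V_\infty=\{v:\chi(\gamma)v=v\ \forall\gamma\in\Gamma_\infty\}$ and $\mathbf{P}_\infty$ the orthogonal projection onto $V_\infty$. For $P=z+rj,P'=z'+r'j$, $\delta(P,P')=\frac{|z-z'|^2+r^2+r'^2}{2rr'}$ ($=\cosh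 d(P,P')$). For $t>0$ and $x\ge1$, $k_t(x)=\frac{e^{-t}}{(4\pi t)^{3/2}}\frac{\ln(x+\sqrt{x^2-1})}{\sqrt{x^2-1}}\exp\big(-\frac{(\ln(x+\sqrt{x^2-1}))^2}{4t}\big)$, and $K_\Gamma(P,Q,t,\chi)=\sum_{\gamma\in\Gamma}\chi(\gamma)k_t(\delta(P,\gamma Q))$ (the heat kernel of the Laplacian on $\chi$-automorphic functions). *)

(* Defs.v *)
From HB Require Import structures.
From mathcomp Require Import all_boot all_order all_algebra.
From mathcomp Require Import generic_quotient spectral complex.
From mathcomp Require Import all_classical all_reals all_analysis.
Import Order.TTheory GRing.Theory Num.Theory.
Import numFieldNormedType.Exports.

Set Implicit Arguments.
Unset Strict Implicit.
Unset Printing Implicit Defensive.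

Local Open Scope classical_set_scope.
Local Open Scope ring_scope.
Local Open Scope complex_scope.
Local Open Scope quotient_scope.

(* PSL(2,C) = SL(2,C) / {1, -1}, for C = R[i]. *)

Record SL2 (R : realType) := MkSL2 {
  sl2_mx :> 'M[R[i]]_2;
  sl2_det : \det sl2_mx == 1
}.

HB.instance Definition _ (R : realType) := [isSub for @sl2_mx R].
HB.instance Definition _ (R : realType) := [Choice of SL2 R by <:].

Section SL2Group.
Variable R : realType.
Implicit Types M N : SL2 R.

Fact sl2_one_det : \det (1 : 'M[R[i]]_2) == 1.
Proof. by rewrite det1. Qed.
Definition sl2_one := MkSL2 sl2_one_det.

Fact sl2_mul_det M N : \det (sl2_mx M *m sl2_mx N) == 1.
Proof. by rewrite det_mulmx (eqP (sl2_det M)) (eqP (sl2_det N)) mulr1. Qed.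
Definition sl2_mul M N := MkSL2 (sl2_mul_det M N).

Fact sl2_unit M : sl2_mx M \in unitmx.
Proof. by rewrite unitmxE (eqP (sl2_det M)) unitr1. Qed.

Fact sl2_inv_det M : \det (invmx (sl2_mx M)) == 1.
Proof. by rewrite det_inv (eqP (sl2_det M)) invr1. Qed.
Definition sl2_inv M := MkSL2 (sl2_inv_det M).

Fact sl2_opp_det M : \det (- sl2_mx M) == 1.
Proof.
by rewrite -scaleN1r detZ sqrrN expr1n mul1r; exact: sl2_det.
Qed.
Definition sl2_opp M := MkSL2 (sl2_opp_det M).

Fact sl2_mulA : associative sl2_mul.
Proof. by move=> M N P; apply/val_inj; exact: mulmxA. Qed.
Fact sl2_mul1 : left_id sl2_one sl2_mul.
Proof. by move=> M; apply/val_inj; exact: mul1mx. Qed.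
Fact sl2_mulr1 : right_id sl2_one sl2_mul.
Proof. by move=> M; apply/val_inj; exact: mulmx1. Qed.
Fact sl2_mulV : left_inverse sl2_one sl2_inv sl2_mul.
Proof. by move=> M; apply/val_inj; exact: mulVmx (sl2_unit M). Qed.
Fact sl2_mulrV : right_inverse sl2_one sl2_inv sl2_mul.
Proof. by move=> M; apply/val_inj; exact: mulmxV (sl2_unit M). Qed.

HB.instance Definition _ :=
  isGroup.Build (SL2 R) sl2_mulA sl2_mul1 sl2_mulr1 sl2_mulV sl2_mulrV.

Definition sl2_pm M N := (N == M) || (N == sl2_opp M).

Fact sl2_oppK : involutive sl2_opp.
Proof. by move=> M; apply/val_inj; exact: opprK. Qed.

Fact sl2_pm_equiv : equiv_class_of sl2_pm.
Proof.
have sym : symmetric sl2_pm.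
  move=> M N; apply/idP/idP => /orP[] /eqP ->;
    by rewrite /sl2_pm ?sl2_oppK eqxx ?orbT.
split=> //; first by move=> M; rewrite /sl2_pm eqxx.
move=> N M P /orP[] /eqP -> // /orP[] /eqP ->;
  by rewrite /sl2_pm ?sl2_oppK eqxx ?orbT.
Qed.
Canonical sl2_pm_equiv_rel := EquivRelPack sl2_pm_equiv.

End SL2Group.

Definition PSL2 (R : realType) := {eq_quot (@sl2_pm R)}.
HB.instance Definition _ (R : realType) := Choice.on (PSL2 R).
HB.instance Definition _ (R : realType) := EqQuotient.on (PSL2 R).

Definition to_psl2 (R : realType) (M : SL2 R) : PSL2 R := \pi_(PSL2 R) M.

Section PSL2Group.
Variable R : realType.
Implicit Types (M N : SL2 R) (g h : PSL2 R).

Lemma to_psl2_eq M N : (to_psl2 M = to_psl2 N) <-> (N = M \/ N = sl2_opp M).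
Proof.
rewrite /to_psl2; split.
  by move=> /eqmodP /orP[] /eqP; [left|right].
by move=> H; apply/eqmodP; apply/orP; case: H => ->; [left|right]; apply/eqP.
Qed.

Lemma psl2_reprK g : to_psl2 (repr g) = g.
Proof. by rewrite /to_psl2 reprK. Qed.

Lemma psl2_repr M : repr (to_psl2 M) = M \/ repr (to_psl2 M) = sl2_opp M.
Proof. by apply/to_psl2_eq; rewrite psl2_reprK. Qed.

Definition psl2_mul g h := to_psl2 (repr g * repr h)%g.
Definition psl2_inv g := to_psl2 ((repr g)^-1)%g.
Definition psl2_one : PSL2 R := to_psl2 1%g.

Lemma psl2_mulE M N : psl2_mul (to_psl2 M) (to_psl2 N) = to_psl2 (M * N)%g.
Proof.
apply/esym/to_psl2_eq.
case: (psl2_repr M) => ->; case: (psl2_repr N) => ->; [left|right|right|left];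
  apply/val_inj => /=; by rewrite ?mulNmx ?mulmxN ?opprK.
Qed.

Fact psl2_mulA : associative psl2_mul.
Proof.
move=> f g h; rewrite -(psl2_reprK f) -(psl2_reprK g) -(psl2_reprK h).
by rewrite !psl2_mulE mulgA.
Qed.
Fact psl2_mul1 : left_id psl2_one psl2_mul.
Proof. by move=> g; rewrite -(psl2_reprK g) psl2_mulE mul1g. Qed.
Fact psl2_mulr1 : right_id psl2_one psl2_mul.
Proof. by move=> g; rewrite -(psl2_reprK g) psl2_mulE mulg1. Qed.
Fact psl2_mulV : left_inverse psl2_one psl2_inv psl2_mul.
Proof. by move=> g; rewrite -{2}(psl2_reprK g) psl2_mulE mulVg. Qed.
Fact psl2_mulrV : right_inverse psl2_one psl2_inv psl2_mul.
Proof. by move=> g; rewrite -{1}(psl2_reprK g) psl2_mulE mulgV. Qed.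

HB.instance Definition _ :=
  isGroup.Build (PSL2 R) psl2_mulA psl2_mul1 psl2_mulr1 psl2_mulV psl2_mulrV.

Lemma to_psl2M M N : to_psl2 (M * N)%g = (to_psl2 M * to_psl2 N)%g.
Proof. by rewrite -psl2_mulE. Qed.

Lemma to_psl2_1 : to_psl2 (1%g : SL2 R) = 1%g.
Proof. by []. Qed.

End PSL2Group.

Section Kleinian.
Variable R : realType.
Local Notation C := R[i].
Local Notation abs := (@Normc.normc R).
Implicit Types (M : SL2 R) (g h : PSL2 R) (Gamma H : set (PSL2 R)).

Definition is_subgroup H : Prop :=
  [/\ H 1%g, (forall g h, H g -> H h -> H (g * h)%g)
    & (forall g, H g -> H (g^-1)%g)].

(* PSL(2,C) is the quotient of SL(2,C) by a finite subgroup, so H is discrete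
   in PSL(2,C) iff its preimage is discrete in SL(2,C). *)
Definition discrete_psl2 H : Prop :=
  forall M, H (to_psl2 M) -> exists2 e : R, 0 < e &
    forall N : SL2 R, H (to_psl2 N) ->
      (forall i j, abs (N i j - M i j) < e) -> N = M.

Definition kleinian Gamma : Prop := is_subgroup Gamma /\ discrete_psl2 Gamma.

(* The functions below act through the representative [repr g] in SL(2,C); the
   lemmas [parabolicE], [mobiusE], [h3_actE] show that its sign is immaterial. *)

Definition parabolic g : Prop := g <> 1%g /\ \tr (repr g : 'M[C]_2) ^+ 2 = 4.

Lemma parabolicE M : parabolic (to_psl2 M) <->
  to_psl2 M <> 1%g /\ \tr (M : 'M[C]_2) ^+ 2 = 4.
Proof.
by rewrite /parabolic; case: (psl2_repr M) => -> //=; rewrite raddfN sqrrN.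
Qed.

(* The projective line P^1(C) is [option C], with [None] the point oo. *)
Definition mobius_sl2 M (zeta : option C) : option C :=
  let a := M 0 0 in let b := M 0 1 in let c := M 1 0 in let d := M 1 1 in
  match zeta with
  | None => if c == 0 then None else Some (a / c)
  | Some z => if c * z + d == 0 then None
              else Some ((a * z + b) / (c * z + d))
  end.

Definition mobius g := mobius_sl2 (repr g).

Lemma mobiusE M : mobius (to_psl2 M) = mobius_sl2 M.
Proof.
rewrite /mobius; case: (psl2_repr M) => -> //.
apply/funext => -[z|]; rewrite /mobius_sl2 /= !mxE.
  by rewrite !mulNr -!opprD oppr_eq0 invrN mulrNN.
by rewrite oppr_eq0 invrN mulrNN.
Qed.

Definition stab_infty Gamma : set (PSL2 R) :=
  [set g | Gamma g /\ mobius g None = None].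

Definition cusp Gamma (zeta : option C) : Prop :=
  exists g, [/\ Gamma g, parabolic g & mobius g zeta = zeta].

Definition one_cusp_class_at_infty Gamma : Prop :=
  forall zeta, cusp Gamma zeta <-> exists2 g, Gamma g & mobius g None = zeta.

Definition torsion_free H : Prop :=
  forall g m, H g -> (0 < m)%N -> (g ^+ m = 1)%g -> g = 1%g.

Definition tf_parabolic_subgroup Gamma H : Prop :=
  [/\ is_subgroup H, H `<=` Gamma, torsion_free H
    & forall g, H g -> g <> 1%g -> parabolic g].

Definition max_tf_parabolic_subgroup Gamma H : Prop :=
  tf_parabolic_subgroup Gamma H /\
  (forall H', tf_parabolic_subgroup Gamma H' -> H `<=` H' -> H' = H).

Definition translation_mx (b : C) : 'M[C]_2 :=
  \matrix_(i, j) if i == j then 1 else if (i < j)%N then b else 0.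

Fact translation_det b : \det (translation_mx b) == 1.
Proof.
rewrite -det_tr det_trig; first by rewrite big1 // => i _; rewrite !mxE eqxx.
apply/is_trig_mxP => i j ij; rewrite !mxE eq_sym.
by rewrite -val_eqE (ltn_eqF ij) ltnNge (ltnW ij).
Qed.

Definition translation (b : C) : PSL2 R := to_psl2 (MkSL2 (translation_det b)).

Definition lattice (tau : C) : set C :=
  [set b | exists m n : int, b = m%:~R + n%:~R * tau].

(* Points of C are pairs (x, y) and points z + rj of H^3 are triples
   ((x, y), r) in [R * R * R], so as to inherit the product topology and the
   product Lebesgue measure. *)

Definition cplx (p : R * R) : C := p.1 +i* p.2.
Definition of_cplx (z : C) : R * R := (complex.Re z, complex.Im z).
Definition h3_z (P : R * R * R) : C := cplx P.1.
Definition h3_r (P : R * R * R) : R := P.2.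
Definition h3 : set (R * R * R) := [set P | 0 < h3_r P].

Definition leb2 : set (R * R) -> \bar R :=
  (@lebesgue_measure R \x @lebesgue_measure R)%E.
Definition leb3 : set (R * R * R) -> \bar R :=
  ((@lebesgue_measure R \x @lebesgue_measure R) \x @lebesgue_measure R)%E.

(* gamma(z + rj) = ((az+b) conj(cz+d) + a conj(c) r^2) / D + (r / D) j,
   where D = |cz+d|^2 + |c|^2 r^2. *)
Definition h3_act_sl2 M (P : R * R * R) : R * R * R :=
  let a := M 0 0 in let b := M 0 1 in let c := M 1 0 in let d := M 1 1 in
  let z := h3_z P in let r := h3_r P in
  let D := abs (c * z + d) ^+ 2 + abs c ^+ 2 * r ^+ 2 in
  (of_cplx (((a * z + b) * (c * z + d)^* + a * c^* * (r ^+ 2)%:C) / D%:C),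
   r / D).

Definition h3_act g := h3_act_sl2 (repr g).

Lemma h3_actE M : h3_act (to_psl2 M) = h3_act_sl2 M.
Proof.
rewrite /h3_act; case: (psl2_repr M) => -> //.
have absN (x : C) : abs (- x) = abs x by case: x => x y; rewrite /= !sqrrN.
apply/funext => P; rewrite /h3_act_sl2 /= !mxE.
rewrite !mulNr -!opprD !absN !rmorphN.
by rewrite mulrNN mulrN mulNr opprK.
Qed.

(* A fundamental domain in X (an open subset of T) for the equivalence relation
   [orb] "lie in the same orbit": a set F, closed in X, that meets every orbit,
   whose interior meets every orbit at most once, and whose boundary has
   measure zero. *)
Definition fundamental_domain (T : topologicalType) (X : set T)
    (mu : set T -> \bar R) (orb : T -> T -> Prop) (F : set T) : Prop :=
  [/\ F `<=` X /\ closure F `&` X `<=` F,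
      (forall x, X x -> exists2 y, F y & orb x y),
      (forall x y, interior F x -> interior F y -> orb x y -> x = y)
    & mu ((closure F `\` interior F) `&` X) = 0%E].

Definition h3_orbit Gamma (P Q : R * R * R) : Prop :=
  exists2 g, Gamma g & h3_act g P = Q.

Definition h3_fundamental_domain Gamma (F : set (R * R * R)) : Prop :=
  fundamental_domain h3 leb3 (h3_orbit Gamma) F.

Definition cplane_orbit Gamma (p q : R * R) : Prop :=
  exists2 g, stab_infty Gamma g & mobius g (Some (cplx p)) = Some (cplx q).

Definition cusp_fundamental_domain Gamma (D : set (R * R)) : Prop :=
  fundamental_domain setT leb2 (cplane_orbit Gamma) D.

Definition area (D : set (R * R)) : R := fine (leb2 D).

Definition hyp_volume (F : set (R * R * R)) : \bar R :=
  (\int[leb3]_(P in F) (h3_r P ^- 3)%:E)%E.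

Definition cofinite Gamma : Prop :=
  exists2 F, h3_fundamental_domain Gamma F & (hyp_volume F < +oo)%E.

Definition cusp_sector (D : set (R * R)) (Y : R) : set (R * R * R) :=
  [set P | D P.1 /\ Y <= h3_r P].

(* Unitary representations on V = C^n, the space of column vectors. *)
Definition unitary_rep Gamma n (chi : PSL2 R -> 'M[C]_n) : Prop :=
  (forall g, Gamma g -> chi g \is unitarymx) /\
  (forall g h, Gamma g -> Gamma h -> chi (g * h)%g = chi g *m chi h).

Definition fixed_vectors H n (chi : PSL2 R -> 'M[C]_n) : set 'cV[C]_n :=
  [set v | forall g, H g -> chi g *m v = v].

Definition inner n (v w : 'cV[C]_n) : C := \sum_(i < n) v i 0 * (w i 0)^*.

Definition orthogonal_projection n (W : set 'cV[C]_n) (Q : 'M[C]_n) : Prop :=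
  forall v, W (Q *m v) /\ (forall w, W w -> inner (v - Q *m v) w = 0).

Definition delta (P Q : R * R * R) : R :=
  (abs (h3_z P - h3_z Q) ^+ 2 + h3_r P ^+ 2 + h3_r Q ^+ 2)
    / (2 * h3_r P * h3_r Q).

Definition arcosh (x : R) : R := ln (x + Num.sqrt (x ^+ 2 - 1)).

(* arcosh x / sqrt (x^2 - 1), extended by continuity at x = 1. *)
Definition arcosh_ratio (x : R) : R :=
  if x == 1 then 1 else arcosh x / Num.sqrt (x ^+ 2 - 1).

Definition heat_k (t x : R) : R :=
  expR (- t) / ((4 * pi * t) `^ (3 / 2)) * arcosh_ratio x
    * expR (- (arcosh x ^+ 2 / (4 * t))).

(* Unordered sums, meaningful for absolutely summable families. *)
Definition rsum (I : choiceType) (D : set I) (f : I -> R) : R :=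
  fine (\esum_(i in D) (EFin \o f)^\+ i - \esum_(i in D) (EFin \o f)^\- i)%E.

Definition csum (I : choiceType) (D : set I) (f : I -> C) : C :=
  rsum D (fun i => complex.Re (f i)) +i* rsum D (fun i => complex.Im (f i)).

Definition heat_kernel Gamma n (chi : PSL2 R -> 'M[C]_n) (t : R)
    (P Q : R * R * R) : 'M[C]_n :=
  \matrix_(i, j)
    csum Gamma (fun g => chi g i j * (heat_k t (delta P (h3_act g Q)))%:C).

End Kleinian.

(* Main.v *)
(* Split the sum over Gamma according to whether gamma fixes oo.

   An element fixing oo acts on the z-coordinate by an isometry, so these terms
   give a matrix M(z) = sum_gamma chi(gamma) k_t(delta), and P_oo M(z) = T(z) P_oo
   where T(z) is the untwisted sum.  Since k_t is convex as a function of delta,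
   with slope O(delta^-2), the second differences of T are bounded below,
   uniformly in z, z', r, r' >= Y; as T is periodic under the lattice, its
   oscillation is bounded.  Unfolding and polar coordinates give its mean over
   the fundamental domain of Gamma_oo, which is the main term.
   The second differences of M are bounded too, and M(z + b) = chi(b) M(z) for a
   lattice vector b, so (2 - chi(b) - chi(b)^-1) M is bounded.  If P absorbs the
   translations, P M is periodic, hence of bounded oscillation, so P (1 - chi(g)) M
   is bounded for g in Gamma_oo.  The matrices B with B M bounded form a left
   ideal, which is characterised by its common kernel: it contains 1 - P_oo.

   If c <> 0 is the lower left entry of gamma, then |c| is bounded below by
   discreteness, and 2 r r' delta(P, gamma P') >= |c|^2 r^2 r'^2 bounds r r' by a
   multiple of delta.  Modulo translations, all entries of gamma are then
   O(delta); discreteness leaves polynomially many such gamma, while k_t decays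
   faster than every power of delta. *)

Require Import Defs.
From HB Require Import structures.
From mathcomp Require Import all_boot all_order all_algebra.
From mathcomp Require Import generic_quotient spectral complex.
From mathcomp Require Import all_classical all_reals all_analysis.
From mathcomp Require Import measurable_realfun.
From mathcomp Require Import ring lra.
Import Order.TTheory GRing.Theory Num.Theory.
Import numFieldNormedType.Exports.

Set Implicit Arguments.
Unset Strict Implicit.
Unset Printing Implicit Defensive.

Local Open Scope classical_set_scope.
Local Open Scope ring_scope.
Local Open Scope complex_scope.

(** * The heat profile *)

(** The main term can be of size [r r'], and so can the absolute sums over the stabilizer, while the
    error has to be bounded uniformly in both points. Second differences in [z] have the right size:
    [delta] is quadratic in [z] with leading coefficient [1 / (2 r r')], so over a bounded step [d]
    its mean exceeds its central value by [|d|^2 / (2 r r')]. The slope of [k_t] turns this into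
    O(delta^-2 / (r r')), whose sum over a planar lattice is a Riemann sum bounded independently of
    [r r']. Convexity gives one sign only; the other comes from the periodicity of the untwisted
    sum. For the twisted sum no diagonalization of [chi] is made and no lower bound for
    [2 - chi(b) - chi(b)^-1] off its kernel is computed: in finite dimension a left ideal of
    matrices is generated by one element, and a single constant for it is enough. A vector fixed by
    the translations but not by all of Gamma_oo is invisible to second differences. It is caught by
    oscillation: moving [z] by such a [g] changes [P M] by a bounded amount, yet multiplies [M] by
    [chi(g)]. *)

Section MonotoneConvex.
Variable R : realType.
Implicit Types f df : R -> R.

Lemma ndecr_of_derive f df (a b : R) : a <= b ->
  (forall x, x \in `]a, b[%R -> is_derive x 1 f (df x)) ->
  (forall x, x \in `]a, b[%R -> 0 <= df x) ->
  {within `[a, b], continuous f} -> f a <= f b.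
Proof.
rewrite le_eqVlt => /predU1P[->//|ab] fd df0 cf.
have [c cab e] := MVT ab fd cf.
by rewrite -subr_ge0 e mulr_ge0 ?df0// subr_ge0 ltW.
Qed.

(** The chord inequality is cleared of denominators, so that coinciding points are harmless. *)
Definition convex1 f := forall a m b : R, 1 <= a -> a <= m -> m <= b ->
  (b - a) * f m <= (b - m) * f a + (m - a) * f b.

Definition nincr1 f := forall a b : R, 1 <= a -> a <= b -> f b <= f a.

Lemma convex1_of_derive f df :
  (forall x : R, 1 < x -> is_derive x 1 f (df x)) ->
  (forall x y, 1 < x -> x <= y -> df x <= df y) ->
  {within `[1, +oo[, continuous f} -> convex1 f.
Proof.
move=> fd df_nd cf a m b a1.
rewrite le_eqVlt => /predU1P[->|am].
  by rewrite subrr mul0r addr0.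
rewrite le_eqVlt => /predU1P[->|mb].
  by rewrite subrr mul0r add0r.
have sub x y : 1 <= x -> {within `[x, y], continuous f}.
  move=> x1; apply: continuous_subspaceW cf => z /=.
  by rewrite !in_itv/= andbT => /andP[+ _]; exact: le_trans.
have d1 x : x \in `]a, m[%R -> is_derive x 1 f (df x).
  by rewrite in_itv/= => /andP[ax _]; apply: fd; exact: le_lt_trans ax.
have d2 x : x \in `]m, b[%R -> is_derive x 1 f (df x).
  rewrite in_itv/= => /andP[mx _]; apply: fd; apply: le_lt_trans mx.
  exact: le_trans (ltW am).
have [c + ec] := MVT am d1 (sub _ _ a1).
have [d + ed] := MVT mb d2 (sub _ _ (le_trans a1 (ltW am))).
rewrite !in_itv/= => /andP[md db] /andP[ac cm].
have : df c <= df d.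
  by apply: df_nd; [exact: le_lt_trans ac|exact: ltW (lt_trans cm md)].
move=> cd.
have : (f m - f a) * (b - m) <= (f b - f m) * (m - a).
  have := mulr_ge0 (mulr_ge0 (ltW (_ : 0 < m - a)) (ltW (_ : 0 < b - m))) (_ : 0 <= df d - df c).
  by rewrite ec ed !subr_gt0 subr_ge0 => /(_ am mb cd); lra.
nra.
Qed.

(** Multiply the two chord inequalities, which is legitimate for nonnegative functions. The product
    of the chords differs from the chord of the product by a multiple of
    [(f a - f b) * (g a - g b)], whose sign is known because both functions decrease. *)
Lemma convex1M f g : (forall x, 1 <= x -> 0 <= f x) ->
  (forall x, 1 <= x -> 0 <= g x) -> nincr1 f -> nincr1 g ->
  convex1 f -> convex1 g -> convex1 (fun x => f x * g x).
Proof.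
move=> f0 g0 fn gn cf cg a m b a1 am mb /=.
have m1 := le_trans a1 am; have b1 := le_trans m1 mb.
have [eab|nab] := eqVneq a b.
  have ema : m = a by apply/eqP; rewrite eq_le am eab mb.
  by rewrite ema -eab subrr !mul0r addr0.
have ba : 0 < b - a.
  by rewrite subr_gt0 lt_neqAle nab (le_trans am mb).
rewrite -(ler_pM2l ba).
have h1 := cf _ _ _ a1 am mb.
have h2 := cg _ _ _ a1 am mb.
have fm : 0 <= (b - a) * f m by rewrite mulr_ge0 ?f0// ltW.
have gm : 0 <= (b - a) * g m by rewrite mulr_ge0 ?g0// ltW.
have h3 := ler_pM fm gm h1 h2.
have fab := fn _ _ a1 (le_trans am mb).
have gab := gn _ _ a1 (le_trans am mb).
have h4 : 0 <= (b - m) * (m - a) * ((f a - f b) * (g a - g b)).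
  by rewrite !mulr_ge0 ?subr_ge0.
rewrite [leLHS](_ : _ = (b - a) * f m * ((b - a) * g m)); last by ring.
apply: (le_trans h3); nra.
Qed.

End MonotoneConvex.

(** * The function v / sinh v in the variable x = cosh v *)

Section Arcosh.
Variable R : realType.
Local Notation phi := (@arcosh_ratio R).
Local Notation s x := (Num.sqrt (x ^+ 2 - 1 : R)).

Lemma sqr_sub1_gt0 (x : R) : 1 < x -> 0 < x ^+ 2 - 1.
Proof. by move=> x1; nra. Qed.

Lemma sqrt_sub1_gt0 (x : R) : 1 < x -> 0 < s x.
Proof. by move=> x1; rewrite sqrtr_gt0 sqr_sub1_gt0. Qed.

Lemma sqr_sqrt_sub1 (x : R) : 1 <= x -> s x ^+ 2 = x ^+ 2 - 1.
Proof. by move=> x1; rewrite sqr_sqrtr//; nra. Qed.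

Lemma add_sqrt_ge1 (x : R) : 1 <= x -> 1 <= x + s x.
Proof. by move=> x1; rewrite -[leLHS]addr0 lerD ?sqrtr_ge0. Qed.

Lemma arcosh_ge0 (x : R) : 1 <= x -> 0 <= arcosh x.
Proof. by move=> x1; rewrite ln_ge0// add_sqrt_ge1. Qed.

Lemma arcosh1 : arcosh (1 : R) = 0.
Proof. by rewrite /arcosh expr1n subrr sqrtr0 addr0 ln1. Qed.

Lemma is_derive_sqrt_sub1 (x : R) : 1 < x ->
  is_derive x 1 (fun y : R => s y) (x / s x).
Proof.
move=> x1; have g0 := sqr_sub1_gt0 x1.
have d1 : is_derive x 1 (fun y : R => y ^+ 2 - 1) (2 * x).
  apply: is_derive_eq.
  by rewrite /GRing.scale/=; ring.
apply: is_derive_eq (@is_derive1_comp R (@Num.sqrt R) _ x _ _ (is_derive1_sqrt g0) d1) _.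
by field; rewrite lt0r_neq0// sqrt_sub1_gt0.
Qed.

Lemma is_derive_arcosh (x : R) : 1 < x -> is_derive x 1 (@arcosh R) (s x)^-1.
Proof.
move=> x1; have s0 := sqrt_sub1_gt0 x1.
have d1 : is_derive x 1 (fun y : R => y + s y) (1 + x / s x).
  by apply: is_deriveD; exact: is_derive_sqrt_sub1.
have p0 : 0 < x + s x by rewrite addr_gt0// (lt_trans ltr01).
apply: is_derive_eq (@is_derive1_comp R (@ln R) _ x _ _ (is_derive1_ln p0) d1) _.
by field; rewrite !lt0r_neq0.
Qed.

Lemma continuous_sqrt_sub1 : continuous (fun y : R => s y).
Proof.
move=> x; apply: (@continuous_comp _ _ _ (fun y : R => y ^+ 2 - 1) (@Num.sqrt R));
  last exact: sqrt_continuous.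
by apply: cvgB; [exact: exprn_continuous|exact: cvg_cst].
Qed.

Lemma continuous_arcosh (x : R) : 0 < x -> {for x, continuous (@arcosh R)}.
Proof.
move=> x0; apply: (@continuous_comp _ _ _ (fun y : R => y + s y) (@ln R)).
  by apply: cvgD; [exact: cvg_id|exact: continuous_sqrt_sub1].
by apply: continuous_ln; rewrite ltr_pwDl// sqrtr_ge0.
Qed.

Lemma arcosh_ratioE (x : R) : 1 < x -> phi x = arcosh x / s x.
Proof. by move=> x1; rewrite /arcosh_ratio gt_eqF. Qed.

Lemma within_arcosh (a b : R) : 0 < a -> {within `[a, b], continuous (@arcosh R)}.
Proof.
move=> a0; apply: continuous_in_subspaceT => x; rewrite inE/= in_itv/= => /andP[ax _].
exact: continuous_arcosh (lt_le_trans a0 ax).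
Qed.

Lemma arcosh_le_sqrt (x : R) : 1 <= x -> arcosh x <= s x.
Proof.
move=> x1; rewrite -subr_ge0.
have -> : 0 = s 1 - arcosh (1 : R) by rewrite arcosh1 subr0 expr1n subrr sqrtr0.
apply: (@ndecr_of_derive R (fun x => s x - arcosh x) (fun x => x / s x - (s x)^-1)) => //.
- move=> y; rewrite in_itv/= => /andP[y1 _].
  by apply: is_deriveB; [exact: is_derive_sqrt_sub1|exact: is_derive_arcosh].
- move=> y; rewrite in_itv/= => /andP[y1 _].
  rewrite (_ : _ - _ = (y - 1) / s y); last by rewrite mulrBl mul1r.
  by rewrite divr_ge0 ?sqrtr_ge0// subr_ge0 ltW.
- move=> y; apply: cvgB; last exact: within_arcosh.
  by apply: continuous_subspaceT; exact: continuous_sqrt_sub1.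
Qed.

Lemma sqrt_le_mul_arcosh (x : R) : 1 <= x -> s x <= x * arcosh x.
Proof.
move=> x1; rewrite -subr_ge0.
have -> : 0 = 1 * arcosh (1 : R) - s 1.
  by rewrite arcosh1 mul1r sub0r expr1n subrr sqrtr0 oppr0.
apply: (@ndecr_of_derive R (fun x => x * arcosh x - s x) (@arcosh R)) => //.
- move=> y; rewrite in_itv/= => /andP[y1 _].
  have h1 := is_derive_arcosh y1; have h2 := is_derive_sqrt_sub1 y1.
  have h3 : is_derive y 1 (fun x : R => x * arcosh x) (y *: (s y)^-1 + arcosh y *: 1).
    exact: is_deriveM.
  apply: is_derive_eq (is_deriveB h3 h2) _.
  by rewrite /GRing.scale/= mulr1; ring.
- by move=> y; rewrite in_itv/= => /andP[y1 _]; rewrite arcosh_ge0// ltW.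
- move=> y; apply: cvgB; last first.
    by apply: continuous_subspaceT; exact: continuous_sqrt_sub1.
  apply: cvgM; last exact: within_arcosh.
  by apply: continuous_subspaceT => z; exact: cvg_id.
Qed.

Lemma arcosh_ratio_le1 (x : R) : 1 <= x -> phi x <= 1.
Proof.
rewrite le_eqVlt => /predU1P[<-|x1]; first by rewrite /arcosh_ratio eqxx.
by rewrite arcosh_ratioE// ler_pdivrMr ?sqrt_sub1_gt0// mul1r arcosh_le_sqrt// ltW.
Qed.

(** In the variable [v] this is [sinh v <= v cosh v]. It gives the sign of the derivative of [phi],
    the continuity of [phi] at 1, and the linear estimate of [1 - phi] near 1. *)
Lemma arcosh_ratio_geV (x : R) : 1 <= x -> x^-1 <= phi x.
Proof.
rewrite le_eqVlt => /predU1P[<-|x1]; first by rewrite /arcosh_ratio eqxx invr1.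
have x0 : 0 < x by exact: lt_trans x1.
rewrite arcosh_ratioE// ler_pdivlMr ?sqrt_sub1_gt0// -ler_pdivlMl ?invr_gt0//.
by rewrite invrK sqrt_le_mul_arcosh// ltW.
Qed.

Lemma arcosh_ratio_gt0 (x : R) : 1 <= x -> 0 < phi x.
Proof.
move=> x1; apply: lt_le_trans (arcosh_ratio_geV x1).
by rewrite invr_gt0 (lt_le_trans ltr01).
Qed.

Let dphi (x : R) := (1 - x * phi x) / (x ^+ 2 - 1).

Lemma is_derive_arcosh_ratio (x : R) : 1 < x ->
  is_derive x 1 phi ((1 - x * phi x) / (x ^+ 2 - 1)).
Proof.
move=> x1; have s0 := sqrt_sub1_gt0 x1.
have sn0 : s x != 0 by rewrite lt0r_neq0.
apply: (@near_eq_is_derive _ _ _ (fun y => arcosh y * (s y)^-1)).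
  near=> y; rewrite arcosh_ratioE//; near: y; exact: lt_nbhsr.
have h1 := is_derive_arcosh x1.
have h2 := @is_deriveV R (fun y => s y) x _ 1 sn0 (is_derive_sqrt_sub1 x1).
apply: is_derive_eq (is_deriveM h1 h2) _.
rewrite /GRing.scale/= arcosh_ratioE//.
have := sqr_sqrt_sub1 (ltW x1); move: sn0; set S := s x => sn0 <-.
by field.
Unshelve. all: by end_near. Qed.

Lemma within_arcosh_ratio : {within `[1, +oo[, continuous phi}.
Proof.
apply/continuous_within_itvcyP; split.
  move=> x; rewrite in_itv/= andbT => x1.
  apply: differentiable_continuous; apply/derivable1_diffP.
  by have [] := is_derive_arcosh_ratio x1.
rewrite {2}/arcosh_ratio eqxx.
apply: (@squeeze_cvgr _ _ _ _ (fun x => x^-1) (fun=> 1)).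
- near=> x; rewrite arcosh_ratio_geV ?arcosh_ratio_le1//.
- rewrite -[X in _ --> X]invr1; apply: cvgV => //; exact: cvg_at_right_filter.
- exact: cvg_cst.
Unshelve. all: by end_near. Qed.

Lemma nincr1_arcosh_ratio : nincr1 phi.
Proof.
move=> a b a1 ab; rewrite -lerN2.
apply: (@ndecr_of_derive R (fun x => - phi x) (fun x => - dphi x)) => //.
- move=> x; rewrite in_itv/= => /andP[ax _]; apply: is_deriveN.
  by apply: is_derive_arcosh_ratio; exact: le_lt_trans ax.
- move=> x; rewrite in_itv/= => /andP[ax _].
  have x1 : 1 < x by exact: le_lt_trans ax.
  rewrite /dphi -mulNr opprB mulr_ge0 ?invr_ge0 ?(ltW (sqr_sub1_gt0 x1))//.
  rewrite subr_ge0 -ler_pdivrMl ?mulr1 ?arcosh_ratio_geV ?(ltW x1)//.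
  exact: lt_trans x1.
- move=> x; apply: cvgN; move: x.
  apply: continuous_subspaceW within_arcosh_ratio => z /=.
  by rewrite !in_itv/= andbT => /andP[+ _]; exact: le_trans.
Qed.

(* Equivalent to [v (cosh v + 2) >= 3 sinh v] for [v = 2 arcosh x]. *)
Lemma arcosh_ge (x : R) : 1 <= x -> 3 * x * s x <= (2 * x ^+ 2 + 1) * arcosh x.
Proof.
move=> x1.
have pos (y : R) : 0 < 2 * y ^+ 2 + 1 by nra.
rewrite -ler_pdivrMl// -subr_ge0.
have -> : 0 = arcosh (1 : R) - (2 * 1 ^+ 2 + 1)^-1 * (3 * 1 * s 1).
  by rewrite arcosh1 expr1n subrr sqrtr0 !mulr0 subr0.
pose f (x : R) := arcosh x - (2 * x ^+ 2 + 1)^-1 * (3 * x * s x).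
pose df (y : R) := 4 * (y ^+ 2 - 1) ^+ 2 / ((2 * y ^+ 2 + 1) ^+ 2 * s y).
apply: (@ndecr_of_derive R f df) => //.
- move=> y; rewrite in_itv/= => /andP[y1 _].
  have h1 := is_derive_arcosh y1; have h2 := is_derive_sqrt_sub1 y1.
  have h3 : is_derive y 1 (fun y : R => 2 * y ^+ 2 + 1) (4 * y).
    apply: is_derive_eq.
    by rewrite /GRing.scale/=; ring.
  have h4 := @is_deriveV R (fun y => 2 * y ^+ 2 + 1) y _ 1 (lt0r_neq0 (pos y)) h3.
  have h5 : is_derive y 1 (fun y : R => 3 * y) 3.
    by apply: is_derive_eq; rewrite /GRing.scale/= mulr1.
  have h6 := is_deriveB h1 (is_deriveM h4 (is_deriveM h5 h2)).
  apply: is_derive_eq h6 _; rewrite /df /GRing.scale !fctE/=.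
  have s2 := sqr_sqrt_sub1 (ltW y1).
  have sn0 : s y != 0 by rewrite lt0r_neq0// sqrt_sub1_gt0.
  have pn0 := lt0r_neq0 (pos y).
  have yn0 := lt0r_neq0 (sqr_sub1_gt0 y1).
  move: s2 sn0; set S := s y => s2 sn0; rewrite (invfM _ S).
  have -> : S^-1 = S / (y ^+ 2 - 1) by rewrite -s2; field.
  by field; rewrite pn0 yn0.
- move=> y; rewrite in_itv/= => /andP[y1 _]; rewrite /df.
  by apply: divr_ge0; apply: mulr_ge0; rewrite ?sqr_ge0 ?sqrtr_ge0.
- have cg : continuous (fun x : R => (2 * x ^+ 2 + 1)^-1 * (3 * x * s x)).
    move=> z; apply: cvgM.
      apply: cvgV; first exact: lt0r_neq0 (pos z).
      apply: cvgD; last exact: cvg_cst.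
      by apply: cvgM; [exact: cvg_cst|exact: exprn_continuous].
    apply: cvgM; last exact: continuous_sqrt_sub1.
    by apply: cvgM; [exact: cvg_cst|exact: cvg_id].
  move=> y; apply: cvgB; first exact: within_arcosh.
  exact: continuous_subspaceT cg y.
Qed.

(** [arcosh_ge] is exactly the nonnegativity of the numerator of the second derivative [ddphi]. *)
Lemma convex1_arcosh_ratio : convex1 phi.
Proof.
apply: (@convex1_of_derive R phi dphi); last exact: within_arcosh_ratio.
  exact: is_derive_arcosh_ratio.
move=> x y x1 xy.
pose ddphi (x : R) := (phi x * (2 * x ^+ 2 + 1) - 3 * x) / (x ^+ 2 - 1) ^+ 2.
have dd (z : R) : 1 < z -> is_derive z 1 dphi (ddphi z).
  move=> z1; have h1 := is_derive_arcosh_ratio z1.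
  have zn0 := lt0r_neq0 (sqr_sub1_gt0 z1).
  have h2 : is_derive z 1 (fun y : R => y ^+ 2 - 1) (2 * z).
    by apply: is_derive_eq; rewrite /GRing.scale/=; ring.
  have h3 := @is_deriveV R (fun y => y ^+ 2 - 1) z _ 1 zn0 h2.
  have h4 : is_derive z 1 (fun y : R => 1 - y * phi y) (0 - (z *: ((1 - z * phi z) / (z ^+ 2 - 1)) + phi z *: 1)).
    by apply: is_deriveB; exact: is_deriveM.
  apply: is_derive_eq (is_deriveM h4 h3) _.
  by rewrite /GRing.scale/= /ddphi; field.
apply: (@ndecr_of_derive R dphi ddphi) => //.
- move=> z; rewrite in_itv/= => /andP[xz _]; apply: dd; exact: lt_trans xz.
- move=> z; rewrite in_itv/= => /andP[xz _].
  have z1 : 1 < z by exact: lt_trans xz.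
  rewrite /ddphi mulr_ge0 ?invr_ge0 ?exprn_even_ge0// subr_ge0.
  rewrite arcosh_ratioE// mulrAC ler_pdivlMr ?sqrt_sub1_gt0// mulrC [leRHS]mulrC.
  by rewrite mulrC; exact: arcosh_ge (ltW z1).
- apply: derivable_within_continuous => z; rewrite in_itv/= => /andP[xz _].
  by have [] := dd z (lt_le_trans x1 xz).
Qed.

End Arcosh.

(** * Monotonicity, convexity, decay and primitive of k_t as a function of delta *)

Section HeatProfile.
Variables (R : realType) (t : R).
Hypothesis t0 : 0 < t.
Local Notation phi := (@arcosh_ratio R).
Local Notation k := (@heat_k R t).

Let h (x : R) := expR (- (arcosh x ^+ 2 / (4 * t))).
Let c := expR (- t) / ((4 * pi * t) `^ (3 / 2)).

Let c_gt0 : 0 < c.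
Proof. by rewrite divr_gt0 ?expR_gt0// powR_gt0// !mulr_gt0// pi_gt0. Qed.

Let heat_kE x : k x = c * (phi x * h x).
Proof. by rewrite /heat_k mulrA. Qed.

(** The derivative of the Gaussian factor reproduces [phi * h], hence [k] up to a constant. This has
    two uses: [h] is convex because [phi * h] decreases, and a multiple of [h] is an explicit
    primitive of [k]. *)
Let is_derive_h (x : R) : 1 < x -> is_derive x 1 h (- (phi x * h x) / (2 * t)).
Proof.
move=> x1; have h1 := is_derive_arcosh x1.
have h2 : is_derive x 1 (fun y => - (arcosh y ^+ 2 / (4 * t))) (- (arcosh x / (2 * t) / Num.sqrt (x ^+ 2 - 1))).
  have -> : (fun y => - (arcosh y ^+ 2 / (4 * t))) = (- (4 * t)^-1) \*: (@arcosh R ^+ 2).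
    apply/funext => y; transitivity (- (4 * t)^-1 * arcosh y ^+ 2) => //; ring.
  apply: is_derive_eq; rewrite /GRing.scale/=; field.
  by rewrite !lt0r_neq0// sqrt_sub1_gt0.
apply: is_derive_eq (is_derive1_comp (is_derive_expR _) h2) _.
rewrite /= /h arcosh_ratioE//; field.
by rewrite !lt0r_neq0// sqrt_sub1_gt0.
Qed.

Let h_gt0 x : 0 < h x. Proof. exact: expR_gt0. Qed.

Let continuous_h (x : R) : 0 < x -> {for x, continuous h}.
Proof.
move=> x0; apply: continuous_comp; last exact: continuous_expR.
apply: cvgN; apply: cvgM; last exact: cvg_cst.
apply: (@continuous_comp _ _ _ (@arcosh R) (fun x => x ^+ 2)).
  exact: continuous_arcosh.
exact: exprn_continuous.
Qed.

Let within_h : {within `[1, +oo[, continuous h}.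
Proof.
apply: continuous_in_subspaceT => x; rewrite inE/= in_itv/= andbT => x1.
by apply: continuous_h; exact: lt_le_trans x1.
Qed.

Lemma le_arcosh (a b : R) : 1 <= a -> a <= b -> arcosh a <= arcosh b.
Proof.
move=> a1 ab; have := add_sqrt_ge1 a1; have := add_sqrt_ge1 (le_trans a1 ab) => b2 a2.
rewrite ler_ln ?posrE ?(lt_le_trans ltr01)// lerD// ler_wsqrtr// lerD2r.
by rewrite lerXn2r// nnegrE; apply: le_trans (le_trans a1 _) => //; exact: ler01.
Qed.

Let nincr1_h : nincr1 h.
Proof.
move=> a b a1 ab; rewrite ler_expR lerN2 ler_pM2r ?invr_gt0 ?mulr_gt0//.
rewrite lerXn2r ?nnegrE ?arcosh_ge0 ?le_arcosh//; exact: le_trans ab.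
Qed.

Let nincr1_phih : nincr1 (fun x => phi x * h x).
Proof.
move=> a b a1 ab; apply: ler_pM; rewrite ?(ltW (h_gt0 _))//.
- by rewrite ltW// arcosh_ratio_gt0//; exact: le_trans ab.
- exact: nincr1_arcosh_ratio.
- exact: nincr1_h.
Qed.

Let convex1_h : convex1 h.
Proof.
apply: (@convex1_of_derive R h (fun x => - (phi x * h x) / (2 * t))).
- exact: is_derive_h.
- move=> x y x1 xy; rewrite ler_pM2r ?invr_gt0 ?mulr_gt0// lerN2.
  exact: nincr1_phih (ltW x1) xy.
- exact: within_h.
Qed.

Lemma heat_k_gt0 (x : R) : 1 <= x -> 0 < k x.
Proof.
by move=> x1; rewrite heat_kE mulr_gt0// mulr_gt0// arcosh_ratio_gt0.
Qed.

Lemma heat_k_ge0 (x : R) : 1 <= x -> 0 <= k x.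
Proof. by move=> x1; rewrite ltW// heat_k_gt0. Qed.

Lemma heat_k_nincr : nincr1 k.
Proof.
move=> a b a1 ab; rewrite !heat_kE ler_pM2l//; exact: nincr1_phih.
Qed.

Lemma heat_k_convex : convex1 k.
Proof.
have H : convex1 (fun x => phi x * h x).
  apply: convex1M => //.
  - by move=> x x1; rewrite ltW// arcosh_ratio_gt0.
  - by move=> x x1; rewrite ltW.
  - exact: nincr1_arcosh_ratio.
  - exact: convex1_arcosh_ratio.
move=> a m b a1 am mb; rewrite !heat_kE.
rewrite (mulrCA (b - a)) (mulrCA (b - m)) (mulrCA (m - a)) -mulrDr.
by rewrite ler_pM2l//; exact: H.
Qed.

Lemma heat_k_midpoint (a b : R) : 1 <= a -> 1 <= b ->
  2 * k ((a + b) / 2) <= k a + k b.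
Proof.
wlog ab : a b / a <= b.
  move=> H a1 b1; case/orP: (le_total a b) => [ab|ba]; first exact: H.
  by rewrite addrC [leRHS]addrC; exact: H.
move=> a1 b1.
have am : a <= (a + b) / 2 by lra.
have mb : (a + b) / 2 <= b by lra.
have [->|nab] := eqVneq a b; first by rewrite (_ : (b + b) / 2 = b); lra.
have ba : 0 < (b - a) by rewrite subr_gt0 lt_neqAle nab.
have := heat_k_convex a1 am mb.
rewrite (_ : b - (a + b) / 2 = (b - a) / 2); last by lra.
rewrite (_ : (a + b) / 2 - a = (b - a) / 2); last by lra.
by rewrite -mulrDr -mulrA ler_pM2l// ler_pdivlMl.
Qed.

Lemma le_expR_arcosh (x : R) : 1 <= x -> x <= expR (arcosh x).
Proof.
move=> x1; rewrite lnK ?posrE ?(lt_le_trans ltr01 (add_sqrt_ge1 x1))//.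
by rewrite lerDl sqrtr_ge0.
Qed.

(** With [v = arcosh x], completing the square gives [n v <= n^2 t + v^2 / (4 t)], and
    [exp v >= x]. *)
Lemma heat_k_decay n : exists2 C : R, 0 < C &
  forall x, 1 <= x -> k x <= C / x ^+ n.
Proof.
exists (c * expR (n%:R ^+ 2 * t)); first by rewrite mulr_gt0// expR_gt0.
move=> x x1; rewrite heat_kE -mulrA ler_pM2l//.
have x0 : 0 < x by exact: lt_le_trans x1.
apply: (@le_trans _ _ (h x)).
  by rewrite -[leRHS]mul1r ler_wpM2r ?arcosh_ratio_le1// ltW.
apply: (@le_trans _ _ (expR (n%:R ^+ 2 * t) * expR (- (n%:R * arcosh x)))).
  rewrite -expRD ler_expR -subr_ge0.
  rewrite (_ : _ - _ = (2 * t * n%:R - arcosh x) ^+ 2 / (4 * t)).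
    by rewrite divr_ge0 ?sqr_ge0// mulr_ge0// ltW.
  by field; rewrite lt0r_neq0.
rewrite ler_pM2l ?expR_gt0// expRN expRM_natl.
rewrite lef_pV2 ?posrE ?exprn_gt0 ?expR_gt0//.
by rewrite lerXn2r ?nnegrE ?expR_ge0 ?le_expR_arcosh// ltW.
Qed.

Let arcosh_sqr (x : R) : 1 <= x -> arcosh x ^+ 2 <= 2 * (x - 1).
Proof.
move=> x1.
have [->|xn1] := eqVneq x 1; first by rewrite arcosh1 expr0n/= subrr mulr0.
have x1' : 1 < x by rewrite lt_neqAle eq_sym xn1.
pose f x := 2 * (x - 1) - arcosh x ^+ 2 : R.
suff : f 1 <= f x by rewrite /f arcosh1 expr0n/= subrr mulr0 subr0 subr_ge0.
apply: (@ndecr_of_derive R f (fun x => 2 * (1 - phi x))) => //; rewrite {}/f.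
- move=> y; rewrite in_itv/= => /andP[y1 _].
  have h1 := is_derive_arcosh y1.
  have h2 : is_derive y 1 (fun y => arcosh y ^+ 2) (2 * phi y).
    have -> : (fun y => arcosh y ^+ 2) = @arcosh R ^+ 2 by [].
    apply: is_derive_eq; rewrite /GRing.scale/= arcosh_ratioE//; field.
    by rewrite !lt0r_neq0// sqrt_sub1_gt0.
  have h3 : is_derive y 1 (fun y : R => 2 * (y - 1)) 2.
    by apply: is_derive_eq; rewrite /GRing.scale/=; ring.
  by apply: is_derive_eq (is_deriveB h3 h2) _; ring.
- move=> y; rewrite in_itv/= => /andP[y1 _].
  by rewrite mulr_ge0// subr_ge0 arcosh_ratio_le1// ltW.
- apply: continuous_in_subspaceT => y; rewrite inE/= in_itv/= => /andP[y1 _].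
  apply: cvgB.
    by apply: cvgM; [exact: cvg_cst|apply: cvgB; [exact: cvg_id|exact: cvg_cst]].
  apply: (@continuous_comp _ _ _ (@arcosh R) (fun x => x ^+ 2)); last exact: exprn_continuous.
  by apply: continuous_arcosh; exact: lt_le_trans y1.
Qed.

(** Controls the slope at the endpoint 1, where [arcosh] has a vertical tangent but [arcosh ^+ 2]
    and [phi] do not. *)
Lemma heat_k_near1 : exists2 C : R, 0 < C &
  forall x, 1 <= x -> k 1 - k x <= C * (x - 1).
Proof.
exists (c * (1 + (2 * t)^-1)).
  by rewrite mulr_gt0// addr_gt0// invr_gt0 mulr_gt0.
move=> x x1; have x0 : 0 < x by exact: lt_le_trans x1.
rewrite !heat_kE -mulrBr -mulrA ler_pM2l//.
have -> : phi 1 * h 1 = 1.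
  by rewrite /arcosh_ratio eqxx /h arcosh1 expr0n/= mul0r oppr0 expR0 mul1r.
have h1 : 1 - h x <= (2 * t)^-1 * (x - 1).
  apply: (@le_trans _ _ (arcosh x ^+ 2 / (4 * t))).
    by have := expR_ge1Dx (- (arcosh x ^+ 2 / (4 * t))); rewrite -/(h x); lra.
  rewrite ler_pdivrMr ?mulr_gt0// (le_trans (arcosh_sqr x1))//.
  by rewrite le_eqVlt; apply/orP; left; apply/eqP; field; rewrite lt0r_neq0.
have h2 : 1 - phi x <= x - 1.
  apply: (@le_trans _ _ (1 - x^-1)); first by rewrite lerD2l lerN2 arcosh_ratio_geV.
  rewrite -subr_ge0 (_ : _ - _ = (x - 1) ^+ 2 / x); first by rewrite divr_ge0 ?sqr_ge0// ltW.
  by field; rewrite lt0r_neq0.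
have h3 := arcosh_ratio_le1 x1.
have h4 : h x <= 1.
  by rewrite -expR0 ler_expR oppr_le0 divr_ge0 ?sqr_ge0// mulr_ge0// ltW.
have h5 := h_gt0 x; have h6 := arcosh_ratio_gt0 x1.
rewrite mulrDl mul1r (_ : 1 - phi x * h x = (1 - phi x) + phi x * (1 - h x)); last by ring.
apply: lerD => //; apply: le_trans h1.
by rewrite -[leRHS]mul1r ler_wpM2r// subr_ge0.
Qed.

(** By convexity the mean slope on [[q, q + e]] is no steeper than that of any chord to its left.
    For [q <= 2] the chord over [[1, q]] is taken; for larger [q] the chord over [[q / 2, q]], where
    one factor [1 / q] comes from its length and the other from the decay of [k (q / 2)]. *)
Lemma heat_k_slope : exists2 C : R, 0 < C &
  forall q e, 1 <= q -> 0 <= e -> k q - k (q + e) <= C * e / q ^+ 2.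
Proof.
have [C1 C1_gt0 near1] := heat_k_near1.
have [C2 C2_gt0 decay] := heat_k_decay 1.
exists (4 * C1 + 8 * C2); first by rewrite addr_gt0// mulr_gt0.
move=> q e q1; rewrite le_eqVlt => /predU1P[<-|e0].
  by rewrite addr0 subrr mulr0 mul0r.
have q0 : 0 < q by exact: lt_le_trans q1.
have qe1 : 1 <= q + e by rewrite -[leLHS]addr0 lerD// ltW.
have [q2|q2] := lerP q 2.
  apply: (@le_trans _ _ (C1 * e)).
    have [->|nq1] := eqVneq q 1.
      apply: le_trans (near1 _ _) _; first by rewrite lerDl ltW.
      by rewrite addrC addKr.
    have q1' : 0 < q - 1 by rewrite subr_gt0 lt_neqAle eq_sym nq1.
    have := heat_k_convex (lexx 1) q1 (_ : q <= q + e).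
    rewrite lerDl => /(_ (ltW e0)); have := near1 _ q1; rewrite -(ler_pM2l e0).
    move=> H1 H2; rewrite -(ler_pM2l q1'); nra.
  rewrite ler_pdivlMr ?exprn_gt0//.
  apply: (@le_trans _ _ (C1 * e * 4)).
    by rewrite ler_pM2l ?mulr_gt0//; nra.
  by nra.
have p1 : 1 <= q / 2 by lra.
have pq : q / 2 <= q by lra.
have := heat_k_convex p1 pq (_ : q <= q + e).
rewrite lerDl => /(_ (ltW e0)) H.
have := decay _ p1; rewrite expr1 => H2.
have := heat_k_ge0 q1 => H3.
have H4 : (k q - k (q + e)) * (q / 2) <= e * (k (q / 2)) by nra.
have H5 : (k q - k (q + e)) * (q / 2) <= e * (C2 / (q / 2)).
  by apply: (le_trans H4); rewrite ler_pM2l.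
rewrite ler_pdivlMr ?exprn_gt0//.
have -> : (k q - k (q + e)) * q ^+ 2 = (k q - k (q + e)) * (q / 2) * (2 * q).
  by field.
apply: (@le_trans _ _ (e * (C2 / (q / 2)) * (2 * q))).
  by rewrite ler_pM2r// mulr_gt0.
have -> : e * (C2 / (q / 2)) * (2 * q) = 4 * C2 * e by field; rewrite lt0r_neq0.
by nra.
Qed.

Lemma within_heat_k : {within `[1, +oo[, continuous k}.
Proof.
have -> : k = (fun x => c * (phi x * h x)) by apply/funext => x; exact: heat_kE.
move=> x; apply: cvgM; first exact: cvg_cst.
by apply: cvgM; [exact: within_arcosh_ratio|exact: within_h].
Qed.

Definition heat_primitive (x : R) := - (2 * t * c * h x).

Lemma is_derive_heat_primitive (x : R) : 1 < x ->
  is_derive x 1 heat_primitive (k x).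
Proof.
move=> x1; have h1 := is_derive_h x1.
have -> : heat_primitive = (- (2 * t * c)) \*: h.
  by apply/funext => y; rewrite /heat_primitive -mulNr.
apply: is_derive_eq; rewrite heat_kE /GRing.scale/=; field.
by rewrite lt0r_neq0.
Qed.

Lemma continuous_heat_primitive (x : R) : 0 < x -> {for x, continuous heat_primitive}.
Proof.
move=> x0; apply: cvgN; apply: cvgM; first exact: cvg_cst.
exact: continuous_h.
Qed.

Lemma heat_primitive_cvgy : heat_primitive x @[x --> +oo] --> 0.
Proof.
rewrite -oppr0; apply: cvgN.
rewrite -[X in _ --> X](mulr0 (2 * t * c)); apply: cvgM; first exact: cvg_cst.
apply: (@squeeze_cvgr _ _ _ _ (fun=> 0) (fun x => expR t * x^-1)).
- near=> x; rewrite ltW//=.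
  have x1 : 1 <= x by near: x; exact: nbhs_pinfty_ge.
  have x0 : 0 < x by exact: lt_le_trans x1.
  apply: (@le_trans _ _ (expR t * expR (- arcosh x))).
    rewrite -expRD ler_expR -subr_ge0.
    rewrite (_ : _ - _ = (2 * t - arcosh x) ^+ 2 / (4 * t)).
      by rewrite divr_ge0 ?sqr_ge0// mulr_ge0// ltW.
    by field; rewrite lt0r_neq0.
  rewrite ler_pM2l ?expR_gt0// expRN lef_pV2 ?posrE ?expR_gt0//.
  exact: le_expR_arcosh.
- exact: cvg_cst.
- rewrite -[X in _ --> X](mulr0 (expR t)); apply: cvgM; first exact: cvg_cst.
  by apply/gtr0_cvgV0; [exact: nbhs_pinfty_gt|exact: cvg_id].
Unshelve. all: by end_near. Qed.

End HeatProfile.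

(** * Integration over the plane *)

Section PlaneMeasure.
Variable R : realType.
Local Notation mu := (@lebesgue_measure R).
Local Notation mu2 := (mu \x mu)%E.
Local Open Scope ereal_scope.

Lemma ge0_integral_shift (a : R) (f : R -> \bar R) :
  measurable_fun [set: R] f -> (forall x, 0 <= f x) ->
  \int[mu]_x f (x + a)%R = \int[mu]_x f x.
Proof.
move=> mf f0.
have mT : measurable_fun setT (fun x : measurableTypeR R => (x + a)%R : measurableTypeR R).
  exact: measurable_funD.
have H := @ge0_integral_pushforward _ _ _ _ R _ mT mu setT f measurableT mf (fun x _ => f0 x).
rewrite preimage_setT in H; rewrite -[LHS]H.
apply: eq_measure_integral => A mA _; apply/esym.
apply: lebesgue_measure_unique => //= _ [[b c]] _ <-.
rewrite /pushforward (_ : _ @^-1` _ = `](b - a)%R, (c - a)%R]%classic); last first.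
  by apply/seteqP; split=> x /=; rewrite !in_itv/= ltrBlDr lerBrDr.
rewrite !lebesgue_measure_itv/= !lte_fin ltrD2r; case: ifP => // _.
by rewrite -!EFinB; congr (_%:E); ring.
Qed.

Lemma ge0_integral_even (f : R -> \bar R) :
  measurable_fun [set: R] f -> (forall x, 0 <= f x) -> (forall x, f (- x)%R = f x) ->
  \int[mu]_x f x = 2%:E * \int[mu]_(x in `]0%R, +oo[) f x.
Proof.
move=> mf f0 fN.
have e1 : \int[mu]_(x in `]0%R, +oo[) f x = \int[mu]_(x in `[0%R, +oo[) f x.
  by rewrite integral_itv_obnd_cbnd//; exact: measurable_funTS.
have -> : [set: R] = `]-oo, 0%R]%classic `|` `]0%R, +oo[%classic.
  by rewrite -(setUv `]-oo, 0%R]%classic) setCitvl.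
rewrite ge0_integral_setU//=; last 2 first.
- exact: measurable_funTS.
- by rewrite -setCitvl; exact/disj_setPCl.
have -> : \int[mu]_(x in `]-oo, 0%R]) f x = \int[mu]_(x in `]0%R, +oo[) f x.
  rewrite e1 ge0_integration_by_substitution0//.
  by apply: eq_integral => x _; rewrite fN.
by rewrite mule_natl mule2n.
Qed.

Lemma tonelli1 (f : R * R -> \bar R) :
  measurable_fun [set: R * R] f -> (forall x, 0 <= f x) ->
  \int[mu2]_w f w = \int[mu]_x \int[mu]_y f (x, y).
Proof. by move=> mf f0; exact: (@fubini_tonelli1 _ _ _ _ R mu mu f mf f0). Qed.

Lemma tonelli2 (f : R * R -> \bar R) :
  measurable_fun [set: R * R] f -> (forall x, 0 <= f x) ->
  \int[mu2]_w f w = \int[mu]_y \int[mu]_x f (x, y).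
Proof. by move=> mf f0; exact: (@fubini_tonelli2 _ _ _ _ R mu mu f mf f0). Qed.

Lemma ge0_integral_shear1 (g : R -> R) (f : R * R -> \bar R) :
  measurable_fun [set: R] g -> measurable_fun [set: R * R] f -> (forall x, 0 <= f x) ->
  \int[mu2]_w f (w.1 + g w.2, w.2)%R = \int[mu2]_w f w.
Proof.
move=> mg mf f0.
have mT : measurable_fun setT (fun w : R * R => (w.1 + g w.2, w.2)%R).
  apply: measurable_fun_pair; last exact: measurable_snd.
  apply: measurable_funD; first exact: measurable_fst.
  by apply: measurableT_comp => //; exact: measurable_snd.
have mfT : measurable_fun setT (fun w : R * R => f (w.1 + g w.2, w.2)%R) by exact: measurableT_comp.
rewrite (tonelli2 mfT)// (tonelli2 mf)//.
apply: eq_integral => y _; rewrite /=.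
apply: (@ge0_integral_shift (g y) (fun x => f (x, y))) => //.
by apply: measurableT_comp => //; exact: pair2_measurable.
Qed.

Lemma ge0_integral_shear2 (g : R -> R) (f : R * R -> \bar R) :
  measurable_fun [set: R] g -> measurable_fun [set: R * R] f -> (forall x, 0 <= f x) ->
  \int[mu2]_w f (w.1, w.2 + g w.1)%R = \int[mu2]_w f w.
Proof.
move=> mg mf f0.
have mT : measurable_fun setT (fun w : R * R => (w.1, w.2 + g w.1)%R).
  apply: measurable_fun_pair; first exact: measurable_fst.
  apply: measurable_funD; first exact: measurable_snd.
  by apply: measurableT_comp => //; exact: measurable_fst.
have mfT : measurable_fun setT (fun w : R * R => f (w.1, w.2 + g w.1)%R) by exact: measurableT_comp.
rewrite (tonelli1 mfT)// (tonelli1 mf)//.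
apply: eq_integral => x _; rewrite /=.
apply: (@ge0_integral_shift (g x) (fun y => f (x, y))) => //.
by apply: measurableT_comp => //; exact: pair1_measurable.
Qed.

Definition rot (c s : R) (w : R * R) : R * R :=
  (c * w.1 - s * w.2, s * w.1 + c * w.2)%R.

Lemma measurable_rot c s : measurable_fun setT (rot c s).
Proof.
apply: measurable_fun_pair.
  by apply: measurable_funB; apply: measurable_funM.
by apply: measurable_funD; apply: measurable_funM.
Qed.

(* A rotation by an angle other than pi is a product of three shears. *)
Lemma ge0_integral_rot (c s : R) (f : R * R -> \bar R) :
  (c ^+ 2 + s ^+ 2 = 1)%R ->
  measurable_fun [set: R * R] f -> (forall x, 0 <= f x) ->
  \int[mu2]_w f (rot c s w) = \int[mu2]_w f w.
Proof.
have main (c' s' : R) (g : R * R -> \bar R) : (c' ^+ 2 + s' ^+ 2 = 1)%R -> s' != 0%R ->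
    measurable_fun [set: R * R] g -> (forall x, 0 <= g x) ->
    \int[mu2]_w g (rot c' s' w) = \int[mu2]_w g w.
  move=> cs s0 mg g0.
  (* For the angle theta this is [- tan (theta / 2)]: the rotation is the horizontal shear by [p],
     then the vertical shear by [sin theta], then the first one again. *)
  pose p := ((c' - 1) / s')%R.
  pose f1 (w : R * R) := g (w.1 + p * w.2, w.2)%R.
  have mp (q : R) : measurable_fun setT (fun y : R => (q * y)%R) by exact: measurable_funM.
  have mT1 (q : R) : measurable_fun setT (fun w : R * R => (w.1 + q * w.2, w.2)%R).
    apply: measurable_fun_pair; last exact: measurable_snd.
    apply: measurable_funD; first exact: measurable_fst.
    by apply: measurable_funM => //; exact: measurable_snd.
  have mT2 (q : R) : measurable_fun setT (fun w : R * R => (w.1, w.2 + q * w.1)%R).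
    apply: measurable_fun_pair; first exact: measurable_fst.
    apply: measurable_funD; first exact: measurable_snd.
    by apply: measurable_funM => //; exact: measurable_fst.
  have mf1 : measurable_fun setT f1 by exact: measurableT_comp.
  pose f2 (w : R * R) := f1 (w.1, w.2 + s' * w.1)%R.
  have mf2 : measurable_fun setT f2 by exact: measurableT_comp.
  rewrite -(ge0_integral_shear1 (mp p) mg g0).
  rewrite -(ge0_integral_shear2 (mp s') mf1) //; last by move=> w; exact: g0.
  rewrite -(ge0_integral_shear1 (mp p) mf2) //; last by move=> w; exact: g0.
  apply: eq_integral => w _; rewrite /f2 /f1 /rot/=; congr (g (_, _)); rewrite /p.
    have -> : (c' * w.1 - s' * w.2 = c' * w.1 - (s' ^+ 2) / s' * w.2)%R by field.
    have -> : (s' ^+ 2 = 1 - c' ^+ 2)%R by rewrite -cs; ring.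
    by field.
  by field.
move=> cs mf f0; have [s0|s0] := eqVneq s 0%R; last exact: main.
have : (c ^+ 2 = 1)%R by rewrite -cs s0; ring.
move=> /eqP; rewrite sqrf_eq1 => /orP[]/eqP ->; rewrite s0.
  by apply: eq_integral => -[x y] _; congr f; rewrite /rot/=; congr (_, _); ring.
(* The remaining case is the half turn, which is the square of the quarter turn. *)
have m1 : measurable_fun setT (fun w => f (rot 0 1 w)).
  by apply: measurableT_comp => //; exact: measurable_rot.
have e01 : (0 ^+ 2 + 1 ^+ 2 = 1 :> R)%R by ring.
rewrite -(main 0%R 1%R f)// ?oner_neq0//.
rewrite -(main 0%R 1%R _ _ _ m1)// ?oner_neq0//.
by apply: eq_integral => -[x y] _; congr f; rewrite /rot/=; congr (_, _); ring.
Qed.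

Lemma measurable_affine_rot c s (b1 b2 : R) :
  measurable_fun setT (fun w => ((rot c s w).1 + b1, (rot c s w).2 + b2)%R).
Proof.
apply: measurable_fun_pair; apply: measurable_funD => //.
- by apply: measurableT_comp; [exact: measurable_fst|exact: measurable_rot].
- by apply: measurableT_comp; [exact: measurable_snd|exact: measurable_rot].
Qed.

Lemma ge0_integral_affine_rot (c s b1 b2 : R) (f : R * R -> \bar R) :
  (c ^+ 2 + s ^+ 2 = 1)%R ->
  measurable_fun [set: R * R] f -> (forall x, 0 <= f x) ->
  \int[mu2]_w f ((rot c s w).1 + b1, (rot c s w).2 + b2)%R = \int[mu2]_w f w.
Proof.
move=> cs mf f0.
have mT1 : measurable_fun setT (fun w : R * R => (w.1 + b1, w.2)%R).
  apply: measurable_fun_pair; last exact: measurable_snd.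
  by apply: measurable_funD => //; exact: measurable_fst.
have mT2 : measurable_fun setT (fun w : R * R => (w.1, w.2 + b2)%R).
  apply: measurable_fun_pair; first exact: measurable_fst.
  by apply: measurable_funD => //; exact: measurable_snd.
pose f1 (w : R * R) := f (w.1 + b1, w.2)%R.
have mf1 : measurable_fun setT f1 by exact: measurableT_comp.
pose f2 (w : R * R) := f1 (w.1, w.2 + b2)%R.
have mf2 : measurable_fun setT f2 by exact: measurableT_comp.
rewrite -(@ge0_integral_shear1 (fun=> b1) f)//.
rewrite -(@ge0_integral_shear2 (fun=> b2) f1)//; last by move=> w; exact: f0.
by rewrite -(@ge0_integral_rot c s f2)//; move=> w; exact: f0.
Qed.

(** An open set is a countable union of rational boxes, and boxes belong to the product
    sigma-algebra. *)
Lemma open_measurable2 (U : set (R * R)) : open U -> measurable U.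
Proof.
move=> oU.
pose box (q : (rat * rat) * (rat * rat)) : set (R * R) :=
  `]ratr q.1.1, ratr q.1.2[%classic `*` `]ratr q.2.1, ratr q.2.2[%classic.
have -> : U = \bigcup_q (if `[< box q `<=` U >] then box q else set0).
  apply/seteqP; split=> [[x y] Uxy|w [q _]]; last first.
    by case: asboolP => // + h; apply.
  have : nbhs (x, y) U by exact: open_nbhs_nbhs.
  move=> /nbhs_ballP[e /= e0 He].
  have lxe : (x - e < x)%R by rewrite ltrBlDr ltrDl.
  have rxe : (x < x + e)%R by rewrite ltrDl.
  have lye : (y - e < y)%R by rewrite ltrBlDr ltrDl.
  have rye : (y < y + e)%R by rewrite ltrDl.
  have [a] := rat_in_itvoo lxe; have [b] := rat_in_itvoo rxe.
  have [c] := rat_in_itvoo lye; have [d] := rat_in_itvoo rye.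
  rewrite !in_itv/= => /andP[d1 d2] /andP[c1 c2] /andP[b1 b2] /andP[a1 a2].
  exists ((a, b), (c, d)) => //.
  case: asboolP => [_|]; first by split; rewrite /= in_itv/=; apply/andP.
  case=> -[x' y'] [] /=; rewrite !in_itv/= => /andP[x1 x2] /andP[y1 y2].
  apply: He; split; rewrite /ball/= ltr_distlC; apply/andP; split; lra.
apply: countable_bigcupT_measurable; first exact: countableP.
move=> q; case: ifP => // _; apply: measurableX; exact: measurable_itv.
Qed.

Lemma closed_measurable2 (A : set (R * R)) : closed A -> measurable A.
Proof.
by move=> cA; rewrite -(setCK A); apply: measurableC; apply: open_measurable2; exact: closed_openC.
Qed.

(** The substitution [y = x u] on the half plane [x > 0] replaces polar coordinates: the integrand
    becomes [G (x^2 (1 + u^2)) x], which is an exact derivative in [x], and what is left is the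
    integral of [1 / (1 + u^2)]. *)
Lemma ge0_integral_radial (G H : R -> R) (l : R) :
  (forall s, 0 <= G s)%R -> continuous G ->
  (forall s : R, (0 < s)%R -> is_derive s 1%R H (G s)) ->
  {for 0%R, continuous H} -> H s @[s --> +oo%R] --> l ->
  \int[mu2]_w (G (w.1 ^+ 2 + w.2 ^+ 2))%:E = (pi * (l - H 0))%:E.
Proof.
move=> G0 cG dH cH0 cHl.
have mG : measurable_fun setT G by exact: continuous_measurable_fun.
have mx2 : measurable_fun setT (fun x : R => x ^+ 2)%R by exact: measurable_funX.
have mf : measurable_fun setT (fun w : R * R => (G (w.1 ^+ 2 + w.2 ^+ 2))%:E).
  apply/measurable_EFinP; apply: measurableT_comp => //.
  apply: measurable_funD; apply: measurable_funX.
    exact: measurable_fst.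
  exact: measurable_snd.
have f0 (w : R * R) : 0 <= (G (w.1 ^+ 2 + w.2 ^+ 2))%:E by rewrite lee_fin.
rewrite (tonelli1 mf)//.
rewrite ge0_integral_even; first last.
- by move=> x; rewrite /= sqrrN.
- by move=> x; apply: integral_ge0 => y _; rewrite lee_fin.
- exact: (@measurable_fun_fubini_tonelli_F _ _ _ _ R mu _ mf f0).
(* The factor [Num.max w.1 0] is the Jacobian [x] for [x > 0] and vanishes on the other half plane,
   so that Tonelli applies on the whole plane. *)
pose K (w : R * R) : R := (G (w.1 ^+ 2 * (1 + w.2 ^+ 2)) * Num.max w.1 0)%R.
have K0 w : (0 <= K w)%R by rewrite mulr_ge0// le_max lexx orbT.
have mK : measurable_fun setT (EFin \o K).
  apply/measurable_EFinP; apply: measurable_funM.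
    apply: measurableT_comp => //; apply: measurable_funM.
      by apply: measurable_funX; exact: measurable_fst.
    by apply: measurable_funD => //; apply: measurable_funX; exact: measurable_snd.
  by apply: measurable_maxr => //; exact: measurable_fst.
have e1 : \int[mu]_(x in `]0%R, +oo[) \int[mu]_y (G (x ^+ 2 + y ^+ 2))%:E =
    \int[mu]_x \int[mu]_u (K (x, u))%:E.
  rewrite integral_mkcond; apply: eq_integral => x _; rewrite patchE.
  have [x0|x0] := ltP 0%R x; last first.
    rewrite memNset/= ?in_itv/= ?andbT ?ltNge ?x0//.
    rewrite integral0_eq// => u _; rewrite /K/=.
    by rewrite (max_idPr x0) mulr0.
  rewrite mem_set/= ?in_itv/= ?x0//.
    have cF : derive1 (fun u : R => x * u)%R = cst x.
      apply/funext => u; rewrite derive1E; apply: derive_val.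
      by apply: is_derive_eq; rewrite /GRing.scale/= mulr1.
    rewrite (@increasing_ge0_integration_by_substitutionT R (fun u => x * u)%R
        (fun y => G (x ^+ 2 + y ^+ 2)%R)) //.
    + apply: eq_integral => u _; rewrite cF /K/= (max_idPl (ltW x0)).
      by congr ((G _ * _)%R%:E); ring.
    + by move=> u v uv; rewrite ltr_pM2l.
    + by rewrite cF; move=> u; exact: cvg_cst.
    + by rewrite cF; exact: is_cvg_cst.
    + by rewrite cF; exact: is_cvg_cst.
    + by apply: gt0_cvgMrNy => //; exact: cvg_id.
    + by apply: gt0_cvgMry => //; exact: cvg_id.
    + move=> y; apply: continuous_comp; last exact: cG.
      by apply: cvgD; [exact: cvg_cst|exact: exprn_continuous].
rewrite e1 (@fubini_tonelli _ _ _ _ R mu mu (EFin \o K) mK)//.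
have e2 u : \int[mu]_x (K (x, u))%:E = ((l - H 0) / 2 * (1 + u ^+ 2)^-1)%:E.
  have u0 : (0 < 1 + u ^+ 2)%R by rewrite ltr_pwDl// sqr_ge0.
  have -> : \int[mu]_x (K (x, u))%:E =
      \int[mu]_(x in `[0%R, +oo[) (G (x ^+ 2 * (1 + u ^+ 2)) * x)%:E.
    rewrite [RHS]integral_mkcond; apply: eq_integral => x _; rewrite patchE.
    have [x0|x0] := leP 0%R x.
      by rewrite mem_set/= ?in_itv/= ?x0// /K/= (max_idPl x0).
    rewrite memNset/= ?in_itv/= ?andbT ?leNgt ?x0//.
    by rewrite /K/= (max_idPr (ltW x0)) mulr0.
  pose F x := (H (x ^+ 2 * (1 + u ^+ 2)) * (2 * (1 + u ^+ 2))^-1)%R.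
  have cq : continuous (fun x : R => x ^+ 2 * (1 + u ^+ 2))%R.
    by move=> x; apply: cvgM; [exact: exprn_continuous|exact: cvg_cst].
  have dF (x : R) : (0 < x)%R -> is_derive x 1%R F (G (x ^+ 2 * (1 + u ^+ 2)) * x)%R.
    move=> x0.
    have h1 : is_derive x 1%R (fun x : R => x ^+ 2 * (1 + u ^+ 2))%R (2 * x * (1 + u ^+ 2))%R.
      by apply: is_derive_eq; rewrite /GRing.scale/=; ring.
    have p0 : (0 < x ^+ 2 * (1 + u ^+ 2))%R by rewrite mulr_gt0// exprn_gt0.
    have h2 := @is_derive1_comp R H _ x _ _ (dH _ p0) h1.
    have -> : F = ((2 * (1 + u ^+ 2))^-1 \*: (H \o (fun x : R => x ^+ 2 * (1 + u ^+ 2))))%R.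
      by apply/funext => y; rewrite /F /GRing.scale/= mulrC.
    apply: is_derive_eq; rewrite /GRing.scale/=; field.
    by rewrite lt0r_neq0.
  rewrite (@ge0_continuous_FTC2y R _ F 0 (l / (2 * (1 + u ^+ 2)))%R).
  - rewrite -EFinB /F expr0n/= mul0r; congr (_%:E); field.
    by rewrite lt0r_neq0.
  - by move=> x x0; rewrite mulr_ge0.
  - apply: continuous_subspaceT => x; apply: cvgM; last exact: cvg_id.
    by apply: continuous_comp; [exact: cq|exact: cG].
  - apply: cvgM; last exact: cvg_cst.
    apply: cvg_comp cHl; apply: gt0_cvgMly => //.
    exact: cvgr_expr2.
  - by move=> x x0; have [] := dF x x0.
  - apply: cvg_at_right_filter; apply: cvgM; last exact: cvg_cst.
    apply: continuous_comp; first exact: cq.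
    by rewrite expr0n/= mul0r.
  - move=> x; rewrite in_itv/= andbT => x0.
    by rewrite derive1E; have h := dF x x0; rewrite derive_val.
under eq_integral do rewrite e2.
have mV : measurable_fun setT (fun u : R => (1 + u ^+ 2)^-1)%R.
  apply: continuous_measurable_fun => u; apply: cvgV.
    by rewrite lt0r_neq0// ltr_pwDl// sqr_ge0.
  by apply: cvgD; [exact: cvg_cst|exact: exprn_continuous].
have V0 (u : R) : (0 <= (1 + u ^+ 2)^-1)%R.
  by rewrite invr_ge0 addr_ge0// sqr_ge0.
have lH : (0 <= (l - H 0) / 2)%R.
  have := e2 0%R; rewrite expr0n/= addr0 invr1 mulr1 => e.
  by rewrite -lee_fin -e; apply: integral_ge0 => x _; rewrite lee_fin.
under eq_integral do rewrite EFinM.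
rewrite ge0_integralZl_EFin//; last 2 first.
  by move=> u _; rewrite lee_fin.
  by apply/measurable_EFinP.
rewrite ge0_integral_even; last 3 first.
- by apply/measurable_EFinP.
- by move=> u; rewrite lee_fin.
- by move=> u; rewrite sqrrN.
rewrite integral_itv_obnd_cbnd; last by apply/measurable_EFinP; exact: measurable_funTS.
have := @integral0y_oneDsqr R; rewrite /oneDsqr => ->.
by rewrite -!EFinM; congr (_%:E); field.
Qed.

End PlaneMeasure.

(** * Absolutely summable families *)

Section SumBound.
Variable R : realType.
Local Open Scope ereal_scope.

(** One inequality carries summability together with an explicit bound, so that uniformity in
    parameters is never lost. *)
Definition sum_le (I : choiceType) (D : set I) (f : I -> R) (B : R) : Prop :=
  \esum_(i in D) (f i)%:E <= B%:E.

Lemma sum_le_mono (I : choiceType) (D : set I) (f g : I -> R) B :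
  (forall i, D i -> (f i <= g i)%R) -> sum_le D g B -> sum_le D f B.
Proof.
by move=> fg; apply: le_trans; apply: le_esum => i Di; rewrite lee_fin fg.
Qed.

Lemma sum_le_ge0 (I : choiceType) (D : set I) (f : I -> R) B :
  sum_le D f B -> (0 <= B)%R.
Proof.
move=> H; rewrite -lee_fin; apply: le_trans H; apply: ereal_sup_ubound.
by exists set0; [exact: fsets_set0|rewrite fsbig_set0].
Qed.

Lemma sum_leZ (I : choiceType) (D : set I) (f : I -> R) B c :
  (0 <= c)%R -> sum_le D f B -> sum_le D (fun i => c * f i)%R (c * B)%R.
Proof.
move=> c0 H; apply: ge_ereal_sup => _ [X [finX XD] <-].
rewrite fsbig_finite//= sumEFin -big_distrr/= lee_fin ler_wpM2l//.
rewrite -lee_fin; apply: le_trans H; apply: ereal_sup_ubound.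
by exists X; [split|rewrite fsbig_finite//= sumEFin].
Qed.

Lemma sum_leD (I : choiceType) (D : set I) (f g : I -> R) A B :
  (forall i, D i -> (0 <= f i)%R) -> (forall i, D i -> (0 <= g i)%R) ->
  sum_le D f A -> sum_le D g B -> sum_le D (fun i => f i + g i)%R (A + B)%R.
Proof.
move=> f0 g0 HA HB; rewrite /sum_le.
under eq_esum do rewrite EFinD.
by rewrite esumD// EFinD leeD.
Qed.

Lemma sum_le_prod (I J : choiceType) (u : I -> R) (v : J -> R) A B :
  (forall i, (0 <= u i)%R) -> (forall j, (0 <= v j)%R) ->
  sum_le setT u A -> sum_le setT v B ->
  sum_le setT (fun k : I * J => u k.1 * v k.2)%R (A * B)%R.
Proof.
move=> u0 v0 HA HB; rewrite /sum_le.
have -> : [set: I * J] = setT `*`` (fun=> setT) by apply/seteqP; split.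
rewrite -(@esum_esum R I J setT (fun=> setT) (fun i j => (u i * v j)%:E)); last first.
  by move=> i j _ _; rewrite lee_fin mulr_ge0.
have B0 := sum_le_ge0 HB.
apply: (@le_trans _ _ (\esum_(i in setT) (B * u i)%:E)).
  by apply: le_esum => i _; rewrite (mulrC B); apply: sum_leZ.
by rewrite mulrC; apply: sum_leZ.
Qed.

Lemma sum_le_inj (I J : choiceType) (D : set I) (e : I -> J) (f : I -> R) (g : J -> R) B :
  set_inj D e -> (forall j, (0 <= g j)%R) ->
  (forall i, D i -> (f i <= g (e i))%R) -> sum_le setT g B -> sum_le D f B.
Proof.
move=> inj g0 fg H; apply: (@sum_le_mono _ _ _ (g \o e)) => //.
rewrite /sum_le -(@esum_image R I J D e (fun j => (g j)%:E))//.
apply: le_trans H; rewrite [leLHS]esum_mkcond.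
by apply: le_esum => j _; case: ifP => _; rewrite ?lee_fin.
Qed.

Lemma sum_le_reindex (I J : choiceType) (D : set I) (E : set J) (e : I -> J) (g : J -> R) B :
  set_bij D E e -> sum_le E g B <-> sum_le D (g \o e) B.
Proof.
by move=> be; rewrite /sum_le (@reindex_esum R I J D E e (fun j => (g j)%:E)).
Qed.

Lemma sum_le_subset (I : choiceType) (D E : set I) (f : I -> R) B :
  D `<=` E -> (forall i, E i -> (0 <= f i)%R) -> sum_le E f B -> sum_le D f B.
Proof.
move=> DE f0; apply: le_trans.
rewrite [leLHS]esum_mkcond [leRHS]esum_mkcond; apply: le_esum => i _.
case: ifP => Di; last by case: ifP => // /set_mem Ei; rewrite lee_fin f0.
by rewrite mem_set//; apply: DE; exact: set_mem.
Qed.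

Lemma sum_le_split (I : choiceType) (D E : set I) (f : I -> R) A B :
  (forall i, D i -> (0 <= f i)%R) ->
  sum_le (D `&` E) f A -> sum_le (D `&` ~` E) f B -> sum_le D f (A + B)%R.
Proof.
move=> f0 HA HB; rewrite /sum_le (esumID E); last by move=> i Di; rewrite lee_fin f0.
by rewrite EFinD; apply: leeD.
Qed.

Lemma sum_le_nat (f : nat -> R) B : (forall n, (0 <= f n)%R) ->
  (forall N, (\sum_(0 <= i < N) f i <= B)%R) -> sum_le setT f B.
Proof.
move=> f0 H; rewrite /sum_le -(@nneseries_esumT R (fun n => (f n)%:E)) //.
apply: lime_le; first by apply: is_cvg_nneseries => n _ _; rewrite lee_fin.
by apply: nearW => N; rewrite sumEFin lee_fin.
Qed.

Lemma sum_le_int (f : int -> R) A B : (forall n, (0 <= f n)%R) ->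
  sum_le setT (f \o Posz) A -> sum_le setT (f \o Negz) B ->
  sum_le setT f (A + B)%R.
Proof.
move=> f0 HA HB; rewrite /sum_le (esumID (range Posz))//=; last first.
  by move=> i _; rewrite lee_fin.
rewrite setTI setTI EFinD; apply: leeD.
  by rewrite (@esum_image R _ _ setT Posz (fun n => (f n)%:E))//; move=> x y _ _ [].
have -> : ~` range Posz = range Negz.
  apply/seteqP; split=> [[n|n] /= H|n [m _ <-] [k _]//].
    by exfalso; apply: H; exists n.
  by exists n.
by rewrite (@esum_image R _ _ setT Negz (fun n => (f n)%:E))//; move=> x y _ _ [].
Qed.

(** A Riemann sum, with mesh [1 / rho], of the function [1 / (1 + x^2)]; hence the bound depends on
    the lower bound [Y] of [rho] but not on [rho]. *)
Lemma sum_le_inv_sqr (Y rho : R) : (0 < Y)%R -> (Y <= rho)%R ->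
  sum_le setT (fun m : int => rho / (rho ^+ 2 + m%:~R ^+ 2))%R (4 * (1 + Y^-1))%R.
Proof.
move=> Y0 Yr; have r0 : (0 < rho)%R by exact: lt_le_trans Yr.
have rm (x : R) : (0 < rho ^+ 2 + x ^+ 2)%R by rewrite ltr_pwDl ?exprn_gt0 ?sqr_ge0.
have f0 (x : R) : (0 <= rho / (rho ^+ 2 + x ^+ 2))%R.
  by rewrite divr_ge0 ?ltW.
have key : sum_le setT (fun n : nat => rho / (rho ^+ 2 + n%:R ^+ 2))%R (2 * (1 + Y^-1))%R.
  apply: sum_le_nat => // N.
  (* A telescoping majorant: [(rho + n)^2 <= 2 (rho^2 + n^2)], and
     [rho + n + 1 <= (1 + 1 / Y) (rho + n)] since [rho >= Y]. *)
  pose h (n : nat) : R := (2 * (1 + Y^-1) * rho * (rho + n%:R)^-1)%R.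
  have rn (n : nat) : (0 < rho + n%:R)%R by rewrite ltr_wpDr.
  apply: (@le_trans _ _ (\sum_(0 <= i < N) (h i - h i.+1))%R).
    apply: ler_sum => n _; rewrite /h -mulrBr.
    have e1 : ((rho + n%:R)^-1 - (rho + n.+1%:R)^-1 = (rho + n%:R)^-1 * (rho + n.+1%:R)^-1)%R.
      have := rn n.+1; have := rn n; rewrite -natr1 => h1 h2.
      by field; rewrite !lt0r_neq0// addrA.
    rewrite e1 -invfM.
    have h1 : ((rho + n%:R) * (rho + n.+1%:R) <= 2 * (1 + Y^-1) * (rho ^+ 2 + n%:R ^+ 2))%R.
      have h2 : (rho + n.+1%:R <= (1 + Y^-1) * (rho + n%:R))%R.
        rewrite mulrDl mul1r -natr1 addrA lerD2l -ler_pdivrMl ?invr_gt0// invrK mulr1.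
        by rewrite (le_trans Yr)// lerDl.
      apply: (@le_trans _ _ ((1 + Y^-1) * (rho + n%:R) ^+ 2)%R).
        by rewrite expr2 mulrCA ler_pM2l.
      rewrite (mulrC 2%R) -mulrA ler_pM2l ?addr_gt0 ?invr_gt0//.
      have := sqr_ge0 (rho - n%:R)%R; lra.
    rewrite ler_pdivrMr// mulrAC ler_pdivlMr ?mulr_gt0//.
    by rewrite (mulrAC _ rho) mulrC ler_pM2r.
  under eq_bigr do rewrite -opprB.
  rewrite sumrN telescope_sumr// opprB /h addr0 mulfK ?lt0r_neq0//.
  by rewrite gerBl mulr_ge0 ?invr_ge0 ?(ltW (rn _))// !mulr_ge0 ?addr_ge0 ?invr_ge0 ?ltW.
have -> : (4 * (1 + Y^-1) = 2 * (1 + Y^-1) + 2 * (1 + Y^-1))%R by ring.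
apply: sum_le_int => //.
(* [Negz n] is [-(n + 1)], so its term is at most the term at [n]. *)
apply: sum_le_mono key => n _ /=.
rewrite ler_pM2l// lef_pV2 ?posrE// lerD2l NegzE mulrNz sqrrN.
by rewrite lerXn2r ?nnegrE// -pmulrn ler_nat.
Qed.

End SumBound.

Section RealSum.
Variables (R : realType) (I : choiceType).
Implicit Types (D : set I) (f g p q : I -> R).

Lemma funepos_fin f i : ((EFin \o f)^\+ i = (Num.max (f i) 0)%:E)%E.
Proof. by rewrite funeposE/= -EFin_max. Qed.

Lemma funeneg_fin f i : ((EFin \o f)^\- i = (Num.max (- f i) 0)%:E)%E.
Proof. by rewrite funenegE/= -EFin_max. Qed.

Lemma rsum_ge0E D p : (forall i, D i -> 0 <= p i) ->
  rsum D p = fine (\esum_(i in D) (p i)%:E)%E.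
Proof.
move=> p0; rewrite /rsum; congr fine.
rewrite [X in (_ - X)%E]esum1 ?sube0; last first.
  by move=> i Di; rewrite funeneg_fin max_r// oppr_le0 p0.
by apply: eq_esum => i Di; rewrite funepos_fin max_l// p0.
Qed.

Lemma sum_le_rsum D p B : (forall i, D i -> 0 <= p i) -> sum_le D p B ->
  (\esum_(i in D) (p i)%:E)%E = (rsum D p)%:E.
Proof.
move=> p0 H; rewrite rsum_ge0E// fineK// ge0_fin_numE.
  exact: le_lt_trans H (ltry _).
by apply: esum_ge0 => i Di; rewrite lee_fin p0.
Qed.

Lemma rsum_le D p B : (forall i, D i -> 0 <= p i) -> sum_le D p B ->
  rsum D p <= B.
Proof. by move=> p0 H; rewrite -lee_fin -(sum_le_rsum p0 H). Qed.

Lemma sum_le_rsum_self D p B : (forall i, D i -> 0 <= p i) -> sum_le D p B ->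
  sum_le D p (rsum D p).
Proof. by move=> p0 H; rewrite /sum_le (sum_le_rsum p0 H). Qed.

Lemma rsum_ge0 D p : (forall i, D i -> 0 <= p i) -> 0 <= rsum D p.
Proof.
move=> p0; rewrite rsum_ge0E// fine_ge0// esum_ge0// => i Di; exact: p0.
Qed.

Lemma rsum_ge0D D p q A B : (forall i, D i -> 0 <= p i) -> (forall i, D i -> 0 <= q i) ->
  sum_le D p A -> sum_le D q B ->
  rsum D (fun i => p i + q i) = rsum D p + rsum D q.
Proof.
move=> p0 q0 HA HB; apply: EFin_inj; rewrite EFinD.
rewrite -(sum_le_rsum p0 HA) -(sum_le_rsum q0 HB).
rewrite -(@sum_le_rsum _ _ (A + B)) //.
- by under eq_esum do rewrite EFinD; rewrite esumD.
- by move=> i Di; rewrite addr_ge0 ?p0 ?q0.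
- exact: sum_leD.
Qed.

Lemma rsum_ge0Z D p A c : (forall i, D i -> 0 <= p i) -> 0 <= c ->
  sum_le D p A -> rsum D (fun i => c * p i) = c * rsum D p.
Proof.
move=> p0; rewrite le_eqVlt => /predU1P[<- _|c0 HA].
  rewrite mul0r rsum_ge0E; last by move=> i _; rewrite mul0r.
  by rewrite esum1// => i _; rewrite mul0r.
have cp0 i : D i -> 0 <= c * p i by move=> Di; rewrite mulr_ge0 ?p0// ltW.
have HcA := sum_leZ (ltW c0) HA.
apply/eqP; rewrite eq_le; apply/andP; split.
  apply: rsum_le => //; apply: sum_leZ; first exact: ltW.
  exact: sum_le_rsum_self HA.
rewrite -ler_pdivlMl//; apply: rsum_le => //.
have H : sum_le D (fun i => c^-1 * (c * p i)) (c^-1 * rsum D (fun i => c * p i)).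
  apply: sum_leZ; first by rewrite invr_ge0 ltW.
  exact: sum_le_rsum_self HcA.
by apply: sum_le_mono H => i _; rewrite mulKf// lt0r_neq0.
Qed.

(** [rsum] is defined by positive and negative parts, which do not behave additively. Any other
    splitting into nonnegative summable families computes it as well, and linearity follows from
    this. *)
Lemma rsum_sub D f p q A B :
  (forall i, D i -> f i = p i - q i) ->
  (forall i, D i -> 0 <= p i) -> (forall i, D i -> 0 <= q i) ->
  sum_le D p A -> sum_le D q B -> rsum D f = rsum D p - rsum D q.
Proof.
move=> fpq p0 q0 HA HB; apply: EFin_inj; rewrite EFinB.
rewrite -(sum_le_rsum p0 HA) -(sum_le_rsum q0 HB).
have sp : summable D (EFin \o p).
  rewrite /summable (@eq_esum _ _ _ _ (EFin \o p)); first exact: le_lt_trans HA (ltry _).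
  by move=> i Di /=; rewrite ger0_norm ?p0.
have sq : summable D (EFin \o q).
  rewrite /summable (@eq_esum _ _ _ _ (EFin \o q)); first exact: le_lt_trans HB (ltry _).
  by move=> i Di /=; rewrite ger0_norm ?q0.
have EB := esumB sp sq p0 q0; rewrite -EB.
rewrite /rsum fineK; last first.
  rewrite (@eq_esum _ _ _ _ ((EFin \o p) \- (EFin \o q))^\+%E); last first.
    by move=> i Di; rewrite funepos_fin funeposE/= fpq// EFin_max.
  rewrite (@eq_esum _ _ D (EFin \o f)^\-%E ((EFin \o p) \- (EFin \o q))^\-%E); last first.
    by move=> i Di; rewrite funeneg_fin funenegE/= fpq// EFin_max.
  rewrite (esumB sp sq)//.
  by rewrite -[X in (X - _)%E]/(\esum_(i in D) (p i)%:E)%E -[X in (_ - X)%E]/(\esum_(i in D) (q i)%:E)%E (sum_le_rsum p0 HA) (sum_le_rsum q0 HB).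
congr (_ - _)%E; apply: eq_esum => i Di.
  by rewrite funepos_fin funeposE/= fpq// EFin_max.
by rewrite funeneg_fin funenegE/= fpq// EFin_max.
Qed.

Definition abs_le D f B := sum_le D (fun i => `|f i|) B.

Lemma maxr0_ge0 (x : R) : 0 <= Num.max x 0.
Proof. by rewrite le_max lexx orbT. Qed.
#[local] Hint Resolve maxr0_ge0 : core.

Lemma maxr0_sub (x : R) : x = Num.max x 0 - Num.max (- x) 0.
Proof.
have [x0|/ltW x0] := leP 0 x.
  by rewrite max_r ?oppr_le0// subr0.
by rewrite max_l ?oppr_ge0// opprK add0r.
Qed.

Lemma rsum_posneg D f B : abs_le D f B ->
  [/\ sum_le D (fun i => Num.max (f i) 0) B, sum_le D (fun i => Num.max (- f i) 0) B
    & rsum D f = rsum D (fun i => Num.max (f i) 0) - rsum D (fun i => Num.max (- f i) 0)].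
Proof.
move=> H.
have H1 : sum_le D (fun i => Num.max (f i) 0) B.
  by apply: sum_le_mono H => i _; rewrite ge_max ler_norm normr_ge0.
have H2 : sum_le D (fun i => Num.max (- f i) 0) B.
  by apply: sum_le_mono H => i _; rewrite ge_max -normrN ler_norm normr_ge0.
split => //; apply: (rsum_sub _ _ _ H1 H2) => i _.
- exact: maxr0_sub.
- by rewrite le_max lexx orbT.
- by rewrite le_max lexx orbT.
Qed.

Lemma rsumD D f g A B : abs_le D f A -> abs_le D g B ->
  rsum D (fun i => f i + g i) = rsum D f + rsum D g.
Proof.
move=> /rsum_posneg[f1 f2 ->] /rsum_posneg[g1 g2 ->].
have d0 (u v : I -> R) i : D i -> 0 <= Num.max (u i) 0 + Num.max (v i) 0.
  by move=> _; rewrite addr_ge0.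
rewrite (@rsum_sub D _ (fun i => Num.max (f i) 0 + Num.max (g i) 0)
  (fun i => Num.max (- f i) 0 + Num.max (- g i) 0) (A + B) (A + B)).
- rewrite (rsum_ge0D _ _ f1 g1)// (rsum_ge0D _ _ f2 g2)//; lra.
- by move=> i _; rewrite {1}(maxr0_sub (f i)) {1}(maxr0_sub (g i)); lra.
- exact: d0.
- exact: (d0 (fun i => - f i) (fun i => - g i)).
- exact: sum_leD.
- exact: sum_leD.
Qed.

Lemma rsumN D f A : abs_le D f A -> rsum D (fun i => - f i) = - rsum D f.
Proof.
move=> /rsum_posneg[f1 f2 ->].
rewrite (@rsum_sub D _ (fun i => Num.max (- f i) 0) (fun i => Num.max (f i) 0) A A)//.
  by rewrite opprB.
by move=> i _; rewrite {1}(maxr0_sub (f i)); lra.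
Qed.

Lemma rsumZ D f A c : abs_le D f A -> rsum D (fun i => c * f i) = c * rsum D f.
Proof.
move=> H; wlog c0 : c / 0 <= c.
  move=> W; have [c0|c0] := leP 0 c; first exact: W.
  have nc0 : 0 <= - c by rewrite oppr_ge0 ltW.
  have := W (- c) nc0 => e.
  have H2 : abs_le D (fun i => - c * f i) (- c * A).
    apply: sum_le_mono (sum_leZ nc0 H) => i _; by rewrite normrM ger0_norm.
  have := rsumN H2; rewrite e mulNr opprK => <-.
  by congr rsum; apply/funext => i; rewrite mulNr opprK.
have [f1 f2 ->] := rsum_posneg H.
rewrite (@rsum_sub D _ (fun i => c * Num.max (f i) 0) (fun i => c * Num.max (- f i) 0) (c * A) (c * A)).
- by rewrite (rsum_ge0Z _ c0 f1)// (rsum_ge0Z _ c0 f2)// mulrBr.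
- by move=> i _; rewrite {1}(maxr0_sub (f i)) mulrBr.
- by move=> i _; rewrite mulr_ge0.
- by move=> i _; rewrite mulr_ge0.
- exact: sum_leZ.
- exact: sum_leZ.
Qed.

Lemma ler_norm_rsum D f B : abs_le D f B -> `|rsum D f| <= B.
Proof.
move=> /rsum_posneg[f1 f2 ->].
have h1 := rsum_le (fun i _ => maxr0_ge0 _) f1.
have h2 := rsum_le (fun i _ => maxr0_ge0 _) f2.
have h3 := rsum_ge0 (fun i (_ : D i) => maxr0_ge0 (f i)).
have h4 := rsum_ge0 (fun i (_ : D i) => maxr0_ge0 (- f i)).
by rewrite ler_norml; apply/andP; split; lra.
Qed.

Lemma eq_rsum D f g : (forall i, D i -> f i = g i) -> rsum D f = rsum D g.
Proof.
move=> fg; rewrite /rsum; congr (fine (_ - _)%E); apply: eq_esum => i Di.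
  by rewrite !funepos_fin fg.
by rewrite !funeneg_fin fg.
Qed.

Lemma ler_rsum D f g A B : (forall i, D i -> f i <= g i) ->
  abs_le D f A -> abs_le D g B -> rsum D f <= rsum D g.
Proof.
move=> fg HA HB; rewrite -subr_ge0.
have HN : abs_le D (fun i => - f i) A.
  by apply: sum_le_mono HA => i _; rewrite normrN.
rewrite -(rsumN HA) -(rsumD HB HN); apply: rsum_ge0 => i Di.
by rewrite subr_ge0 fg.
Qed.

Lemma rsum_split D (E : set I) f B : abs_le D f B ->
  rsum D f = rsum (D `&` E) f + rsum (D `&` ~` E) f.
Proof.
move=> H.
have sub F : D `&` F `<=` D by move=> i [].
have HE F : abs_le (D `&` F) f B by apply: sum_le_subset (sub F) _ H.
have [f1 f2 ->] := rsum_posneg H.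
have [g1 g2 ->] := rsum_posneg (HE E).
have [h1 h2 ->] := rsum_posneg (HE (~` E)).
have key p : (forall i, 0 <= p i) -> sum_le D p B -> sum_le (D `&` E) p B ->
    sum_le (D `&` ~` E) p B -> rsum D p = rsum (D `&` E) p + rsum (D `&` ~` E) p.
  move=> p0 k1 k2 k3; apply: EFin_inj; rewrite EFinD.
  rewrite -(sum_le_rsum _ k1)// -(sum_le_rsum _ k2)// -(sum_le_rsum _ k3)//.
  by rewrite -esumID// => i _; rewrite lee_fin.
rewrite (key _ _ f1 g1 h1)// (key _ _ f2 g2 h2)//; lra.
Qed.

Lemma rsum_bij (J : choiceType) (E : set J) D (e : J -> I) f :
  set_bij E D e -> rsum D f = rsum E (f \o e).
Proof.
move=> be; rewrite /rsum; congr (fine (_ - _)%E);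
  rewrite (@reindex_esum R _ _ E D e _ be); apply: eq_esum => i _.
  by rewrite !funeposE.
by rewrite !funenegE.
Qed.

End RealSum.

Section ComplexSum.
Variable R : realType.
Local Notation C := R[i].
Local Notation abs := (@Normc.normc R).
Implicit Types z w : C.

Lemma conjE z : (z^*)%R = z^*%C.
Proof. by []. Qed.

Lemma sqr_normcE z : abs z ^+ 2 = complex.Re z ^+ 2 + complex.Im z ^+ 2.
Proof. by case: z => x y; rewrite /= sqr_sqrtr// addr_ge0// sqr_ge0. Qed.

Lemma normc_ge0 z : 0 <= abs z.
Proof. by case: z => x y; exact: sqrtr_ge0. Qed.

Lemma ler_Re_normc z : `|complex.Re z| <= abs z.
Proof.
rewrite -ler_sqr ?nnegrE ?normc_ge0// sqr_normcE real_normK ?num_real//.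
by rewrite lerDl sqr_ge0.
Qed.

Lemma ler_Im_normc z : `|complex.Im z| <= abs z.
Proof.
rewrite -ler_sqr ?nnegrE ?normc_ge0// sqr_normcE real_normK ?num_real//.
by rewrite lerDr sqr_ge0.
Qed.

Lemma ler_normc_ReIm z : abs z <= `|complex.Re z| + `|complex.Im z|.
Proof.
rewrite -ler_sqr ?nnegrE ?normc_ge0 ?addr_ge0// sqr_normcE sqrrD.
rewrite !real_normK ?num_real// addrAC lerDl mulrn_wge0 ?mulr_ge0//.
Qed.

Lemma normc_real (x : R) : abs x%:C = `|x|.
Proof. by rewrite /= expr0n addr0 sqrtr_sqr. Qed.

Lemma normc_ge0_real (x : R) : 0 <= x -> abs x%:C = x.
Proof. by move=> x0; rewrite normc_real ger0_norm. Qed.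

Lemma ler_normc_sum (I : Type) (r : seq I) (P : pred I) (F : I -> C) :
  abs (\sum_(i <- r | P i) F i) <= \sum_(i <- r | P i) abs (F i).
Proof.
elim/big_ind2 : _ => //; first by rewrite Normc.normc0.
move=> x1 x2 y1 y2 h1 h2; exact: le_trans (le_normcD _ _) (lerD h1 h2).
Qed.

Variable I : choiceType.
Implicit Types (D : set I) (f g : I -> C).

Definition cabs_le D f B := sum_le D (fun i => abs (f i)) B.

Lemma cabs_le_Re D f B : cabs_le D f B -> abs_le D (fun i => complex.Re (f i)) B.
Proof. by apply: sum_le_mono => i _; exact: ler_Re_normc. Qed.

Lemma cabs_le_Im D f B : cabs_le D f B -> abs_le D (fun i => complex.Im (f i)) B.
Proof. by apply: sum_le_mono => i _; exact: ler_Im_normc. Qed.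

Lemma cabs_leD D f g A B : cabs_le D f A -> cabs_le D g B ->
  cabs_le D (fun i => f i + g i) (A + B).
Proof.
move=> HA HB; have H : sum_le D (fun i => abs (f i) + abs (g i)) (A + B).
  by apply: sum_leD => // i _; exact: normc_ge0.
by apply: sum_le_mono H => i _; exact: le_normcD.
Qed.

Lemma cabs_leZ D f B (c : C) : cabs_le D f B ->
  cabs_le D (fun i => c * f i) (abs c * B).
Proof.
move=> H; apply: sum_le_mono (sum_leZ (normc_ge0 c) H) => i _.
by rewrite Normc.normcM.
Qed.

Lemma csumD D f g A B : cabs_le D f A -> cabs_le D g B ->
  csum D (fun i => f i + g i) = csum D f + csum D g.
Proof.
move=> HA HB; have hRe := rsumD (cabs_le_Re HA) (cabs_le_Re HB).
have hIm := rsumD (cabs_le_Im HA) (cabs_le_Im HB).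
transitivity ((rsum D (fun i => complex.Re (f i)) + rsum D (fun i => complex.Re (g i))) +i*
  (rsum D (fun i => complex.Im (f i)) + rsum D (fun i => complex.Im (g i)))) => //.
rewrite -hRe -hIm; congr (_ +i* _);
  by apply: eq_rsum => i _; case: (f i) (g i) => [? ?] [? ?].
Qed.

Lemma abs_leZ D (h : I -> R) B (c : R) : abs_le D h B ->
  abs_le D (fun i => c * h i) (`|c| * B).
Proof.
move=> H; apply: sum_le_mono (sum_leZ (normr_ge0 c) H) => i _.
by rewrite normrM.
Qed.

Lemma csumZ D f B (c : C) : cabs_le D f B ->
  csum D (fun i => c * f i) = c * csum D f.
Proof.
move=> H; case: c => x y.
have h1 := cabs_le_Re H; have h2 := cabs_le_Im H.
rewrite /csum [RHS]/=; congr (_ +i* _).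
  rewrite -mulNr -(rsumZ x h1) -(rsumZ (- y) h2).
  rewrite -(rsumD (abs_leZ x h1) (abs_leZ (- y) h2)).
  by apply: eq_rsum => i _; case: (f i) => a b /=; rewrite mulNr.
rewrite -(rsumZ x h2) -(rsumZ y h1).
rewrite -(rsumD (abs_leZ x h2) (abs_leZ y h1)).
by apply: eq_rsum => i _; case: (f i).
Qed.

Lemma eq_csum D f g : (forall i, D i -> f i = g i) -> csum D f = csum D g.
Proof. by move=> fg; congr (_ +i* _); apply: eq_rsum => i Di; rewrite fg. Qed.

Lemma csum0 D : csum D (fun=> 0 : C) = 0.
Proof.
have e : rsum D (fun=> 0 : R) = 0.
  by rewrite rsum_ge0E// esum1.
by rewrite /csum /= e.
Qed.

Lemma csum_sum D (J : Type) (r : seq J) (c : J -> C) (F : J -> I -> C) (B : J -> R) :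
  (forall j, cabs_le D (F j) (B j)) ->
  csum D (fun i => \sum_(j <- r) c j * F j i) = \sum_(j <- r) c j * csum D (F j).
Proof.
move=> H.
suff [A HA ->] : exists2 A, cabs_le D (fun i => \sum_(j <- r) c j * F j i) A &
    csum D (fun i => \sum_(j <- r) c j * F j i) = \sum_(j <- r) c j * csum D (F j) by [].
elim: r => [|j r [A HA IH]].
  exists 0; last by rewrite big_nil -[RHS](csum0 D); apply: eq_csum => i _; rewrite big_nil.
  rewrite /cabs_le /sum_le esum1// => i _; by rewrite big_nil Normc.normc0.
have Hj := cabs_leZ (c j) (H j).
have e : (fun i => \sum_(k <- j :: r) c k * F k i) =
    (fun i => c j * F j i + \sum_(k <- r) c k * F k i).
  by apply/funext => i; rewrite big_cons.
exists (abs (c j) * B j + A); first by rewrite e; exact: cabs_leD.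
by rewrite e (csumD Hj HA) IH (csumZ _ (H j)) big_cons.
Qed.

(** The factor 2 is the price of bounding the real and the imaginary part separately. *)
Lemma ler_normc_csum D f B : cabs_le D f B -> abs (csum D f) <= 2 * B.
Proof.
move=> H; apply: le_trans (ler_normc_ReIm _) _.
have h1 := ler_norm_rsum (cabs_le_Re H).
have h2 := ler_norm_rsum (cabs_le_Im H).
by rewrite /csum/=; lra.
Qed.

Lemma csum_split D (E : set I) f B : cabs_le D f B ->
  csum D f = csum (D `&` E) f + csum (D `&` ~` E) f.
Proof.
move=> H; rewrite /csum [RHS]/=.
by rewrite (rsum_split E (cabs_le_Re H)) (rsum_split E (cabs_le_Im H)).
Qed.

Lemma csum_real D (h : I -> R) (c : C) B : abs_le D h B ->
  csum D (fun i => c * (h i)%:C) = c * (rsum D h)%:C.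
Proof.
move=> H.
have H' : cabs_le D (fun i => (h i)%:C) B.
  by apply: sum_le_mono H => i _; rewrite normc_real.
rewrite (csumZ _ H'); congr (_ * _); rewrite /csum/=; congr (_ +i* _).
by rewrite rsum_ge0E// esum1.
Qed.

End ComplexSum.

Lemma csum_bij (R : realType) (I J : choiceType) (E : set J) (D : set I)
    (e : J -> I) (f : I -> R[i]) :
  set_bij E D e -> csum D f = csum E (f \o e).
Proof. by move=> be; rewrite /csum !(rsum_bij _ be). Qed.

(** The columns of [cokermx A] are killed by [A], hence by [B]; and [B *m cokermx A = 0] is
    inclusion of row spaces. *)
Lemma submx_of_kernel (F : fieldType) (m1 m2 n : nat) (A : 'M[F]_(m1, n)) (B : 'M[F]_(m2, n)) :
  (forall v : 'cV_n, A *m v = 0 -> B *m v = 0) -> (B <= A)%MS.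
Proof.
move=> AB; rewrite submxE; apply/eqP/matrixP => i j.
have /matrixP/(_ i 0) : B *m col j (cokermx A) = 0.
  by apply: AB; rewrite colE mulmxA mulmx_coker mul0mx.
by rewrite colE mulmxA -colE !mxE.
Qed.

(* The matrices [B] with [B *m M x] bounded form a left ideal, hence are
   characterised by their common kernel. *)
Section BoundedIdeal.
Variables (R : realType) (n : nat) (X : Type) (S : set X) (M : X -> 'M[R[i]]_n).
Local Notation C := R[i].
Local Notation abs := (@Normc.normc R).

Definition bounded_mx (A : X -> 'M[C]_n) := exists K : R, forall x, S x ->
  forall i j, abs (A x i j) <= K.

Lemma bounded_mxD (A B : X -> 'M[C]_n) : bounded_mx A -> bounded_mx B ->
  bounded_mx (fun x => A x + B x).
Proof.
move=> [K HK] [L HL]; exists (K + L) => x Sx i j; rewrite mxE.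
by apply: le_trans (le_normcD _ _) _; rewrite lerD ?HK ?HL.
Qed.

Lemma bounded_mxM (B : 'M[C]_n) (A : X -> 'M[C]_n) : bounded_mx A ->
  bounded_mx (fun x => B *m A x).
Proof.
move=> [K HK]; exists (\sum_i \sum_k abs (B i k) * `|K|) => x Sx i j.
rewrite mxE; apply: le_trans (ler_normc_sum _ _ _) _.
apply: (@le_trans _ _ (\sum_k abs (B i k) * `|K|)).
  apply: ler_sum => k _; rewrite Normc.normcM ler_wpM2l ?normc_ge0//.
  by apply: le_trans (HK _ Sx _ _) (ler_norm _).
rewrite [leRHS](bigD1 i)//= lerDl; apply: sumr_ge0 => l _; apply: sumr_ge0 => k _.
by rewrite mulr_ge0// normc_ge0.
Qed.

Definition bounding (B : 'M[C]_n) := bounded_mx (fun x => B *m M x).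

Lemma boundingD A B : bounding A -> bounding B -> bounding (A + B).
Proof.
move=> HA HB; have [K HK] := bounded_mxD HA HB.
by exists K => x Sx i j; rewrite mulmxDl; exact: HK.
Qed.

Lemma boundingM A B : bounding B -> bounding (A *m B).
Proof.
move=> HB; have [K HK] := bounded_mxM A HB.
by exists K => x Sx i j; rewrite -mulmxA; exact: HK.
Qed.

Lemma bounding_submx (A B : 'M[C]_n) : bounding B -> (A <= B)%MS -> bounding A.
Proof. by move=> HB /submxP[D ->]; exact: boundingM. Qed.

Lemma bounding0 : bounding 0.
Proof.
by exists 0 => x _ i j; rewrite mul0mx mxE Normc.normc0.
Qed.

(** An element [A0] of maximal rank generates the ideal: the sum of the row spaces of [A0] and of
    another element is again the row space of an element, so its rank cannot be larger. The common
    kernel is then the kernel of [A0]. *)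
Lemma bounding_of_kernel (B : 'M[C]_n) :
  (forall v : 'cV[C]_n, (forall A, bounding A -> A *m v = 0) -> B *m v = 0) ->
  bounding B.
Proof.
move=> HB.
have ex : exists r, `[< exists2 A, bounding A & \rank A = r >].
  by exists 0%N; apply/asboolP; exists 0; [exact: bounding0|exact: mxrank0].
have ub r : `[< exists2 A, bounding A & \rank A = r >] -> (r <= n)%N.
  by move=> /asboolP[A _ <-]; exact: rank_leq_row.
case: (ex_maxnP ex ub) => r /asboolP[A0 HA0 rA0] rmax.
have sub A : bounding A -> (A <= A0)%MS.
  move=> HA; have HS : bounding (A + A0)%MS.
    have /sub_addsmxP[[u v] /= ->] := submx_refl (A + A0)%MS.
    by apply: boundingD; exact: boundingM.
  apply: (submx_trans (addsmxSl A A0)).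
  have := mxrank_leqif_sup (addsmxSr A A0) => h.
  rewrite -(geq_leqif h) rA0; apply: rmax; apply/asboolP.
  by exists (A + A0)%MS.
apply: (bounding_submx HA0); apply: submx_of_kernel => v A0v.
by apply: HB => A /sub/submxP[D ->]; rewrite -mulmxA A0v mulmx0.
Qed.

End BoundedIdeal.

(** * Stabilizer of the cusp *)

Section Affine.
Variable R : realType.
Local Notation C := R[i].
Local Notation abs := (@Normc.normc R).
Implicit Types (M N : SL2 R) (g h : PSL2 R).

Lemma mulmx2E (A B : 'M[C]_2) i j : (A *m B) i j = A i 0 * B 0 j + A i 1 * B 1 j.
Proof.
rewrite mxE big_ord_recl big_ord1; congr (_ + A i _ * B _ j); exact/val_inj.
Qed.

Lemma sl2_detE M : M 0 0 * M 1 1 - M 0 1 * M 1 0 = 1.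
Proof.
have := eqP (sl2_det M); rewrite (expand_det_row _ 0) big_ord_recl big_ord1.
rewrite /cofactor !det_mx11 !mxE /= addn0 expr0 mul1r expr1 mulN1r mulrN.
by move=> <-; congr (M _ _ * M _ _ - M _ _ * M _ _); exact/val_inj.
Qed.

(* The action [w |-> al g * w + be g] on C of an element fixing oo. *)
Definition al g : C := repr g 0 0 ^+ 2.
Definition be g : C := repr g 0 0 * repr g 0 1.

Lemma alE M : al (to_psl2 M) = M 0 0 ^+ 2.
Proof. by rewrite /al; case: (psl2_repr M) => -> //=; rewrite !mxE sqrrN. Qed.

Lemma beE M : be (to_psl2 M) = M 0 0 * M 0 1.
Proof. by rewrite /be; case: (psl2_repr M) => -> //=; rewrite !mxE mulrNN. Qed.

Lemma mobius_inftyP M : mobius (to_psl2 M) None = None <-> M 1 0 = 0.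
Proof. by rewrite mobiusE /=; case: eqP. Qed.

Lemma fix_inftyP g : mobius g None = None <-> repr g 1 0 = 0.
Proof. by rewrite -{1}(psl2_reprK g) mobius_inftyP. Qed.

Lemma psl2_mul_repr g h : (g * h)%g = to_psl2 (repr g * repr h)%g.
Proof. by []. Qed.

Lemma fix_inftyM g h : mobius g None = None -> mobius h None = None ->
  mobius (g * h)%g None = None.
Proof.
move=> /fix_inftyP g0 /fix_inftyP h0; rewrite psl2_mul_repr mobius_inftyP.
by rewrite [LHS]mulmx2E g0 h0 mul0r mulr0 addr0.
Qed.

Lemma fix_infty1 : mobius (1%g : PSL2 R) None = None.
Proof. by apply/mobius_inftyP; rewrite /= mxE. Qed.

Lemma fix_infty_diag g : mobius g None = None -> repr g 0 0 * repr g 1 1 = 1.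
Proof. by move=> /fix_inftyP g0; have := sl2_detE (repr g); rewrite g0 mulr0 subr0. Qed.

Lemma fix_inftyV g : mobius g None = None -> mobius (g^-1)%g None = None.
Proof.
move=> gI; have /fix_inftyP g0 := gI; have gd := fix_infty_diag gI.
have := mulgV g; rewrite psl2_mul_repr => e.
have /mobius_inftyP : mobius (to_psl2 (repr g * repr (g^-1)%g)%g) None = None.
  by rewrite e fix_infty1.
rewrite [X in X = _]mulmx2E g0 mul0r add0r => /eqP.
rewrite mulf_eq0 => /orP[/eqP d0|/eqP c0]; last exact/fix_inftyP.
by move: gd; rewrite d0 mulr0 => /eqP; rewrite eq_sym oner_eq0.
Qed.

Lemma al1 : al 1%g = 1.
Proof. by rewrite (alE 1%g) /= mxE expr1n. Qed.

Lemma be1 : be 1%g = 0.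
Proof. by rewrite (beE 1%g) /= !mxE mulr0. Qed.

Lemma alM g h : mobius g None = None -> mobius h None = None ->
  al (g * h)%g = al g * al h.
Proof.
move=> _ /fix_inftyP h0; rewrite psl2_mul_repr alE.
by rewrite [X in X ^+ 2]mulmx2E h0 mulr0 addr0 exprMn.
Qed.

Lemma beM g h : mobius g None = None -> mobius h None = None ->
  be (g * h)%g = al g * be h + be g.
Proof.
move=> _ hI; have /fix_inftyP h0 := hI; have hd := fix_infty_diag hI.
rewrite psl2_mul_repr beE [X in X * _]mulmx2E [X in _ * X]mulmx2E h0 mulr0 addr0.
rewrite /al /be.
have -> : repr g 0 0 * repr h 0 0 * (repr g 0 0 * repr h 0 1 + repr g 0 1 * repr h 1 1)
  = repr g 0 0 ^+ 2 * (repr h 0 0 * repr h 0 1) + repr g 0 0 * repr g 0 1 * (repr h 0 0 * repr h 1 1) by ring.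
by rewrite hd mulr1.
Qed.

Lemma alV g : mobius g None = None -> al g * al (g^-1)%g = 1.
Proof. by move=> gI; rewrite -alM ?fix_inftyV// mulgV al1. Qed.

Lemma al_neq0 g : mobius g None = None -> al g != 0.
Proof.
by move=> gI; apply/eqP => a0; have := alV gI; rewrite a0 mul0r => /eqP; rewrite eq_sym oner_eq0.
Qed.

Lemma ord2P (i : 'I_2) : i = 0 \/ i = 1.
Proof. by case: i => [[|[|//]] lt]; [left|right]; exact/val_inj. Qed.

Lemma mx2P (A B : 'M[C]_2) : A 0 0 = B 0 0 -> A 0 1 = B 0 1 ->
  A 1 0 = B 1 0 -> A 1 1 = B 1 1 -> A = B.
Proof.
move=> h00 h01 h10 h11; apply/matrixP => i j.
by case: (ord2P i) => ->; case: (ord2P j) => ->.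
Qed.

(** [al g] determines the entry [a] up to sign, and [be g] then determines [b]; the sign is the one
    lost in PSL(2,C). *)
Lemma fix_infty_inj g h : mobius g None = None -> mobius h None = None ->
  al g = al h -> be g = be h -> g = h.
Proof.
move=> gI hI eal ebe; rewrite -(psl2_reprK g) -(psl2_reprK h); apply/to_psl2_eq.
have /fix_inftyP g0 := gI; have /fix_inftyP h0 := hI.
have gd := fix_infty_diag gI; have hd := fix_infty_diag hI.
have gn0 : repr g 0 0 != 0.
  by apply/eqP => e; move: gd; rewrite e mul0r => /eqP; rewrite eq_sym oner_eq0.
have : repr h 0 0 ^+ 2 == repr g 0 0 ^+ 2 by rewrite -/(al g) -/(al h) eal.
rewrite eqf_sqr => /orP[]/eqP e; [left|right]; apply/val_inj; apply: mx2P => /=.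
- exact: e.
- by apply: (mulfI gn0); rewrite -/(be g) ebe /be e.
- by rewrite g0 h0.
- by apply: (mulfI gn0); rewrite gd -hd e.
- by rewrite mxE.
- by apply: (mulfI gn0); rewrite mxE mulrN -/(be g) ebe /be e mulNr opprK.
- by rewrite mxE g0 h0 oppr0.
- by apply: (mulfI gn0); rewrite mxE mulrN gd -hd e mulNr opprK.
Qed.

Lemma translation_fix (b : C) : mobius (translation b) None = None.
Proof. by apply/mobius_inftyP; rewrite /= mxE. Qed.

Lemma al_translation (b : C) : al (translation b) = 1.
Proof. by rewrite alE /= mxE /= expr1n. Qed.

Lemma be_translation (b : C) : be (translation b) = b.
Proof. by rewrite beE /= !mxE /= mul1r. Qed.

Lemma translation_inj : injective (@translation R).
Proof. by move=> b c e; rewrite -(be_translation b) e be_translation. Qed.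

Lemma fix_infty_translation g : mobius g None = None -> al g = 1 ->
  g = translation (be g).
Proof.
move=> gI g1; apply: fix_infty_inj => //; first exact: translation_fix.
  by rewrite al_translation.
by rewrite be_translation.
Qed.

Lemma translationD (b c : C) : (translation b * translation c)%g = translation (b + c) :> PSL2 R.
Proof.
have H := fix_inftyM (translation_fix b) (translation_fix c).
rewrite (fix_infty_translation H); last first.
  by rewrite alM ?al_translation ?mulr1//; exact: translation_fix.
rewrite beM ?al_translation ?be_translation ?mul1r; try exact: translation_fix.
by rewrite addrC.
Qed.

Lemma translation0 : translation 0 = 1%g :> PSL2 R.
Proof.
by rewrite [RHS](fix_infty_translation fix_infty1 al1) be1.
Qed.

Lemma translationN (b : C) : translation (- b) = ((translation b)^-1)%g :> PSL2 R.
Proof.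
apply/esym; rewrite -[LHS]mulg1 -translation0 -(subrr b) -translationD mulgA.
by rewrite mulVg mul1g.
Qed.

Lemma conj_translation g (b : C) : mobius g None = None ->
  (g * translation b * g^-1)%g = translation (al g * b).
Proof.
move=> gI; have gV := fix_inftyV gI; have tI := translation_fix b.
have gt := fix_inftyM gI tI.
have H := fix_inftyM gt gV.
have e1 : al (g * translation b * g^-1)%g = 1.
  by rewrite !alM// al_translation mulr1 alV.
rewrite (fix_infty_translation H e1) !beM// !alM// al_translation mulr1 be_translation.
congr translation.
have := beM gI gV; rewrite mulgV be1 => h; rewrite addrCA -h addr0//.
Qed.

Lemma translation_expg (b : C) m : (translation b ^+ m)%g = translation (b *+ m) :> PSL2 R.
Proof.
elim: m => [|m IH]; first by rewrite expg0 mulr0n translation0.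
by rewrite expgS IH translationD mulrS.
Qed.

Lemma translation_parabolic (b : C) : translation b <> 1%g :> PSL2 R -> parabolic (translation b).
Proof.
move=> bn; apply/parabolicE; split => //.
rewrite /mxtrace big_ord_recl big_ord1 !mxE eqxx /=.
by ring.
Qed.

(** From [|al g| = 1] follows [|a| = |d| = 1]; as [c = 0], the denominator [D] of the action is 1
    and the height is preserved. *)
Lemma h3_act_fix g P : mobius g None = None -> abs (al g) = 1 ->
  h3_act g P = (of_cplx (al g * h3_z P + be g), h3_r P).
Proof.
move=> gI a1; have /fix_inftyP g0 := gI; have gd := fix_infty_diag gI.
have aa : abs (repr g 0 0) = 1.
  move: a1; rewrite /al expr2 Normc.normcM -expr2 => /eqP.
  by rewrite sqrf_eq1 => /orP[]/eqP // e; have := normc_ge0 (repr g 0 0); rewrite e; lra.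
have ad : abs (repr g 1 1) = 1.
  by have := congr1 abs gd; rewrite Normc.normcM aa mul1r Normc.normc1.
have dd : repr g 1 1 * (repr g 1 1)^*%C = 1.
  rewrite -sqr_normc normc_def -sqr_normcE ad expr1n sqrtr1.
  by rewrite rmorph1 expr1n.
have cd : (repr g 1 1)^*%C = repr g 0 0.
  by rewrite -[LHS]mul1r -gd -mulrA dd mulr1.
rewrite /h3_act /h3_act_sl2; cbv zeta.
rewrite g0 mul0r add0r ad Normc.normc0 !conjE conjc0 cd.
rewrite !expr1n expr0n /= mul0r addr0 mulr0 mul0r addr0 divr1.
congr (of_cplx _, _); rewrite ?rmorph1 ?divr1 /al /be//.
by ring.
Qed.

Definition actz g (z : C) : C := al g * z + be g.

Lemma actzM g h z : mobius g None = None -> mobius h None = None ->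
  actz (g * h)%g z = actz g (actz h z).
Proof. by move=> gI hI; rewrite /actz alM// beM//; ring. Qed.

Lemma actz1 z : actz 1%g z = z.
Proof. by rewrite /actz al1 be1 mul1r addr0. Qed.

Lemma mobius_fix g z : mobius g None = None -> mobius g (Some z) = Some (actz g z).
Proof.
move=> gI; have /fix_inftyP g0 := gI; have gd := fix_infty_diag gI.
have dn0 : repr g 1 1 != 0.
  by apply/eqP => e; move: gd; rewrite e mulr0 => /eqP; rewrite eq_sym oner_eq0.
rewrite /mobius /= g0 mul0r add0r (negPf dn0); congr Some.
have -> : (repr g 1 1)^-1 = repr g 0 0 by apply: (mulfI dn0); rewrite divff// mulrC gd.
by rewrite /actz /al /be; ring.
Qed.

End Affine.

Section Lattice.
Variables (R : realType) (tau : R[i]).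
Hypothesis tau_nonreal : complex.Im tau != 0.
Local Notation C := R[i].
Local Notation abs := (@Normc.normc R).
Local Notation L := (lattice tau).
Implicit Types z w b : C.

Definition ycoord w : R := complex.Im w / complex.Im tau.
Definition xcoord w : R := complex.Re w - ycoord w * complex.Re tau.

Lemma coordE w : w = (xcoord w)%:C + (ycoord w)%:C * tau.
Proof.
rewrite /xcoord /ycoord; case: w => u v; move: tau_nonreal; case: tau => a b /= b0.
by apply/eqP; rewrite eq_complex /=; apply/andP; split; apply/eqP; field.
Qed.

Lemma ReB z w : complex.Re (z - w) = complex.Re z - complex.Re w.
Proof. by case: z w => [? ?] [? ?]. Qed.

Lemma ImB z w : complex.Im (z - w) = complex.Im z - complex.Im w.
Proof. by case: z w => [? ?] [? ?]. Qed.

Lemma ycoordB z w : ycoord (z - w) = ycoord z - ycoord w.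
Proof. by rewrite /ycoord ImB mulrBl. Qed.

Lemma xcoordB z w : xcoord (z - w) = xcoord z - xcoord w.
Proof. by rewrite /xcoord ycoordB ReB; ring. Qed.

Lemma intC (m : int) : m%:~R = (m%:~R : R)%:C :> C.
Proof. by rewrite rmorph_int. Qed.

Lemma coord_real (x y : R) :
  xcoord (x%:C + y%:C * tau) = x /\ ycoord (x%:C + y%:C * tau) = y.
Proof.
have y1 : ycoord (x%:C + y%:C * tau) = y.
  rewrite /ycoord; move: tau_nonreal; case: tau => a b /= b0; field.
  exact: b0.
split => //; rewrite /xcoord y1; case: tau => a b /=; ring.
Qed.

Lemma lattice_coord b : L b -> exists m n : int, xcoord b = m%:~R /\ ycoord b = n%:~R.
Proof.
move=> [m [n ->]]; exists m, n; rewrite !intC; exact: coord_real.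
Qed.

Lemma lattice1 : L 1.
Proof. by exists 1, 0; rewrite mul0r addr0. Qed.

Lemma latticeN b : L b -> L (- b).
Proof.
by move=> [m [n ->]]; exists (- m), (- n); rewrite !rmorphN/=; ring.
Qed.

(** Origin of the constant: [y^2 <= |w|^2 / (Im tau)^2] and [x^2 <= 2 (Re w)^2 + 2 y^2 (Re tau)^2]
    for the coordinates [x], [y] of [w] in the basis 1, tau. *)
Definition coord_const : R := 2 + (2 * abs tau ^+ 2 + 1) / complex.Im tau ^+ 2.

Lemma Im_sqr_gt0 : 0 < complex.Im tau ^+ 2.
Proof. by rewrite lt0r sqrf_eq0 tau_nonreal sqr_ge0. Qed.

Lemma coord_const_ge1 : 1 <= coord_const.
Proof.
have : 0 <= (2 * abs tau ^+ 2 + 1) / complex.Im tau ^+ 2.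
  by rewrite divr_ge0 ?ltW ?Im_sqr_gt0// ltr_wpDl// mulr_ge0// sqr_ge0.
rewrite /coord_const; lra.
Qed.

Lemma coord_le w : xcoord w ^+ 2 + ycoord w ^+ 2 <= coord_const * abs w ^+ 2.
Proof.
have I0 := Im_sqr_gt0.
rewrite /coord_const; have yE : ycoord w ^+ 2 = complex.Im w ^+ 2 / complex.Im tau ^+ 2.
  by rewrite /ycoord exprMn exprVn.
have hw := sqr_normcE w; have ht := sqr_normcE tau.
have h1 : xcoord w ^+ 2 <= 2 * complex.Re w ^+ 2 + 2 * (ycoord w ^+ 2 * complex.Re tau ^+ 2).
  rewrite /xcoord; have := sqr_ge0 (complex.Re w + ycoord w * complex.Re tau); nra.
have h2 : ycoord w ^+ 2 <= abs w ^+ 2 / complex.Im tau ^+ 2.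
  by rewrite yE ler_pM2r ?invr_gt0// hw lerDr sqr_ge0.
have h3 : complex.Re tau ^+ 2 <= abs tau ^+ 2 by rewrite ht lerDl sqr_ge0.
have h4 : complex.Re w ^+ 2 <= abs w ^+ 2 by rewrite hw lerDl sqr_ge0.
have h5 : ycoord w ^+ 2 * complex.Re tau ^+ 2 <= abs w ^+ 2 / complex.Im tau ^+ 2 * abs tau ^+ 2.
  by apply: ler_pM; rewrite ?sqr_ge0.
rewrite mulrDl (_ : _ / _ * _ = 2 * (abs w ^+ 2 / complex.Im tau ^+ 2 * abs tau ^+ 2) + abs w ^+ 2 / complex.Im tau ^+ 2).
  lra.
by field.
Qed.

Lemma lattice_near w : exists2 b, L b & abs (w - b) <= 1 + abs tau.
Proof.
exists ((Num.floor (xcoord w))%:~R + (Num.floor (ycoord w))%:~R * tau).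
  by exists (Num.floor (xcoord w)), (Num.floor (ycoord w)).
have frac (x : R) : abs (x - (Num.floor x)%:~R)%:C <= 1.
  rewrite normc_ge0_real ?subr_ge0//.
    by rewrite lerBlDl ltW// -[X in _ + X]/(1%:~R) -intrD floorD1_gt.
  exact: floor_le.
rewrite {1}(coordE w) !intC.
have -> : (xcoord w)%:C + (ycoord w)%:C * tau -
   ((Num.floor (xcoord w))%:~R%:C + (Num.floor (ycoord w))%:~R%:C * tau) =
   (xcoord w - (Num.floor (xcoord w))%:~R)%:C + (ycoord w - (Num.floor (ycoord w))%:~R)%:C * tau.
  by rewrite !rmorphB/=; ring.
apply: le_trans (le_normcD _ _) _; apply: lerD; first exact: frac.
by rewrite Normc.normcM -[leRHS]mul1r ler_wpM2r ?normc_ge0.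
Qed.

Lemma lattice_min : exists2 m : R, 0 < m & forall b, L b -> b != 0 -> m <= abs b.
Proof.
have It : 0 < `|complex.Im tau| by rewrite normr_gt0.
have int1 (n : int) : n != 0 -> 1 <= `|n%:~R : R|.
  by move=> n0; rewrite -intr_norm -[1]/(1%:~R) ler_int -gtz0_ge1 normr_gt0.
exists (Num.min 1 `|complex.Im tau|); first by rewrite lt_min ltr01 It.
move=> _ [m [n ->]] b0; have [n0|n0] := eqVneq n 0.
  move: b0; rewrite n0 mul0r addr0 intC normc_real => b0; rewrite ge_min int1//.
  by apply: contra_neq b0 => ->.
rewrite ge_min; apply/orP; right.
apply: le_trans (ler_Im_normc _).
have -> : complex.Im (m%:~R + n%:~R * tau) = n%:~R * complex.Im tau.
  by rewrite !intC; case: tau => a b /=; ring.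
by rewrite normrM -[leLHS]mul1r ler_pM2r// int1.
Qed.

End Lattice.

Section CuspGroup.
Variables (R : realType) (Gamma : set (PSL2 R)) (tau : R[i]).
Hypothesis G_sub : is_subgroup Gamma.
Hypothesis tau_nonreal : complex.Im tau != 0.
Hypothesis Gmax :
  max_tf_parabolic_subgroup (stab_infty Gamma) (@translation R @` lattice tau).
Local Notation C := R[i].
Local Notation abs := (@Normc.normc R).
Local Notation L := (lattice tau).
Local Notation G := (stab_infty Gamma).
Implicit Types (g h : PSL2 R) (z w b : C).

Lemma stabM g h : G g -> G h -> G (g * h)%g.
Proof.
by case: G_sub => _ GM _ [? ?] [? ?]; split; [exact: GM|exact: fix_inftyM].
Qed.

Lemma stabV g : G g -> G (g^-1)%g.
Proof. by case: G_sub => _ _ GV [? ?]; split; [exact: GV|exact: fix_inftyV]. Qed.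

Lemma stab1 : G 1%g.
Proof. by case: G_sub => G1 _ _; split => //; exact: fix_infty1. Qed.

Lemma stab_fix g : G g -> mobius g None = None.
Proof. by case. Qed.

Lemma stab_translation b : L b -> G (translation b).
Proof. by move=> Lb; have [[_ + _ _] _] := Gmax; apply; exists b. Qed.

(** All translations in the stabilizer together form a torsion-free parabolic subgroup containing
    the lattice, so maximality leaves no room for further ones. *)
Lemma translation_stab b : G (translation b) -> L b.
Proof.
move=> Gb.
pose H' : set (PSL2 R) := @translation R @` [set c | G (translation c)].
have H'E : H' = @translation R @` L.
  have [_] := Gmax; apply; last first.
    by move=> _ [c Lc <-]; exists c => //; exact: stab_translation.
  split.
  - split.
    + by exists 0 => /=; [rewrite translation0; exact: stab1|exact: translation0].
    + move=> _ _ [c Gc <-] [d Gd <-]; exists (c + d); last by rewrite translationD.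
      by rewrite /= -translationD; exact: stabM.
    + move=> _ [c Gc <-]; exists (- c); last by rewrite translationN.
      by rewrite /= translationN; exact: stabV.
  - by move=> _ [c Gc <-].
  - move=> _ m [c Gc <-] m0; rewrite translation_expg -translation0.
    move=> /translation_inj/eqP; rewrite mulrn_eq0 (gtn_eqF m0)/= => /eqP ->//.
  - by move=> _ [c Gc <-]; exact: translation_parabolic.
have : H' (translation b) by exists b.
by rewrite H'E => -[c Lc /translation_inj <-].
Qed.

Lemma al_lattice g b : G g -> L b -> L (al g * b).
Proof.
move=> Gg Lb; apply: translation_stab; rewrite -conj_translation ?stab_fix//.
by apply: stabM; [apply: stabM => //; exact: stab_translation|exact: stabV].
Qed.

(** Conjugation by [g] multiplies the lattice by [al g], so all powers of [al g] are nonzero lattice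
    vectors. If [|al g| < 1] they would tend to 0. Applied to the inverse as well, this shows that
    the stabilizer acts on C by isometries. *)
Lemma al_norm_ge1 g : G g -> 1 <= abs (al g).
Proof.
move=> Gg; rewrite leNgt; apply/negP => a1.
have [m m0 mmin] := lattice_min tau_nonreal.
have Lk k : L (al g ^+ k).
  elim: k => [|k IH]; first exact: lattice1.
  by rewrite exprS; exact: al_lattice.
have absX k : abs (al g ^+ k) = abs (al g) ^+ k.
  elim: k => [|k IH]; first by rewrite !expr0 Normc.normc1.
  by rewrite !exprS Normc.normcM IH.
have : (fun k => abs (al g) ^+ k) @ \oo --> (0 : R).
  by apply: cvg_expr; rewrite ger0_norm ?normc_ge0.
move=> /cvgrPdist_lt/(_ _ m0)[N _ /(_ N (leqnn N))] /=.
rewrite sub0r normrN ger0_norm ?exprn_ge0 ?normc_ge0// -absX ltNge mmin//.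
by rewrite expf_neq0// al_neq0// stab_fix.
Qed.

Lemma al_norm1 g : G g -> abs (al g) = 1.
Proof.
move=> Gg; apply/eqP; rewrite eq_le al_norm_ge1// andbT.
have := al_norm_ge1 (stabV Gg).
have := congr1 abs (alV (stab_fix Gg)); rewrite Normc.normcM Normc.normc1 => e h.
by rewrite -e ler_peMr// normc_ge0.
Qed.

Lemma be_lattice g h : G g -> G h -> al g = al h -> L (be g - be h).
Proof.
move=> Gg Gh e; apply: translation_stab.
have GV := stabV Gh.
have -> : translation (be g - be h) = (g * h^-1)%g.
  have aV : al (g * h^-1)%g = 1 by rewrite alM ?stab_fix// e alV// stab_fix.
  rewrite [RHS](fix_infty_translation _ aV); last by apply: fix_inftyM; exact: stab_fix.
  congr translation; rewrite beM ?stab_fix// e addrC; congr (_ + _).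
  have := beM (stab_fix Gh) (stab_fix GV); rewrite mulgV be1 => /eqP.
  by rewrite eq_sym addr_eq0 => /eqP.
exact: stabM.
Qed.

Lemma stab_act g P : G g -> h3_act g P = (of_cplx (actz g (h3_z P)), h3_r P).
Proof. by move=> Gg; rewrite h3_act_fix ?stab_fix// al_norm1. Qed.

Lemma abs_actzB g z w : G g -> abs (actz g z - actz g w) = abs (z - w).
Proof.
move=> Gg; rewrite /actz opprD addrACA subrr addr0 -mulrBr Normc.normcM.
by rewrite al_norm1// mul1r.
Qed.

(** A code by four integers: the cell of the linear part, and the cell of the image of [z] relative
    to that of [w]. It is injective because [al g] is itself a lattice vector, hence known from its
    cell, and two elements with the same linear part move [z] to points that differ by a lattice
    vector. *)
Let label z w g : (int * int) * (int * int) :=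
  ((Num.floor (xcoord tau (al g)), Num.floor (ycoord tau (al g))),
   (Num.floor (xcoord tau (actz g z)) - Num.floor (xcoord tau w),
    Num.floor (ycoord tau (actz g z)) - Num.floor (ycoord tau w))).

Let label_inj z w : set_inj G (label z w).
Proof.
move=> g h /set_mem Gg /set_mem Gh [ex ey epx epy].
have La k : G k -> L (al k).
  by move=> Gk; rewrite -[al k]mulr1; apply: al_lattice => //; exact: lattice1.
have ea : al g = al h.
  have [m [n [xm yn]]] := lattice_coord tau_nonreal (La _ Gg).
  have [p [q [xp yq]]] := lattice_coord tau_nonreal (La _ Gh).
  move: ex ey; rewrite xm yn xp yq !intrKfloor => mp nq.
  by rewrite (coordE tau_nonreal (al g)) (coordE tau_nonreal (al h)) xm yn xp yq mp nq.
have Lb : L (actz g z - actz h z).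
  by rewrite /actz ea opprD addrACA subrr add0r; exact: be_lattice.
have [m [n [xm yn]]] := lattice_coord tau_nonreal Lb.
have same (x y : R) (k : int) : Num.floor x = Num.floor y -> x - y = k%:~R -> k = 0.
  move=> e xy; have : x = y + k%:~R by rewrite -xy; ring.
  move=> xE; move: e; rewrite xE floorDrz ?intr_int// intrKfloor => /eqP.
  by rewrite addrC -subr_eq0 addrK => /eqP.
have m0 : m = 0.
  apply: (same _ _ _ (addIr _ epx)); by rewrite -xcoordB.
have n0 : n = 0.
  apply: (same _ _ _ (addIr _ epy)); by rewrite -ycoordB.
have eact : actz g z = actz h z.
  apply/eqP; rewrite -subr_eq0 (coordE tau_nonreal (actz g z - actz h z)) xm yn m0 n0.
  by rewrite !rmorph0 mul0r addr0.
apply: fix_infty_inj; rewrite ?stab_fix//.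
by move: eact; rewrite /actz ea => /addrI.
Qed.

(** For [rho^2 = r r'] this dominates [delta^-2 / rho^2] up to a constant, which is the size of one
    second difference. *)
Definition lattice_weight (rho : R) z w : R := rho ^+ 2 / (rho ^+ 2 + abs (w - z) ^+ 2) ^+ 2.

(** Up to constants the weight is at most a product of two one-dimensional terms
    [rho / (rho^2 + p^2)] in the integer coordinates of the image, whose sums are bounded uniformly
    in [rho]. The linear part is coded by two more integers, given the summable weights [u 1]; these
    are bounded below because [|al g| = 1], so the finiteness of the rotation group need not be
    proved separately. *)
Lemma sum_le_lattice_weight (Y : R) : 0 < Y -> exists2 K : R, 0 < K &
  forall rho z w, Y <= rho ->
  sum_le G (fun g => lattice_weight rho (actz g z) w) K.
Proof.
move=> Y0.
pose Ct := coord_const tau; have Ct1 : 1 <= Ct := coord_const_ge1 tau_nonreal.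
pose u (rho : R) (m : int) := rho / (rho ^+ 2 + m%:~R ^+ 2).
have u0 rho m : 0 < rho -> 0 <= u rho m.
  by move=> r0; rewrite divr_ge0 ?addr_ge0 ?sqr_ge0// ltW.
(* The first factor absorbs the rounding error, [p^2 <= 2 x^2 + 2] with [2 <= 2 rho^2 / Y^2]; the
   second one passes from coordinates to the Euclidean norm. *)
pose C1 := (2 + 2 / Y ^+ 2) * (1 + Ct).
have C1_gt0 : 0 < C1.
  by rewrite mulr_gt0// ?ltr_pwDl// ?divr_ge0 ?exprn_ge0 ?ltW//; lra.
pose C2 := (C1 ^+ 2 * (1 + 4 * Ct + 4) ^+ 2).
have C2_gt0 : 0 < C2 by rewrite mulr_gt0 ?exprn_gt0//; lra.
pose B1 := 4 * (1 + 1^-1) : R; pose B2 := 4 * (1 + Y^-1).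
have B1_gt0 : 0 < B1 by rewrite /B1; lra.
have B2_gt0 : 0 < B2 by rewrite mulr_gt0// addr_gt0// invr_gt0.
exists (C2 * (B1 * B1 * (B2 * B2))); first by do 3 apply: mulr_gt0 => //; exact: mulr_gt0.
move=> rho z w Yr; have r0 : 0 < rho by exact: lt_le_trans Yr.
pose gw (k : (int * int) * (int * int)) :=
  u 1 k.1.1 * u 1 k.1.2 * (u rho k.2.1 * u rho k.2.2).
have gw0 k : 0 <= gw k by apply: mulr_ge0; apply: mulr_ge0; apply: u0.
have key : sum_le setT gw (B1 * B1 * (B2 * B2)).
  pose v1 (k : int * int) := u 1 k.1 * u 1 k.2.
  pose v2 (k : int * int) := u rho k.1 * u rho k.2.
  have s1 : sum_le setT (u 1) B1 by exact: sum_le_inv_sqr.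
  have s2 : sum_le setT (u rho) B2 by exact: sum_le_inv_sqr.
  apply: (@sum_le_prod _ _ _ v1 v2).
  - by move=> k; apply: mulr_ge0; apply: u0.
  - by move=> k; apply: mulr_ge0; apply: u0.
  - by apply: sum_le_prod => // k; apply: u0.
  - by apply: sum_le_prod => // k; apply: u0.
apply: (@sum_le_inj _ _ _ _ (label z w) _ (fun k => C2 * gw k)).
- exact: label_inj.
- by move=> k; rewrite mulr_ge0// ltW.
- move=> g Gg; rewrite /lattice_weight /gw /label/=.
  set a1 := Num.floor _; set a2 := Num.floor _; set p := Num.floor (xcoord _ _) - Num.floor _.
  set q := Num.floor (ycoord _ _) - Num.floor _.
  have fl (x : R) : (Num.floor x)%:~R <= x /\ x < (Num.floor x)%:~R + 1.
    by split; [exact: floor_le|rewrite -[X in _ + X]/(1%:~R) -intrD floorD1_gt].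
  have intd (x y : R) (k : int) : k = Num.floor x - Num.floor y ->
      k%:~R ^+ 2 <= 2 * (x - y) ^+ 2 + 2.
    move=> ->; rewrite intrD intrN; have [? ?] := fl x; have [? ?] := fl y.
    set e := (Num.floor x)%:~R - _; have : - 1 < e - (x - y) < 1 by apply/andP; split; rewrite /e; lra.
    set v := x - y => /andP[e1 e2].
    have d1 : (e - v) ^+ 2 <= 1 by nra.
    have := sqr_ge0 (2 * v - e); lra.
  have hxy := coord_le tau_nonreal (actz g z - w).
  rewrite xcoordB ycoordB -/Ct in hxy.
  have hp := intd _ _ p erefl; have hq := intd _ _ q erefl.
  have hal := coord_le tau_nonreal (al g); rewrite al_norm1// expr1n mulr1 -/Ct in hal.
  have ha1 : a1%:~R ^+ 2 <= 2 * xcoord tau (al g) ^+ 2 + 2.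
    by have := intd (xcoord tau (al g)) 0 a1; rewrite floor0 !subr0; exact.
  have ha2 : a2%:~R ^+ 2 <= 2 * ycoord tau (al g) ^+ 2 + 2.
    by have := intd (ycoord tau (al g)) 0 a2; rewrite floor0 !subr0; exact.
  have -> : abs (w - actz g z) = abs (actz g z - w) by rewrite -normcN opprB.
  move: hxy hp hq hal ha1 ha2; set d := abs _.
  set x1 := _ - xcoord _ _; set y1 := _ - ycoord _ _.
  set ax := xcoord _ _; set ay := ycoord _ _ => hxy hp hq hal ha1 ha2.
  have Yrr : 1 <= rho ^+ 2 / Y ^+ 2.
    by rewrite ler_pdivlMr ?exprn_gt0// mul1r; nra.
  have rd0 : 0 < rho ^+ 2 + d ^+ 2 by rewrite ltr_pwDl ?exprn_gt0// sqr_ge0.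
  have bnd (x : R) (k : int) : k%:~R ^+ 2 <= 2 * x ^+ 2 + 2 -> x ^+ 2 <= Ct * d ^+ 2 ->
      rho ^+ 2 + k%:~R ^+ 2 <= C1 * (rho ^+ 2 + d ^+ 2).
    move=> hk hx; apply: (@le_trans _ _ ((2 + 2 / Y ^+ 2) * (rho ^+ 2 + x ^+ 2))).
      have h1 : 0 <= 2 / Y ^+ 2 * x ^+ 2 by rewrite mulr_ge0 ?sqr_ge0 ?divr_ge0 ?sqr_ge0.
      have h2 : 2 / Y ^+ 2 * rho ^+ 2 = 2 * (rho ^+ 2 / Y ^+ 2) by rewrite -mulrA (mulrC _^-1).
      have h3 := sqr_ge0 rho.
      by move: h1 h2; set T := 2 / Y ^+ 2 => h1 h2; lra.
    rewrite /C1 -mulrA ler_pM2l; last by rewrite ltr_pwDl// divr_ge0 ?sqr_ge0.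
    have h1 := sqr_ge0 d; have h2 : 0 <= Ct * rho ^+ 2 by rewrite mulr_ge0 ?sqr_ge0//; lra.
    by rewrite mulrDl mul1r mulrDr; lra.
  have hx1 : x1 ^+ 2 <= Ct * d ^+ 2 by apply: le_trans hxy; rewrite lerDl sqr_ge0.
  have hy1 : y1 ^+ 2 <= Ct * d ^+ 2 by apply: le_trans hxy; rewrite lerDr sqr_ge0.
  have bp := bnd _ _ hp hx1; have bq := bnd _ _ hq hy1.
  have sax := sqr_ge0 ax; have say := sqr_ge0 ay.
  have b1 : 1 ^+ 2 + a1%:~R ^+ 2 <= 1 + 4 * Ct + 4 by rewrite expr1n; lra.
  have b2 : 1 ^+ 2 + a2%:~R ^+ 2 <= 1 + 4 * Ct + 4 by rewrite expr1n; lra.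
  have pos (x : R) (k : int) : 0 < x -> 0 < x ^+ 2 + k%:~R ^+ 2.
    by move=> x0; rewrite ltr_pwDl ?exprn_gt0// sqr_ge0.
  have P1 := pos 1 a1 ltr01; have P2 := pos 1 a2 ltr01.
  have P3 := pos rho p r0; have P4 := pos rho q r0.
  have prod : (1 ^+ 2 + a1%:~R ^+ 2) * (1 ^+ 2 + a2%:~R ^+ 2) *
      ((rho ^+ 2 + p%:~R ^+ 2) * (rho ^+ 2 + q%:~R ^+ 2)) <=
      C2 * (rho ^+ 2 + d ^+ 2) ^+ 2.
    have -> : C2 * (rho ^+ 2 + d ^+ 2) ^+ 2 = (1 + 4 * Ct + 4) * (1 + 4 * Ct + 4) *
      ((C1 * (rho ^+ 2 + d ^+ 2)) * (C1 * (rho ^+ 2 + d ^+ 2))) by rewrite /C2; ring.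
    apply: ler_pM.
    - by apply: mulr_ge0; exact: ltW.
    - by apply: mulr_ge0; exact: ltW.
    - by apply: ler_pM => //; exact: ltW.
    - by apply: ler_pM => //; exact: ltW.
  rewrite /u; move: P1 P2 P3 P4 prod; set Q1 := 1 ^+ 2 + _; set Q2 := 1 ^+ 2 + _.
  set Q3 := _ + p%:~R ^+ 2; set Q4 := _ + q%:~R ^+ 2 => P1 P2 P3 P4 prod.
  have -> : C2 * (1 / Q1 * (1 / Q2) * (rho / Q3 * (rho / Q4))) =
      C2 * rho ^+ 2 / (Q1 * Q2 * (Q3 * Q4)).
    by field; rewrite !lt0r_neq0.
  rewrite ler_pdivrMr ?exprn_gt0// mulrAC ler_pdivlMr ?mulr_gt0//.
  by rewrite [leRHS]mulrAC [leRHS]mulrC ler_pM2l ?exprn_gt0.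
- exact: sum_leZ (ltW C2_gt0) key.
Qed.

Lemma stab_label : exists f : PSL2 R -> nat, set_inj G f.
Proof.
exists (pickle \o label 0 0) => g h Gg Gh /= /(pcan_inj pickleK).
exact: label_inj.
Qed.

End CuspGroup.

(** * Unitary matrices *)

Section Adjoint.
Variables (R : realType) (n : nat).
Local Notation C := R[i].
Local Notation abs := (@Normc.normc R).
Implicit Types (A B U : 'M[C]_n) (v w : 'cV[C]_n).

Definition adj A : 'M[C]_n := \matrix_(i, j) (A j i)^*%C.

Lemma adjK A : adj (adj A) = A.
Proof. by apply/matrixP => i j; rewrite !mxE conjcK. Qed.

Lemma adjM A B : adj (A *m B) = adj B *m adj A.
Proof.
apply/matrixP => i j; rewrite !mxE rmorph_sum/=; apply: eq_bigr => k _.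
by rewrite !mxE rmorphM/= mulrC.
Qed.

Lemma adj0 : adj 0 = 0.
Proof. by apply/matrixP => i j; rewrite !mxE conjc0. Qed.

Lemma adj1 : adj 1%:M = 1%:M.
Proof. by apply/matrixP => i j; rewrite !mxE rmorph_nat eq_sym. Qed.

Lemma adjB A B : adj (A - B) = adj A - adj B.
Proof. by apply/matrixP => i j; rewrite !mxE rmorphB. Qed.

Lemma adjD A B : adj (A + B) = adj A + adj B.
Proof. by apply/matrixP => i j; rewrite !mxE rmorphD. Qed.

Lemma innerE v w : inner v w = \sum_(i < n) v i 0 * (w i 0)^*%C.
Proof. by []. Qed.

Lemma inner_adj A v w : inner (A *m v) w = inner v (adj A *m w).
Proof.
rewrite !innerE.
transitivity (\sum_(i < n) \sum_(k < n) A i k * v k 0 * (w i 0)^*%C).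
  by apply: eq_bigr => i _; rewrite mxE mulr_suml.
rewrite exchange_big; apply: eq_bigr => k _.
rewrite mxE rmorph_sum/= mulr_sumr; apply: eq_bigr => i _.
by rewrite mxE rmorphM/= conjcK; ring.
Qed.

Lemma innerBl u v w : inner (u - v : 'cV[C]_n) w = inner u w - inner v w.
Proof. by rewrite !innerE -sumrB; apply: eq_bigr => i _; rewrite !mxE mulrBl. Qed.

Lemma innerDl u v w : inner (u + v : 'cV[C]_n) w = inner u w + inner v w.
Proof. by rewrite !innerE -big_split; apply: eq_bigr => i _; rewrite !mxE mulrDl. Qed.

Lemma inner0l w : inner 0 w = 0.
Proof. by rewrite innerE big1// => i _; rewrite mxE mul0r. Qed.

Lemma inner_self v : inner v v = (\sum_(i < n) abs (v i 0) ^+ 2)%:C.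
Proof.
rewrite innerE rmorph_sum/=; apply: eq_bigr => i _.
by rewrite sqr_normcE; case: (v i 0) => x y /=; simpc; congr (_ +i* _); ring.
Qed.

Lemma inner_self_eq0 v : inner v v = 0 -> v = 0.
Proof.
rewrite inner_self => /complexI/eqP; rewrite psumr_eq0; last by move=> i _; exact: sqr_ge0.
move=> /allP H; apply/matrixP => i j; rewrite mxE (ord1 j).
have := H i (mem_index_enum i); rewrite sqrf_eq0 => /eqP.
exact: Normc.eq0_normc.
Qed.

Lemma sum_inner_self_eq0 v w : inner v v + inner w w = 0 -> v = 0 /\ w = 0.
Proof.
move=> H; suff [h1 h2] : inner v v = 0 /\ inner w w = 0.
  by split; exact: inner_self_eq0.
move: H; rewrite !inner_self -rmorphD => /complexI/eqP.
have p0 (u : 'cV[C]_n) : 0 <= \sum_(i < n) abs (u i 0) ^+ 2.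
  by apply: sumr_ge0 => i _; exact: sqr_ge0.
by rewrite paddr_eq0 ?p0// => /andP[/eqP -> /eqP ->]; rewrite rmorph0.
Qed.

Lemma unitary_adj U : U \is unitarymx -> U *m adj U = 1%:M /\ adj U *m U = 1%:M.
Proof.
move=> /unitarymxP h.
have h1 : U *m adj U = 1%:M.
  by rewrite -h; congr (_ *m _); apply/matrixP => i j; rewrite !mxE.
by split => //; exact: mulmx1C.
Qed.

Lemma unitary_entry U i j : U \is unitarymx -> abs (U i j) <= 1.
Proof.
move=> /unitary_adj[/matrixP/(_ i i) + _]; rewrite !mxE eqxx.
have -> : \sum_k U i k * adj U k i = (\sum_k abs (U i k) ^+ 2)%:C.
  rewrite rmorph_sum/=; apply: eq_bigr => k _; rewrite mxE sqr_normcE.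
  by case: (U i k) => x y /=; simpc; congr (_ +i* _); ring.
move=> /(@complexI R _ 1) h.
rewrite -(@ler_pXn2r _ 2) ?nnegrE ?normc_ge0// expr1n -h (bigD1 j)//= lerDl.
by apply: sumr_ge0 => k _; exact: sqr_ge0.
Qed.

(* [2 - U - U^*] is [(1 - U)^* (1 - U)]. *)
Definition lap U : 'M[C]_n := 1%:M + 1%:M - U - adj U.

Lemma lapE U : U \is unitarymx -> lap U = adj (1%:M - U) *m (1%:M - U).
Proof.
move=> /unitary_adj[_ h].
rewrite /lap adjB adj1 mulmxBl !mulmxBr !mul1mx mulmx1 h.
by apply/matrixP => i j; rewrite !mxE; ring.
Qed.

Lemma adj_lap U : adj (lap U) = lap U.
Proof.
by rewrite /lap !adjB adjD adj1 adjK; apply/matrixP => i j; rewrite !mxE; ring.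
Qed.

Lemma inner_lap U v : U \is unitarymx ->
  inner (lap U *m v) v = inner (v - U *m v) (v - U *m v).
Proof.
by move=> Uu; rewrite lapE// -mulmxA inner_adj adjK mulmxBl mul1mx.
Qed.

Lemma lap_kernel U v : U \is unitarymx -> lap U *m v = 0 -> U *m v = v.
Proof.
move=> Uu h; have := inner_lap v Uu; rewrite h inner0l => /esym/inner_self_eq0.
by move=> /eqP; rewrite subr_eq0 => /eqP.
Qed.

Lemma lap2_kernel U1 U2 v : U1 \is unitarymx -> U2 \is unitarymx ->
  (lap U1 + lap U2) *m v = 0 -> U1 *m v = v /\ U2 *m v = v.
Proof.
move=> u1 u2 h; have : inner ((lap U1 + lap U2) *m v) v = 0 by rewrite h inner0l.
rewrite mulmxDl innerDl !inner_lap// => /sum_inner_self_eq0[/eqP + /eqP].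
by rewrite !subr_eq0 => /eqP <- /eqP <-.
Qed.

(** For self-adjoint [A], [A A v = 0] gives [|A v|^2 = 0]. The resulting [X] with [A = X A A] serves
    as a left inverse away from the kernel. *)
Lemma selfadj_sqr_submx A : adj A = A -> (A <= A *m A)%MS.
Proof.
move=> sA; apply: submx_of_kernel => v; rewrite -mulmxA => h.
by apply: inner_self_eq0; rewrite inner_adj sA h innerE big1// => i _; rewrite mxE conjc0 mulr0.
Qed.

(* A left inverse of [A] modulo its kernel gives [P] acting as the identity on
   the common fixed vectors of [U1] and [U2], with [P U1 = P = P U2]. *)
Lemma fixed_absorber U1 U2 : U1 \is unitarymx -> U2 \is unitarymx ->
  exists X : 'M[C]_n, let P := 1%:M - X *m (lap U1 + lap U2) in
    P *m U1 = P /\ P *m U2 = P.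
Proof.
move=> u1 u2; set A := lap U1 + lap U2.
have sA : adj A = A by rewrite /A adjD !adj_lap.
have /submxP[X hX] := selfadj_sqr_submx sA.
exists X => P.
have PA : P *m A = 0 by rewrite /P mulmxBl mul1mx -mulmxA -hX subrr.
(* Since [A] is self-adjoint, [P A = 0] says that the columns of the adjoint of [P] lie in the
   kernel of [A], so [U] fixes them; taking adjoints gives [P U = P]. *)
have fixP U : U \is unitarymx -> (forall v, A *m v = 0 -> U *m v = v) -> P *m U = P.
  move=> uU hU; have [UU' U'U] := unitary_adj uU.
  have UP : U *m adj P = adj P.
    apply/matrixP => i j; have : U *m col j (adj P) = col j (adj P).
      by apply: hU; rewrite -[A]sA colE mulmxA -adjM PA adj0 mul0mx.
    by move=> /matrixP/(_ i 0); rewrite colE mulmxA -!colE !mxE.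
  by rewrite -[LHS]adjK adjM -UP mulmxA U'U mul1mx adjK.
by split; apply: fixP => // v /(lap2_kernel u1 u2) [].
Qed.

End Adjoint.

(** * Sums over the stabilizer of the cusp *)

(* At a near-maximum, a lower bound on second differences bounds the oscillation. *)
Lemma periodic_osc (R : realType) (tau : R[i]) (f : R[i] -> R) (B K : R) :
  complex.Im tau != 0 ->
  (forall w b, lattice tau b -> f (w + b) = f w) ->
  (forall w, `|f w| <= B) ->
  (forall w h, Normc.normc h <= 1 + Normc.normc tau ->
     - K <= f (w + h) + f (w - h) - 2 * f w) ->
  forall w1 w2, `|f w1 - f w2| <= K.
Proof.
move=> tau0 per bnd sd w1 w2.
have hs : has_sup (range f).
  split; first by exists (f w1), w1.
  by exists B => _ [w _ <-]; exact: le_trans (ler_norm _) (bnd w).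
have ub w : f w <= sup (range f) by apply: sup_upper_bound => //; exists w.
have lb w : sup (range f) - K <= f w.
  apply/ler_addgt0Pr => e e0.
  have e2 : 0 < e / 2 by rewrite divr_gt0.
  have [_ [w0 _ <-] hw0] := sup_adherent e2 hs.
  (* A bounded step from the near-maximum [w0] reaches a lattice translate of [w]; at the opposite
     neighbour [f] is at most the supremum, so the second difference bounds [f w] from below. *)
  have [b Lb hb] := lattice_near tau0 (w - w0).
  have := sd w0 _ hb; have := ub (w0 - (w - w0 - b)).
  have -> : f (w0 + (w - w0 - b)) = f w by rewrite -(per _ b)//; congr f; ring.
  lra.
have := ub w1; have := ub w2; have := lb w1; have := lb w2.
rewrite ler_norml => *; apply/andP; split; lra.
Qed.

Section CuspSum.
Variables (R : realType) (Gamma : set (PSL2 R)) (tau : R[i]).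
Hypothesis G_sub : is_subgroup Gamma.
Hypothesis tau_nonreal : complex.Im tau != 0.
Hypothesis Gmax :
  max_tf_parabolic_subgroup (stab_infty Gamma) (@translation R @` lattice tau).
Variables (Y t : R).
Hypothesis Y_gt0 : 0 < Y.
Hypothesis t_gt0 : 0 < t.
Local Notation C := R[i].
Local Notation abs := (@Normc.normc R).
Local Notation L := (lattice tau).
Local Notation G := (stab_infty Gamma).
Implicit Types (g h : PSL2 R) (z w b : C).

Definition cosh_dist (r r' d2 : R) : R := (d2 + r ^+ 2 + r' ^+ 2) / (2 * r * r').

Lemma cosh_dist_ge1 r r' d2 : 0 < r -> 0 < r' -> 0 <= d2 -> 1 <= cosh_dist r r' d2.
Proof.
move=> r0 r0' d0; rewrite ler_pdivlMr ?mulr_gt0// mul1r.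
by have := sqr_ge0 (r - r'); lra.
Qed.

Lemma cosh_dist_ge r r' d2 : 0 < r -> 0 < r' -> 0 <= d2 ->
  (r * r' + d2) / (4 * (r * r')) <= cosh_dist r r' d2.
Proof.
move=> r0 r0' d0; have rr := mulr_gt0 r0 r0'.
rewrite /cosh_dist -mulrA (_ : 4 * _ = 2 * (2 * (r * r'))); last by ring.
rewrite ler_pdivrMr ?mulr_gt0// (_ : _ / _ * _ = 2 * (d2 + r ^+ 2 + r' ^+ 2)).
  by have := sqr_ge0 (r - r'); lra.
by field; rewrite !lt0r_neq0.
Qed.

Lemma delta_stab p p' (r r' : R) g : G g ->
  delta (p, r) (h3_act g (p', r')) =
  cosh_dist r r' (abs (cplx p - actz g (cplx p')) ^+ 2).
Proof.
move=> Gg; rewrite (stab_act G_sub tau_nonreal Gmax)// /delta /cosh_dist /h3_z /h3_r /=.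
by rewrite /of_cplx /cplx /=; case: (actz g _).
Qed.

(** The data [z'], [r], [r'] over which every constant must be uniform. The coordinate [z] is kept
    apart as the variable [w], since differences and periodicity are taken in it. *)
Record cusp_param := CuspParam { cp_z : C; cp_r : R; cp_r' : R }.

Definition cp_ok (x : cusp_param) := Y <= cp_r x /\ Y <= cp_r' x.

Definition hk (x : cusp_param) w g : R :=
  heat_k t (cosh_dist (cp_r x) (cp_r' x) (abs (w - actz g (cp_z x)) ^+ 2)).

Definition rho (x : cusp_param) := Num.sqrt (cp_r x * cp_r' x).

Definition wt (x : cusp_param) w g : R := lattice_weight (rho x) (actz g (cp_z x)) w.

Lemma cp_gt0 x : cp_ok x -> 0 < cp_r x /\ 0 < cp_r' x.
Proof. by move=> [h1 h2]; split; exact: lt_le_trans Y_gt0 _. Qed.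

Lemma rho_sqr x : cp_ok x -> rho x ^+ 2 = cp_r x * cp_r' x.
Proof. by move=> /cp_gt0[h1 h2]; rewrite sqr_sqrtr// ltW// mulr_gt0. Qed.

Lemma rho_ge x : cp_ok x -> Y <= rho x.
Proof.
move=> [h1 h2]; rewrite -[leLHS]gtr0_norm// -sqrtr_sqr ler_wsqrtr// expr2.
by apply: ler_pM => //; exact: ltW.
Qed.

Lemma rho_gt0 x : cp_ok x -> 0 < rho x.
Proof. by move=> /rho_ge; exact: lt_le_trans. Qed.

Lemma wt_ge0 x w g : 0 <= wt x w g.
Proof. by rewrite divr_ge0 ?sqr_ge0 ?exprn_even_ge0. Qed.

Lemma hk_ge0 x w g : cp_ok x -> 0 <= hk x w g.
Proof.
move=> /cp_gt0[h1 h2]; apply: heat_k_ge0 => //.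
by apply: cosh_dist_ge1 => //; exact: sqr_ge0.
Qed.

Lemma inv_cosh_dist_le x w g : cp_ok x ->
  (cosh_dist (cp_r x) (cp_r' x) (abs (w - actz g (cp_z x)) ^+ 2)) ^- 2 <=
  16 * rho x ^+ 2 * wt x w g.
Proof.
move=> xok; have [r0 r0'] := cp_gt0 xok.
have := cosh_dist_ge r0 r0' (sqr_ge0 (abs (w - actz g (cp_z x)))).
rewrite /wt /lattice_weight -(rho_sqr xok); set d := abs _; set q := cosh_dist _ _ _.
have p0 := rho_gt0 xok.
have rd : 0 < rho x ^+ 2 + d ^+ 2 by rewrite ltr_pwDl ?exprn_gt0// sqr_ge0.
move=> hq.
have lq : 0 < (rho x ^+ 2 + d ^+ 2) / (4 * rho x ^+ 2).
  by rewrite divr_gt0// mulr_gt0// exprn_gt0.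
have -> : 16 * rho x ^+ 2 * (rho x ^+ 2 / (rho x ^+ 2 + d ^+ 2) ^+ 2) =
    ((rho x ^+ 2 + d ^+ 2) / (4 * rho x ^+ 2)) ^- 2.
  by field; rewrite !lt0r_neq0.
have q0 := lt_le_trans lq hq.
rewrite lef_pV2 ?posrE ?exprn_gt0//.
by rewrite ler_pXn2r// nnegrE ltW.
Qed.

(** The factor [rho ^+ 2 = r r'] makes this bound as large as the main term; it serves only to
    guarantee summability. *)
Lemma hk_le : exists2 A : R, 0 < A & forall x w g, cp_ok x ->
  hk x w g <= A * rho x ^+ 2 * wt x w g.
Proof.
have [A A0 HA] := heat_k_decay t_gt0 2.
exists (A * 16); first by rewrite mulr_gt0.
move=> x w g xok; have [r0 r0'] := cp_gt0 xok.
apply: le_trans (HA _ (cosh_dist_ge1 r0 r0' (sqr_ge0 _))) _.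
rewrite (_ : A * 16 * _ * _ = A * (16 * rho x ^+ 2 * wt x w g)); last by ring.
by rewrite ler_pM2l//; exact: inv_cosh_dist_le.
Qed.

(** By the parallelogram law the mean of [delta] at [w + d] and [w - d] is [q + e] with
    [e = |d|^2 / (2 r r')]. Midpoint convexity bounds the sum of the two values below by
    [2 k (q + e)], and [heat_k_slope] compares [k (q + e)] with [k q]. The powers of [rho] then
    cancel. *)
Lemma hk_second_diff : exists2 A : R, 0 < A & forall x w d g, cp_ok x ->
  - (A * abs d ^+ 2 * wt x w g) <= hk x (w + d) g + hk x (w - d) g - 2 * hk x w g.
Proof.
have [A A0 HA] := heat_k_slope t_gt0.
exists (A * 16); first by rewrite mulr_gt0.
move=> x w d g xok; have [r0 r0'] := cp_gt0 xok.
rewrite /hk; set u := w - _.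
have -> : w + d - actz g (cp_z x) = u + d by rewrite /u; ring.
have -> : w - d - actz g (cp_z x) = u - d by rewrite /u; ring.
set q := cosh_dist _ _ (abs u ^+ 2).
pose e := abs d ^+ 2 / (2 * rho x ^+ 2).
have e0 : 0 <= e by rewrite divr_ge0 ?sqr_ge0// mulr_ge0 ?sqr_ge0.
have q1 : 1 <= q by apply: cosh_dist_ge1 => //; exact: sqr_ge0.
have qp1 : 1 <= cosh_dist (cp_r x) (cp_r' x) (abs (u + d) ^+ 2).
  by apply: cosh_dist_ge1 => //; exact: sqr_ge0.
have qm1 : 1 <= cosh_dist (cp_r x) (cp_r' x) (abs (u - d) ^+ 2).
  by apply: cosh_dist_ge1 => //; exact: sqr_ge0.
have := heat_k_midpoint t_gt0 qp1 qm1.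
have -> : (cosh_dist (cp_r x) (cp_r' x) (abs (u + d) ^+ 2) +
    cosh_dist (cp_r x) (cp_r' x) (abs (u - d) ^+ 2)) / 2 = q + e.
  rewrite /q /e rho_sqr// /cosh_dist !sqr_normcE.
  case: u {q q1 qp1 qm1} => u1 u2; case: d {e e0} => d1 d2 /=.
  by field; rewrite !lt0r_neq0.
have hs := HA q e q1 e0.
have hq := inv_cosh_dist_le w g xok; rewrite -/u -/q in hq.
have h2 : A * e / q ^+ 2 <= A * 8 * abs d ^+ 2 * wt x w g.
  rewrite -[leLHS]mulrA (_ : A * 8 * _ * _ = A * (8 * abs d ^+ 2 * wt x w g)); last by ring.
  rewrite ler_pM2l//.
  apply: (le_trans (ler_wpM2l e0 hq)); rewrite /e le_eqVlt; apply/orP; left; apply/eqP.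
  by field; rewrite lt0r_neq0// rho_gt0.
move: hs h2; move: (heat_k t q) (heat_k t (q + e)) (heat_k t _) (heat_k t _) => k1 k2 k3 k4.
move: (A * e / q ^+ 2) (wt x w g) (abs d ^+ 2) => v1 v2 v3 *; lra.
Qed.

Lemma hk_equiv x w g0 g : G g0 -> G g -> hk x (actz g0 w) g = hk x w (g0^-1 * g)%g.
Proof.
move=> G0 Gg; have GV := stabV G_sub G0.
rewrite /hk actzM ?(stab_fix GV) ?(stab_fix Gg)//; congr (heat_k t (cosh_dist _ _ (_ ^+ 2))).
rewrite -(abs_actzB G_sub tau_nonreal Gmax w (actz (g0^-1)%g _) G0).
by rewrite -(actzM _ (stab_fix G0) (stab_fix GV)) mulgV actz1.
Qed.

Lemma wt_sum : exists2 K : R, 0 < K & forall x w, cp_ok x -> sum_le G (wt x w) K.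
Proof.
have [K K0 HK] := sum_le_lattice_weight G_sub tau_nonreal Gmax Y_gt0.
by exists K => // x w xok; apply: HK; exact: rho_ge.
Qed.

Lemma hk_sum : exists2 A : R, 0 < A & forall x w, cp_ok x ->
  sum_le G (hk x w) (A * rho x ^+ 2).
Proof.
have [A A0 HA] := hk_le; have [K K0 HK] := wt_sum.
exists (A * K); first exact: mulr_gt0.
move=> x w xok.
have H : sum_le G (fun g => A * rho x ^+ 2 * wt x w g) (A * rho x ^+ 2 * K).
  by apply: sum_leZ (HK _ _ xok); rewrite mulr_ge0 ?sqr_ge0// ltW.
by rewrite mulrAC; apply: sum_le_mono H => g _; exact: HA.
Qed.

Lemma left_mul_bij g0 : G g0 -> set_bij G G (fun g => g0^-1 * g)%g.
Proof.
move=> G0; have GV := stabV G_sub G0; split.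
- by move=> g Gg; exact: stabM.
- by move=> g h _ _ /mulgI.
- by move=> g Gg; exists (g0 * g)%g; [exact: stabM|rewrite mulKg].
Qed.

Definition Tsum x w : R := rsum G (hk x w).

Lemma abs_le_ge0 (I : choiceType) (D : set I) (f : I -> R) B :
  (forall i, D i -> 0 <= f i) -> sum_le D f B -> abs_le D f B.
Proof. by move=> f0; apply: sum_le_mono => i Di; rewrite ger0_norm ?f0. Qed.

Lemma Tsum_equiv x w g0 : G g0 -> Tsum x (actz g0 w) = Tsum x w.
Proof.
move=> G0; rewrite /Tsum (rsum_bij (hk x w) (left_mul_bij G0)).
by apply: eq_rsum => g Gg; exact: hk_equiv.
Qed.

Lemma actz_translation b w : actz (translation b) w = w + b.
Proof. by rewrite /actz al_translation be_translation mul1r. Qed.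

Lemma second_diff_rsum x w d : cp_ok x ->
  exists2 B : R, abs_le G (fun g => hk x (w + d) g + hk x (w - d) g - 2 * hk x w g) B &
  rsum G (fun g => hk x (w + d) g + hk x (w - d) g - 2 * hk x w g) =
  Tsum x (w + d) + Tsum x (w - d) - 2 * Tsum x w.
Proof.
move=> xok; have [A A0 HA] := hk_sum.
have ha v : abs_le G (hk x v) (A * rho x ^+ 2).
  by apply: abs_le_ge0 (HA _ _ xok) => g _; exact: hk_ge0.
have h2 : abs_le G (fun g => - 2 * hk x w g) (`|- 2| * (A * rho x ^+ 2)).
  by apply: abs_leZ.
have h1 : abs_le G (fun g => hk x (w + d) g + hk x (w - d) g) (A * rho x ^+ 2 + A * rho x ^+ 2).
  have h := sum_leD (fun g _ => normr_ge0 (hk x (w + d) g)) (fun g _ => normr_ge0 (hk x (w - d) g)) (ha _) (ha _).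
  by apply: sum_le_mono h => g _; exact: ler_normD.
exists (A * rho x ^+ 2 + A * rho x ^+ 2 + `|- 2| * (A * rho x ^+ 2)).
  have h := sum_leD (fun g _ => normr_ge0 (hk x (w + d) g + hk x (w - d) g)) (fun g _ => normr_ge0 (- 2 * hk x w g)) h1 h2.
  by apply: sum_le_mono h => g _; rewrite -[X in _ + X]mulNr; exact: ler_normD.
have e : (fun g => hk x (w + d) g + hk x (w - d) g - 2 * hk x w g) =
  (fun g => (hk x (w + d) g + hk x (w - d) g) + - 2 * hk x w g).
  by apply/funext => g; rewrite mulNr.
by rewrite e (rsumD h1 h2) (rsumD (ha _) (ha _)) (rsumZ (- 2) (ha w)) mulNr.
Qed.

Lemma Tsum_osc : exists2 K : R, 0 < K & forall x w1 w2, cp_ok x ->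
  `|Tsum x w1 - Tsum x w2| <= K.
Proof.
have [A A0 HA] := hk_second_diff; have [K K0 HK] := wt_sum.
have [A' A'0 HA'] := hk_sum.
exists (A * (1 + abs tau) ^+ 2 * K).
  by apply: mulr_gt0 => //; apply: mulr_gt0 => //; rewrite exprn_gt0// ltr_pwDl// normc_ge0.
move=> x w1 w2 xok; apply: (@periodic_osc R tau (Tsum x) (A' * rho x ^+ 2)).
- exact: tau_nonreal.
- move=> w b Lb; rewrite -actz_translation; apply: Tsum_equiv.
  exact: (stab_translation Gmax).
- move=> w; rewrite ger0_norm; last by apply: rsum_ge0 => g _; exact: hk_ge0.
  by apply: rsum_le (HA' _ _ xok) => g _; exact: hk_ge0.
- move=> w d hd; have [B HB <-] := second_diff_rsum w d xok.
  have hw : sum_le G (fun g => A * abs d ^+ 2 * wt x w g) (A * abs d ^+ 2 * K).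
    by apply: sum_leZ (HK _ _ xok); rewrite mulr_ge0 ?sqr_ge0// ltW.
  have hw0 g : 0 <= A * abs d ^+ 2 * wt x w g.
    by rewrite mulr_ge0 ?wt_ge0// mulr_ge0 ?sqr_ge0// ltW.
  have hwa := abs_le_ge0 (fun g (_ : G g) => hw0 g) hw.
  have hwN : abs_le G (fun g => - (A * abs d ^+ 2 * wt x w g)) (A * abs d ^+ 2 * K).
    by apply: sum_le_mono hwa => g _; rewrite normrN.
  apply: (@le_trans _ _ (rsum G (fun g => - (A * abs d ^+ 2 * wt x w g)))).
    rewrite (rsumN hwa) lerN2.
    apply: (le_trans (rsum_le (fun g _ => hw0 g) hw)).
    rewrite ler_pM2r// ler_pM2l// lerXn2r ?nnegrE ?normc_ge0//.
    by rewrite addr_ge0 ?normc_ge0.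
  by apply: ler_rsum hwN HB => g _; exact: HA.
Qed.

(** A termwise lower bound [- E <= D] already controls absolute values, since [|D| <= D + 2 E], and
    the sum of [D] is a second difference of [Tsum], bounded by its oscillation. Absolute bounds are
    what survives multiplication by the unitary [chi g]. *)
Lemma second_diff_sum (H : R) : exists2 K : R, 0 < K & forall x w d, cp_ok x ->
  abs d <= H ->
  abs_le G (fun g => hk x (w + d) g + hk x (w - d) g - 2 * hk x w g) K.
Proof.
have [A A0 HA] := hk_second_diff; have [K K0 HK] := wt_sum.
have [KT KT0 HT] := Tsum_osc.
pose E := A * H ^+ 2 * K.
exists (2 * KT + 2 * E + 1).
  have : 0 <= E by apply: mulr_ge0; [apply: mulr_ge0; [exact: ltW|exact: sqr_ge0]|exact: ltW].
  by lra.
move=> x w d xok hd; have [B HB eD] := second_diff_rsum w d xok.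
set D := fun g => _ in HB eD *.
have hw : sum_le G (fun g => A * abs d ^+ 2 * wt x w g) (A * abs d ^+ 2 * K).
  by apply: sum_leZ (HK _ _ xok); rewrite mulr_ge0 ?sqr_ge0// ltW.
have hw0 g : 0 <= A * abs d ^+ 2 * wt x w g.
  by rewrite mulr_ge0 ?wt_ge0// mulr_ge0 ?sqr_ge0// ltW.
have hwa := abs_le_ge0 (fun g (_ : G g) => hw0 g) hw.
have h2w := abs_leZ 2 hwa.
pose f g := D g + 2 * (A * abs d ^+ 2 * wt x w g).
have Df g : `|D g| <= f g.
  clear eD; have := hw0 g; have := HA x w d g xok; rewrite -/(D g) /f ler_norml.
  by move: (D g) (A * _ * _) => u v *; apply/andP; split; lra.
have ef : rsum G f = rsum G D + 2 * rsum G (fun g => A * abs d ^+ 2 * wt x w g).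
  by rewrite (rsumD HB h2w) (rsumZ 2 hwa).
have f0 g : 0 <= f g by apply: le_trans (Df g).
have sf : sum_le G f (B + `|2| * (A * abs d ^+ 2 * K)).
  have h := sum_leD (fun g _ => normr_ge0 (D g)) (fun g _ => normr_ge0 (2 * (A * abs d ^+ 2 * wt x w g))) HB h2w.
  by apply: sum_le_mono h => g _; rewrite lerD// ler_norm.
have sf' := sum_le_rsum_self (fun g _ => f0 g) sf.
apply: (@sum_le_mono _ _ _ _ f); first by move=> g _; exact: Df.
apply: (le_trans sf'); rewrite lee_fin ef eD.
have hE : rsum G (fun g => A * abs d ^+ 2 * wt x w g) <= E.
  apply: (le_trans (rsum_le (fun g _ => hw0 g) hw)).
  rewrite ler_pM2r// ler_pM2l// lerXn2r ?nnegrE ?normc_ge0//.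
  exact: le_trans (normc_ge0 d) hd.
have h1 := le_trans (ler_norm _) (HT x (w + d) w xok).
have h2 := le_trans (ler_norm _) (HT x (w - d) w xok).
clear eD ef sf'; move: hE h1 h2.
by move: (Tsum _ _) (Tsum _ _) (Tsum _ _) (rsum _ _) => *; lra.
Qed.

End CuspSum.

(** * Sums over the stabilizer twisted by the representation *)

Section TwistedSum.
Variables (R : realType) (Gamma : set (PSL2 R)) (tau : R[i]).
Hypothesis G_sub : is_subgroup Gamma.
Hypothesis tau_nonreal : complex.Im tau != 0.
Hypothesis Gmax :
  max_tf_parabolic_subgroup (stab_infty Gamma) (@translation R @` lattice tau).
Variables (Y t : R).
Hypothesis Y_gt0 : 0 < Y.
Hypothesis t_gt0 : 0 < t.
Variables (n : nat) (chi : PSL2 R -> 'M[R[i]]_n).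
Hypothesis chi_unitary : unitary_rep Gamma chi.
Local Notation C := R[i].
Local Notation abs := (@Normc.normc R).
Local Notation L := (lattice tau).
Local Notation G := (stab_infty Gamma).
Local Notation hk := (hk t).
Local Notation cp_ok := (cp_ok Y).
Implicit Types (g h : PSL2 R) (z w b : C).

Lemma chi_unit g : G g -> chi g \is unitarymx.
Proof. by case: chi_unitary => + _ [Gg _]; exact. Qed.

Lemma chi_mul g h : G g -> G h -> chi (g * h)%g = chi g *m chi h.
Proof. by case: chi_unitary => _ + [Gg _] [Gh _]; exact. Qed.

Lemma chi1 : chi 1%g = 1%:M.
Proof.
have G1 := stab1 G_sub; have [h1 h2] := unitary_adj (chi_unit G1).
have := chi_mul G1 G1; rewrite mulg1 => e.
by rewrite -h1 {2}e -mulmxA h1 mulmx1.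
Qed.

Lemma chiV g : G g -> chi (g^-1)%g = adj (chi g).
Proof.
move=> Gg; have GV := stabV G_sub Gg; have [h1 h2] := unitary_adj (chi_unit Gg).
by rewrite -[LHS]mul1mx -h2 -mulmxA -chi_mul// mulgV chi1 mulmx1.
Qed.

Definition chisum (f : PSL2 R -> R) : 'M[C]_n :=
  \matrix_(i, j) csum G (fun g => chi g i j * (f g)%:C).

Lemma cabs_chi (f : PSL2 R -> R) B i j : abs_le G f B ->
  cabs_le G (fun g => chi g i j * (f g)%:C) B.
Proof.
apply: sum_le_mono => g Gg; rewrite Normc.normcM normc_real -[leRHS]mul1r.
by rewrite ler_wpM2r// unitary_entry// chi_unit.
Qed.

Lemma chisum_le (f : PSL2 R -> R) B i j : abs_le G f B ->
  abs (chisum f i j) <= 2 * B.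
Proof. by move=> fB; rewrite mxE; apply: ler_normc_csum; exact: cabs_chi. Qed.

Lemma mul_chisum (A : 'M[C]_n) f B : abs_le G f B ->
  A *m chisum f = \matrix_(i, j) csum G (fun g => (A *m chi g) i j * (f g)%:C).
Proof.
move=> fB; apply/matrixP => i j; rewrite !mxE.
under eq_bigr do rewrite mxE.
rewrite -(@csum_sum _ _ _ _ _ (fun k => A i k) (fun k g => chi g k j * (f g)%:C) (fun=> B)).
  by apply: eq_csum => g _; rewrite mxE mulr_suml; apply: eq_bigr => k _; rewrite mulrA.
by move=> k; exact: cabs_chi.
Qed.

Lemma chi_chisum g0 f B : G g0 -> abs_le G f B ->
  chi g0 *m chisum f = chisum (fun g => f (g0^-1 * g)%g).
Proof.
move=> G0 fB; rewrite (mul_chisum _ fB); apply/matrixP => i j; rewrite !mxE.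
rewrite (csum_bij _ (left_mul_bij G_sub G0)); apply: eq_csum => g Gg /=.
have GV := stabV G_sub G0.
by rewrite -chi_mul//; [rewrite mulVKg|exact: stabM].
Qed.

Lemma eq_chisum (f f' : PSL2 R -> R) : (forall g, G g -> f g = f' g) -> chisum f = chisum f'.
Proof. by move=> ff; apply/matrixP => i j; rewrite !mxE; apply: eq_csum => g Gg; rewrite ff. Qed.

Lemma chisumD (f f' : PSL2 R -> R) B B' : abs_le G f B -> abs_le G f' B' ->
  chisum (fun g => f g + f' g) = chisum f + chisum f'.
Proof.
move=> fB fB'; apply/matrixP => i j; rewrite !mxE.
rewrite -(csumD (cabs_chi i j fB) (cabs_chi i j fB')); apply: eq_csum => g _.
by rewrite rmorphD mulrDr.
Qed.

Lemma chisumZ (f : PSL2 R -> R) B (c : R) : abs_le G f B ->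
  chisum (fun g => c * f g) = c%:C *: chisum f.
Proof.
move=> fB; apply/matrixP => i j; rewrite !mxE.
rewrite -(csumZ _ (cabs_chi i j fB)); apply: eq_csum => g _.
by rewrite rmorphM mulrCA.
Qed.

Definition Msum (x : cusp_param R) w : 'M[C]_n := chisum (hk x w).

Lemma hk_abs_le : exists2 A : R, 0 < A & forall x w, cp_ok x ->
  abs_le G (hk x w) (A * rho x ^+ 2).
Proof.
have [A A0 HA] := hk_sum G_sub tau_nonreal Gmax Y_gt0 t_gt0.
exists A => // x w xok; apply: abs_le_ge0 (HA _ _ xok) => g _.
exact: hk_ge0 xok.
Qed.

Lemma Msum_equiv x w g0 : cp_ok x -> G g0 -> Msum x (actz g0 w) = chi g0 *m Msum x w.
Proof.
move=> xok G0; have [A _ HA] := hk_abs_le.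
rewrite /Msum (chi_chisum G0 (HA x w xok)); apply: eq_chisum => g Gg.
exact: (hk_equiv G_sub tau_nonreal Gmax).
Qed.

Lemma Msum_second_diff x w d : cp_ok x ->
  chisum (fun g => hk x (w + d) g + hk x (w - d) g - 2 * hk x w g) =
  Msum x (w + d) + Msum x (w - d) - (2 : C) *: Msum x w.
Proof.
move=> xok; have [A _ HA] := hk_abs_le.
have ha v := HA x v xok.
have h2 : abs_le G (fun g => - 2 * hk x w g) (`|- 2| * (A * rho x ^+ 2)) by exact: abs_leZ.
have h1 : abs_le G (fun g => hk x (w + d) g + hk x (w - d) g) (A * rho x ^+ 2 + A * rho x ^+ 2).
  have h := sum_leD (fun g _ => normr_ge0 (hk x (w + d) g)) (fun g _ => normr_ge0 (hk x (w - d) g)) (ha _) (ha _).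
  by apply: sum_le_mono h => g _; exact: ler_normD.
have -> : (fun g => hk x (w + d) g + hk x (w - d) g - 2 * hk x w g) =
  (fun g => (hk x (w + d) g + hk x (w - d) g) + - 2 * hk x w g).
  by apply/funext => g; rewrite mulNr.
rewrite (chisumD h1 h2) (chisumD (ha _) (ha _)) (chisumZ (- 2) (ha w)).
by rewrite rmorphN scaleNr rmorph_nat.
Qed.

Lemma Msum_second_diff_le (H : R) : exists2 K : R, 0 < K & forall x w d i j, cp_ok x ->
  abs d <= H -> abs ((Msum x (w + d) + Msum x (w - d) - (2 : C) *: Msum x w) i j) <= K.
Proof.
have [K K0 HK] := second_diff_sum G_sub tau_nonreal Gmax Y_gt0 t_gt0 H.
exists (2 * K); first by rewrite mulr_gt0.
move=> x w d i j xok hd; rewrite -Msum_second_diff//; apply: chisum_le.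
exact: HK.
Qed.

Let X := (cusp_param R * C)%type.
Let S : set X := [set y | cp_ok y.1].
Let M (y : X) := Msum y.1 y.2.

Lemma lap_bounding b : L b -> bounding S M (lap (chi (translation b))).
Proof.
move=> Lb; have Gb := stab_translation Gmax Lb.
have GNb : G (translation (- b)) by apply: (stab_translation Gmax); exact: latticeN.
have [K K0 HK] := Msum_second_diff_le (abs b).
exists K => -[x w] /= xok i j.
have := HK x w b i j xok (lexx _).
rewrite -!actz_translation !Msum_equiv// translationN chiV//.
rewrite -normcN; congr (abs _ <= _).
rewrite /M/= /lap !mulmxBl mulmxDl !mul1mx !mxE; ring.
Qed.

Lemma chi_absorb (P : 'M[C]_n) b1 b2 : L b1 -> L b2 ->
  P *m chi (translation b1) = P -> P *m chi (translation b2) = P ->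
  P *m chi (translation (b1 + b2)) = P.
Proof.
move=> L1 L2 h1 h2; rewrite -translationD chi_mul ?mulmxA ?h1//;
  exact: (stab_translation Gmax).
Qed.

Lemma chi_absorbN (P : 'M[C]_n) b : L b ->
  P *m chi (translation b) = P -> P *m chi (translation (- b)) = P.
Proof.
move=> Lb h; have Gb := stab_translation Gmax Lb.
rewrite translationN chiV// -{1}h -mulmxA.
by have [-> _] := unitary_adj (chi_unit Gb); rewrite mulmx1.
Qed.

Lemma latticeMz (c : C) (m : int) : (c = 1 \/ c = tau) -> L (m%:~R * c).
Proof.
case=> ->; [exists m, 0|exists 0, m]; first by rewrite mulr1 mul0r addr0.
by rewrite add0r.
Qed.

Lemma chi_absorbMz (P : 'M[C]_n) (c : C) (m : int) : (c = 1 \/ c = tau) ->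
  P *m chi (translation c) = P -> P *m chi (translation (m%:~R * c)) = P.
Proof.
move=> cE h; have Lm k : L (k%:~R * c) by exact: latticeMz.
have Lc : L c by rewrite -[c]mul1r; exact: (Lm 1).
have nat_case (k : nat) : P *m chi (translation (k%:~R * c)) = P.
  elim: k => [|k IH]; first by rewrite mul0r translation0 chi1 mulmx1.
  by rewrite -addn1 PoszD intrD mulrDl mul1r; exact: chi_absorb.
case: m => k; first exact: nat_case.
by rewrite NegzE mulrNz mulNr; apply: chi_absorbN.
Qed.

Lemma chi_absorb_lattice (P : 'M[C]_n) b : L b ->
  P *m chi (translation 1) = P -> P *m chi (translation tau) = P ->
  P *m chi (translation b) = P.
Proof.
move=> [p [q ->]] h1 h2; rewrite -[p%:~R]mulr1; apply: chi_absorb.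
- by apply: latticeMz; left.
- by apply: latticeMz; right.
- by apply: chi_absorbMz => //; left.
- by apply: chi_absorbMz => //; right.
Qed.

Lemma entry_second_diff (A B D : 'M[C]_n) i j :
  (A + B - (2 : C) *: D) i j = A i j + B i j - 2 * D i j.
Proof. by rewrite !mxE. Qed.

Lemma Msum_osc (P : 'M[C]_n) : (forall b, L b -> P *m chi (translation b) = P) ->
  exists2 K : R, 0 < K & forall x w1 w2 i j, cp_ok x ->
  abs ((P *m Msum x w1 - P *m Msum x w2) i j) <= K.
Proof.
move=> PL; have [K K0 HK] := Msum_second_diff_le (1 + abs tau).
have [A _ HA] := hk_abs_le.
pose c := \sum_i \sum_k abs (P i k).
have c0 : 0 <= c by apply: sumr_ge0 => i _; apply: sumr_ge0 => k _; exact: normc_ge0.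
have PE (N : 'M[C]_n) (B : R) : 0 <= B -> (forall i j, abs (N i j) <= B) ->
    forall i j, abs ((P *m N) i j) <= c * B.
  move=> B0 HB i j; rewrite mxE; apply: le_trans (ler_normc_sum _ _ _) _.
  apply: (@le_trans _ _ ((\sum_k abs (P i k)) * B)).
    rewrite mulr_suml; apply: ler_sum => k _; rewrite Normc.normcM.
    by rewrite ler_wpM2l ?normc_ge0.
  rewrite ler_wpM2r// /c [leRHS](bigD1 i)//= lerDl.
  by apply: sumr_ge0 => l _; apply: sumr_ge0 => k _; exact: normc_ge0.
exists (2 * (c * K) + 1); first by rewrite ltr_pwDr// !mulr_ge0// ltW.
move=> x w1 w2 i j xok.
pose f w : C := (P *m Msum x w) i j.
have per w b : L b -> f (w + b) = f w.
  move=> Lb; rewrite /f -actz_translation Msum_equiv//; last exact: (stab_translation Gmax).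
  by rewrite mulmxA PL.
have bnd w : abs (f w) <= c * (2 * (A * rho x ^+ 2)).
  apply: PE => [|k l]; last exact: chisum_le (HA x w xok).
  by rewrite mulr_ge0//; exact: sum_le_ge0 (HA x w xok).
have sd w d : abs d <= 1 + abs tau -> abs (f (w + d) + f (w - d) - 2 * f w) <= c * K.
  move=> hd; have := PE _ _ (ltW K0) (fun i j => HK x w d i j xok hd) i j.
  by rewrite mulmxBr mulmxDr -scalemxAr entry_second_diff.
(* [periodic_osc] is about real functions, so it is applied through [e], which will be the real and
   then the imaginary part. *)
have reP (e : C -> R) : (forall u v, e (u + v) = e u + e v) -> (forall u, `|e u| <= abs u) ->
    `|e (f w1) - e (f w2)| <= c * K.
  move=> eD eabs.
  have e0 : e 0 = 0 by have := eD 0 0; rewrite addr0 => h; lra.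
  have eN u : e (- u) = - e u.
    by have := eD u (- u); rewrite subrr e0 => h; lra.
  apply: (@periodic_osc R tau (fun w => e (f w)) (c * (2 * (A * rho x ^+ 2)))).
  - exact: tau_nonreal.
  - by move=> w b Lb; rewrite per.
  - by move=> w; apply: le_trans (eabs _) (bnd w).
  - move=> w d hd; have := le_trans (eabs _) (sd w d hd).
    rewrite !eD eN (_ : 2 * f w = f w + f w); last by ring.
    by rewrite eD ler_norml => /andP[+ _]; rewrite mulr_natl mulr2n.
rewrite (_ : (P *m Msum x w1 - P *m Msum x w2) i j = f w1 - f w2); last by rewrite mxE; congr (_ + _); rewrite mxE.
apply: le_trans (ler_normc_ReIm _) _.
have h1 := reP (@complex.Re R) (fun u v => ltac:(by case: u v => [? ?] [? ?])) (@ler_Re_normc R).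
have h2 := reP (@complex.Im R) (fun u v => ltac:(by case: u v => [? ?] [? ?])) (@ler_Im_normc R).
rewrite ReB ImB; lra.
Qed.

Variable Pinf : 'M[C]_n.
Hypothesis Pinf_proj : orthogonal_projection (fixed_vectors G chi) Pinf.

Lemma fixed_vectorsB (v w : 'cV[C]_n) : fixed_vectors G chi v -> fixed_vectors G chi w ->
  fixed_vectors G chi (v - w).
Proof. by move=> hv hw g Gg; rewrite mulmxBr hv// hw. Qed.

Lemma Pinf_fixed v : fixed_vectors G chi v -> Pinf *m v = v.
Proof.
move=> hv; have [h1 h2] := Pinf_proj v.
apply/esym/eqP; rewrite -subr_eq0; apply/eqP; apply: inner_self_eq0.
by apply: h2; exact: fixed_vectorsB.
Qed.

(** The adjoint of [chi g] fixes the fixed vectors, so [chi g *m v] and [v] have the same inner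
    products with all of them, hence the same projection. *)
Lemma Pinf_chi g : G g -> Pinf *m chi g = Pinf.
Proof.
move=> Gg; have GV := stabV G_sub Gg.
have key (v : 'cV[C]_n) : Pinf *m (chi g *m v) = Pinf *m v.
  have [h1 h2] := Pinf_proj (chi g *m v); have [h3 h4] := Pinf_proj v.
  have hw : fixed_vectors G chi (Pinf *m (chi g *m v) - Pinf *m v) by exact: fixed_vectorsB.
  apply/eqP; rewrite -subr_eq0; apply/eqP; apply: inner_self_eq0.
  set u := _ - _ in hw *.
  have e1 : inner (chi g *m v) u = inner v u.
    by rewrite inner_adj -chiV// hw.
  have := h2 _ hw; have := h4 _ hw; rewrite !innerBl -/u e1.
  move=> /eqP; rewrite subr_eq0 => /eqP <-.
  by move=> /eqP; rewrite subr_eq0 => /eqP ->; rewrite subrr.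
apply/matrixP => i j.
have /matrixP/(_ i 0) := key (delta_mx j 0).
by rewrite mulmxA -!colE !mxE.
Qed.

Lemma Pinf_Msum x w : cp_ok x -> Pinf *m Msum x w = (Tsum Gamma t x w)%:C *: Pinf.
Proof.
move=> xok; have [A _ HA] := hk_abs_le.
rewrite (mul_chisum _ (HA x w xok)); apply/matrixP => i j; rewrite !mxE.
rewrite mulrC -(csum_real _ (HA x w xok)); apply: eq_csum => g Gg.
by rewrite Pinf_chi.
Qed.

(** A vector [v] in the common kernel is fixed by the lattice, because a lattice vector contributes
    its [lap] to the ideal. Then [chi g *m v] is fixed by the lattice too, [P] acts as the identity
    on both, and [P (chi g - 1) v = 0] becomes [chi g *m v = v]. *)
Lemma sub_Pinf_bounding : bounding S M (1%:M - Pinf).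
Proof.
apply: bounding_of_kernel => v hv.
have L1 : L 1 := lattice1 tau.
have Lt : L tau by exists 0, 1; rewrite add0r mul1r.
have G1 := stab_translation Gmax L1; have Gt := stab_translation Gmax Lt.
have u1 := chi_unit G1; have ut := chi_unit Gt.
have [Z [P1 Pt]] := fixed_absorber u1 ut.
set A := lap _ + lap _ in P1 Pt; set P := 1%:M - Z *m A in P1 Pt.
have PL b : L b -> P *m chi (translation b) = P.
  by move=> Lb; exact: chi_absorb_lattice.
have fixL b : L b -> chi (translation b) *m v = v.
  move=> Lb; apply: lap_kernel; first by apply: chi_unit; exact: (stab_translation Gmax).
  exact/hv/lap_bounding.
have PA (w : 'cV_n) : (forall b, L b -> chi (translation b) *m w = w) -> P *m w = w.
  move=> hw; suff : A *m w = 0 by move=> h; rewrite /P mulmxBl -mulmxA h mulmx0 subr0 mul1mx.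
  have lap0 b : L b -> lap (chi (translation b)) *m w = 0.
    move=> Lb; have Ub := chi_unit (stab_translation Gmax Lb).
    by rewrite lapE// -mulmxA mulmxBl mul1mx hw// subrr mulmx0.
  by rewrite /A mulmxDl !lap0// addr0.
suff fixG : fixed_vectors G chi v.
  by rewrite mulmxBl mul1mx Pinf_fixed// subrr.
move=> g Gg; have GV := stabV G_sub Gg.
have [K K0 HK] := Msum_osc PL.
have hJ : bounding S M (P *m (chi g - 1%:M)).
  exists K => -[x w] xok i j; rewrite /M -mulmxA (mulmxBl (chi g)) mul1mx /=.
  by rewrite -(Msum_equiv w (xok : cp_ok x) Gg) mulmxBr; exact: HK.
have := hv _ hJ; rewrite -mulmxA (mulmxBl (chi g)) mul1mx mulmxBr.
rewrite [P *m v]PA// PA; first by move=> /eqP; rewrite subr_eq0 => /eqP.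
move=> b Lb; have Gb := stab_translation Gmax Lb.
have La : L (al (g^-1)%g * b) by exact: (al_lattice G_sub Gmax GV Lb).
have Ga := stab_translation Gmax La.
(* The lattice is normalized by [g]: pushing a translation through [g] turns it into another one,
   which [v] absorbs. *)
have e : (translation b * g)%g = (g * translation (al (g^-1)%g * b)%R)%g.
  rewrite -(conj_translation b (stab_fix GV)).
  by rewrite invgK !mulgA mulgV mul1g.
by rewrite mulmxA -chi_mul// e chi_mul// -mulmxA fixL.
Qed.

Lemma Msum_approx : exists K : R, forall x w i j, cp_ok x ->
  abs ((Msum x w - (Tsum Gamma t x w)%:C *: Pinf) i j) <= K.
Proof.
have [K HK] := sub_Pinf_bounding.
exists K => x w i j xok; have := HK (x, w) xok i j.
by rewrite mulmxBl mul1mx /M/= Pinf_Msum.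
Qed.

End TwistedSum.

(** * Unfolding over a fundamental domain of the stabilizer *)

Section Unfolding.
Variables (R : realType) (Gamma : set (PSL2 R)) (tau : R[i]).
Hypothesis G_sub : is_subgroup Gamma.
Hypothesis tau_nonreal : complex.Im tau != 0.
Hypothesis Gmax :
  max_tf_parabolic_subgroup (stab_infty Gamma) (@translation R @` lattice tau).
Variable D : set (R * R).
Hypothesis D_fund : cusp_fundamental_domain Gamma D.
Local Notation C := R[i].
Local Notation abs := (@Normc.normc R).
Local Notation G := (stab_infty Gamma).
Local Notation mu := (@lebesgue_measure R).
Local Notation mu2 := (mu \x mu)%E.
Implicit Types (g h : PSL2 R).

Definition act2 g (w : R * R) : R * R := of_cplx (actz g (cplx w)).

Lemma cplxK (w : R * R) : of_cplx (cplx w) = w.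
Proof. by case: w. Qed.

Lemma of_cplxK (z : C) : cplx (of_cplx z) = z.
Proof. by case: z. Qed.

Lemma act2E g w : act2 g w =
  ((rot (complex.Re (al g)) (complex.Im (al g)) w).1 + complex.Re (be g),
   (rot (complex.Re (al g)) (complex.Im (al g)) w).2 + complex.Im (be g)).
Proof.
rewrite /act2 /actz /rot /of_cplx /cplx; case: w => u v.
by case: (al g) (be g) => [a1 a2] [b1 b2] /=; congr (_, _); ring.
Qed.

Lemma measurable_act2 g : measurable_fun [set: R * R] (act2 g).
Proof.
have -> : act2 g = fun w => ((rot (complex.Re (al g)) (complex.Im (al g)) w).1 + complex.Re (be g),
   (rot (complex.Re (al g)) (complex.Im (al g)) w).2 + complex.Im (be g)).
  by apply/funext => w; exact: act2E.
exact: measurable_affine_rot.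
Qed.

Lemma act2M g h w : G g -> G h -> act2 (g * h)%g w = act2 g (act2 h w).
Proof. by move=> Gg Gh; rewrite /act2 of_cplxK actzM// ?(stab_fix Gg) ?(stab_fix Gh). Qed.

Lemma act21 w : act2 1%g w = w.
Proof. by rewrite /act2 actz1 cplxK. Qed.

Lemma ge0_integral_act2 g (f : R * R -> \bar R) : G g ->
  measurable_fun [set: R * R] f -> (forall w, 0 <= f w)%E ->
  (\int[mu2]_w f (act2 g w) = \int[mu2]_w f w)%E.
Proof.
move=> Gg mf f0.
rewrite -[RHS](@ge0_integral_affine_rot R (complex.Re (al g)) (complex.Im (al g))
  (complex.Re (be g)) (complex.Im (be g)) f)//.
  by apply: eq_integral => w _; rewrite act2E.
by rewrite -sqr_normcE (al_norm1 G_sub tau_nonreal Gmax)// expr1n.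
Qed.

(** The stabilizer is countable, by its integer code. Writing its sums as series over [nat] makes
    term-by-term integration available. *)
Lemma esum_stab_series : exists (N : set nat) (e : nat -> PSL2 R),
  (forall n, N n -> G (e n)) /\
  forall a : PSL2 R -> \bar R, (forall g, G g -> 0 <= a g)%E ->
  ((\esum_(g in G) a g) = \sum_(n <oo) if n \in N then a (e n) else 0)%E.
Proof.
have [f f_inj] := stab_label G_sub tau_nonreal Gmax.
pose N := f @` G.
pose e n := if pselect (exists2 g, G g & f g = n) is left p then s2val (cid2 p) else 1%g.
have eP n : N n -> G (e n) /\ f (e n) = n.
  by rewrite /e; case: pselect => // p _; case: (cid2 p).
have eK g : G g -> e (f g) = g.
  move=> Gg; have [h1 h2] : G (e (f g)) /\ f (e (f g)) = f g by apply: eP; exists g.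
  by apply: f_inj; rewrite ?inE.
exists N, e; split; first by move=> n /eP[].
move=> a a0.
transitivity (\esum_(n in N) a (e n))%E.
  rewrite (@esum_image R _ _ G f (fun n => a (e n))) //.
  by apply: eq_esum => g Gg; rewrite eK.
rewrite esum_mkcond -nneseries_esumT//.
by move=> n; case: ifP => // /set_mem /eP[Ge _]; exact: a0.
Qed.

Lemma measurable_esum_stab (a : PSL2 R -> R * R -> R) :
  (forall g w, 0 <= a g w) -> (forall g, measurable_fun [set: R * R] (a g)) ->
  measurable_fun [set: R * R] (fun w => \esum_(g in G) (a g w)%:E)%E.
Proof.
move=> a0 ma; have [N [e [Ge He]]] := esum_stab_series.
pose F (w : R * R) := (\sum_(n <oo) if n \in N then (a (e n) w)%:E else 0)%E.
have FE : F = (fun w => \esum_(g in G) (a g w)%:E)%E.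
  by apply/funext => w; rewrite /F (He (fun g => (a g w)%:E))// => g _; rewrite lee_fin.
rewrite -FE; apply: ge0_emeasurable_sum => [n w _ _|n _].
  by case: ifP; rewrite ?lee_fin.
case: (boolP (n \in N)) => _; last exact: measurable_cst.
by apply/measurable_EFinP; exact: ma.
Qed.

(** The second factor on the right counts how often the translates of [E] cover [w]. The set [E] is
    left general because no single choice has multiplicity exactly 1: it is at least 1 everywhere
    for [D], and at most 1 for its interior. *)
Lemma unfold_set (E : set (R * R)) (f : R * R -> R) :
  measurable E -> measurable_fun [set: R * R] f -> (forall w, 0 <= f w) ->
  (\int[mu2]_(w in E) (\esum_(g in G) (f (act2 g w))%:E) =
   \int[mu2]_w ((f w)%:E * \esum_(g in G) (\1_E (act2 (g^-1)%g w))%:E))%E.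
Proof.
move=> mE mf f0; have [N [e [Ge He]]] := esum_stab_series.
have GeV n : N n -> G ((e n)^-1)%g by move=> Nn; apply: (stabV G_sub); exact: Ge.
transitivity (\int[mu2]_(w in E) \sum_(n <oo)
    (if n \in N then (f (act2 (e n) w))%:E else 0))%E.
  by apply: eq_integral => w _; rewrite He// => g _; rewrite lee_fin.
rewrite integral_nneseries//; last 2 first.
- move=> n; case: (boolP (n \in N)) => _; last exact: measurable_cst.
  apply: measurable_funTS; apply/measurable_EFinP.
  by apply: measurableT_comp => //; exact: measurable_act2.
- by move=> n w _; case: ifP => _; rewrite ?lee_fin.
have mI h : measurable_fun [set: R * R] (fun w => \1_E (act2 h w) : R).
  by apply: (measurableT_comp (measurable_indic mE)); exact: measurable_act2.
transitivity (\int[mu2]_w \sum_(n <oo)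
    (if n \in N then (f w * \1_E (act2 ((e n)^-1)%g w))%:E else 0))%E; last first.
  apply: eq_integral => w _; rewrite He; last by move=> g _; rewrite lee_fin.
  rewrite -nneseriesZl//; last by move=> n _; case: ifP => _; rewrite ?lee_fin.
  by apply: eq_eseriesr => n _; case: ifP => _; rewrite ?mule0// EFinM.
rewrite [RHS]integral_nneseries//; last 2 first.
- move=> n; case: (boolP (n \in N)) => _; last exact: measurable_cst.
  by apply/measurable_EFinP; apply: measurable_funM => //; exact: mI.
- by move=> n w _; case: ifP => _; rewrite ?lee_fin ?mulr_ge0.
apply: eq_eseriesr => n _; have [nN|nN] := boolP (n \in N); last by rewrite !integral0.
have Nn := set_mem nN.
pose F w := (f w * \1_E (act2 ((e n)^-1)%g w))%:E.
have mF : measurable_fun [set: R * R] F.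
  by apply/measurable_EFinP; apply: measurable_funM => //; exact: mI.
rewrite -(@ge0_integral_act2 (e n) F (Ge _ Nn) mF); last by move=> w; rewrite lee_fin mulr_ge0.
rewrite integral_mkcond; apply: eq_integral => w _.
rewrite patchE /F -act2M; [|exact: GeV|exact: Ge].
by rewrite mulVg act21 indicE; case: ifP => _; rewrite ?mulr1 ?mulr0.
Qed.

Lemma D_closed : closed D.
Proof. by have [[_ h] _ _ _] := D_fund; move=> x cx; apply: h. Qed.

Lemma orbitP p q : cplane_orbit Gamma p q <-> exists2 g, G g & act2 g p = q.
Proof.
split=> -[g Gg].
  rewrite (mobius_fix _ (stab_fix Gg)) => -[] e.
  by exists g => //; rewrite /act2 e cplxK.
by move=> <-; exists g => //; rewrite (mobius_fix _ (stab_fix Gg)) /act2 of_cplxK.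
Qed.

(** A fundamental domain only forbids two distinct equivalent interior points, so that [g] is
    trivial needs an argument: the nearby interior points [y + d] and [y + al g * d] are equivalent,
    hence equal, and [al g = 1]. *)
Lemma interior_free y g : (interior D) y -> G g -> act2 g y = y -> g = 1%g.
Proof.
move=> iy Gg gy.
have /nbhs_ballP[e /= e0 He] : nbhs y (interior D).
  by apply: open_nbhs_nbhs; split => //; exact: open_interior.
have a1 : al g = 1.
  pose d := e / 2; have d0 : 0 < d by rewrite divr_gt0.
  pose y1 : R * R := (y.1 + d, y.2).
  have near (u : C) : abs u = d -> (interior D) (of_cplx (cplx y + u)).
    move=> ud; apply: He; case: u ud => u1 u2 ud.
    have h1 := ler_Re_normc (u1 +i* u2); have h2 := ler_Im_normc (u1 +i* u2).
    rewrite ud /= in h1 h2.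
    split; rewrite /ball/= opprD addNKr normrN.
      by apply: le_lt_trans h1 _; rewrite /d; lra.
    by apply: le_lt_trans h2 _; rewrite /d; lra.
  have dd : abs d%:C = d by rewrite normc_ge0_real// ltW.
  have i1 := near _ dd.
  have i2 : (interior D) (of_cplx (cplx y + al g * d%:C)).
    by apply: near; rewrite Normc.normcM (al_norm1 G_sub tau_nonreal Gmax)// mul1r.
  have [_ _ uniqD _] := D_fund.
  have : of_cplx (cplx y + d%:C) = of_cplx (cplx y + al g * d%:C).
    apply: uniqD => //; apply/orbitP; exists g => //.
    rewrite /act2 of_cplxK; congr of_cplx.
    have : actz g (cplx y) = cplx y by rewrite -[LHS]of_cplxK -/(act2 g y) gy.
    by rewrite /actz => h; rewrite mulrDr addrAC h.
  move=> /(congr1 (@cplx R)); rewrite !of_cplxK => /addrI.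
  rewrite -[X in X = _]mul1r => /mulIf -> //.
  by apply/eqP => /complexI d00; move: d0; rewrite d00 ltxx.
apply: fix_infty_inj; rewrite ?(stab_fix Gg) ?al1 ?be1 //; first exact: fix_infty1.
have : actz g (cplx y) = cplx y by rewrite -[LHS]of_cplxK -/(act2 g y) gy.
by rewrite /actz a1 mul1r => /eqP; rewrite -subr_eq0 addrAC subrr add0r => /eqP.
Qed.

Lemma multiplicity_ge1 w : (1 <= (\esum_(g in G) (\1_D (act2 (g^-1)%g w))%:E) :> \bar R)%E.
Proof.
have [_ /(_ w I)[y Dy /orbitP[g Gg gw]] _ _] := D_fund.
have GV := stabV G_sub Gg.
apply: esum_ge; exists [set (g^-1)%g].
  by split; [exact: finite_set1|move=> _ ->].
by rewrite fsbig_set1 invgK gw indicE mem_set.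
Qed.

Lemma multiplicity_le1 w :
  ((\esum_(g in G) (\1_(interior D) (act2 (g^-1)%g w))%:E) <= 1 :> \bar R)%E.
Proof.
have [[g0 [Gg0 ig0]]|none] := pselect (exists g, G g /\ (interior D) (act2 (g^-1)%g w)).
  rewrite (esumID [set g0]); last by move=> g _; rewrite lee_fin.
  have -> : G `&` [set g0] = [set g0] by apply/seteqP; split => [x []|x ->].
  rewrite esum_set1 ?lee_fin// [X in (_ + X)%E]esum1 ?adde0.
    by rewrite lee_fin indicE; case: (_ \in _).
  move=> g [Gg gn]; rewrite indicE memNset// => ig; apply: gn => /=.
  have GV := stabV G_sub Gg; have GV0 := stabV G_sub Gg0.
  have [_ _ uniqD _] := D_fund.
  have e : act2 (g^-1)%g w = act2 (g0^-1)%g w.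
    apply: uniqD => //; apply/orbitP; exists (g0^-1 * g)%g; first exact: (stabM G_sub).
    by rewrite act2M// -(act2M _ Gg GV) mulgV act21.
  have h : (g0^-1 * g)%g = 1%g.
    apply: (interior_free ig0); first exact: (stabM G_sub).
    by rewrite -{1}e act2M// -(act2M _ Gg GV) mulgV act21.
  by rewrite -(mulVKg g0 g) h mulg1.
rewrite esum1// => g Gg; rewrite indicE memNset// => ig.
by apply: none; exists g.
Qed.

(** The two multiplicity bounds squeeze the integral: [D] gives one inequality, its interior the
    other, and the boundary is a null set. *)
Lemma integral_unfold (f : R * R -> R) :
  measurable_fun [set: R * R] f -> (forall w, 0 <= f w) ->
  (\int[mu2]_(w in D) (\esum_(g in G) (f (act2 g w))%:E) = \int[mu2]_w (f w)%:E)%E.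
Proof.
move=> mf f0.
have mD : measurable D by apply: closed_measurable2; exact: D_closed.
have oI : open (interior D) by exact: open_interior.
have mI : measurable (interior D) by exact: open_measurable2.
have mEs (E : set (R * R)) : measurable E -> measurable_fun [set: R * R]
    (fun w => \esum_(g in G) (\1_E (act2 (g^-1)%g w) : R)%:E)%E.
  move=> mE.
  have m1 g : measurable_fun [set: R * R] (fun w => \1_E (act2 (g^-1)%g w) : R).
    by apply: (measurableT_comp (measurable_indic mE)); exact: measurable_act2.
  have p1 g w : 0 <= (\1_E (act2 (g^-1)%g w) : R) by [].
  exact: (measurable_esum_stab p1 m1).
have mFs : measurable_fun [set: R * R] (fun w => \esum_(g in G) (f (act2 g w))%:E)%E.
  apply: (@measurable_esum_stab (fun g w => f (act2 g w))) => // g.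
  by apply: measurableT_comp => //; exact: measurable_act2.
have Fs0 w : (0 <= \esum_(g in G) (f (act2 g w))%:E)%E.
  by apply: esum_ge0 => g _; rewrite lee_fin.
have Es0 (E : set (R * R)) w : (0 <= \esum_(g in G) (\1_E (act2 (g^-1)%g w) : R)%:E)%E.
  by apply: esum_ge0 => g _; rewrite lee_fin.
apply/eqP; rewrite eq_le; apply/andP; split; last first.
  rewrite unfold_set//; apply: ge0_le_integral => //.
  - by move=> w _; rewrite lee_fin.
  - by apply/measurable_EFinP.
  - by apply: emeasurable_funM; [apply/measurable_EFinP|exact: mEs].
  - by move=> w _; rewrite lee_pemulr ?lee_fin// multiplicity_ge1.
have -> : (\int[mu2]_(w in D) (\esum_(g in G) (f (act2 g w))%:E) =
    \int[mu2]_(w in interior D) \esum_(g in G) (f (act2 g w))%:E)%E.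
  have sub : interior D `<=` D by exact: interior_subset.
  have mDI : measurable (D `\` interior D) by exact: measurableD.
  rewrite -{1}(setDUK sub) ge0_integral_setU//; last 2 first.
  - exact: measurable_funTS.
  - by apply/disj_setPS => x [? []].
  rewrite [X in (_ + X)%E]null_set_integral ?adde0//.
    exact: measurable_funTS.
  have [[_ cD] _ _ null] := D_fund.
  have -> : D `\` interior D = (closure D `\` interior D) `&` setT.
    rewrite setIT; congr (_ `\` _).
    by apply/seteqP; split; [exact: subset_closure|move=> x cx; apply: cD].
  exact: null.
rewrite unfold_set//; apply: ge0_le_integral => //.
- by move=> w _; rewrite mule_ge0 ?lee_fin.
- by apply: emeasurable_funM; [apply/measurable_EFinP|exact: mEs].
- by apply/measurable_EFinP.
- move=> w _; rewrite -[leRHS]mule1; apply: lee_wpmul2l; first by rewrite lee_fin.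
  exact: multiplicity_le1.
Qed.

End Unfolding.

(** * The integral of k_t over a horizontal plane *)

Section HeatIntegral.
Variables (R : realType) (t : R).
Hypothesis t_gt0 : 0 < t.
Local Notation C := R[i].
Local Notation abs := (@Normc.normc R).
Local Notation mu := (@lebesgue_measure R).
Local Notation mu2 := (mu \x mu)%E.

Lemma continuous_comp_within (A : set R) (k u : R -> R) :
  {within A, continuous k} -> continuous u -> (forall s, A (u s)) ->
  continuous (k \o u).
Proof.
move=> /subspace_continuousP ck cu Au s.
apply: (@cvg_comp _ _ _ u k _ (within A (nbhs (u s)))); last exact: ck.
move=> P hP; have : nbhs s (fun y => A (u y) -> P (u y)) := cu s _ hP.
by rewrite [X in _ -> X]/nbhs/=; apply: filterS => y; apply.
Qed.

Lemma continuous_cosh_dist (r r' : R) : continuous (cosh_dist r r').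
Proof.
move=> s; apply: cvgM; last exact: cvg_cst.
by apply: cvgD; [apply: cvgD; [exact: cvg_id|exact: cvg_cst]|exact: cvg_cst].
Qed.

(** Two points on one vertical line are at distance [|ln (r / r')|]; the square spares the
    distinction of signs. *)
Lemma arcosh_cosh_dist (r r' : R) : 0 < r -> 0 < r' ->
  arcosh (cosh_dist r r' 0) ^+ 2 = ln (r / r') ^+ 2.
Proof.
move=> r0 r0'; rewrite /arcosh.
have -> : cosh_dist r r' 0 ^+ 2 - 1 = ((r ^+ 2 - r' ^+ 2) / (2 * r * r')) ^+ 2.
  by rewrite /cosh_dist; field; rewrite !lt0r_neq0.
have d0 : 0 < 2 * r * r' by rewrite !mulr_gt0.
rewrite sqrtr_sqr normrM [`|_^-1|]gtr0_norm ?invr_gt0//.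
have [rr|rr] := leP r' r.
  rewrite ger0_norm; last by rewrite subr_ge0; nra.
  by congr (ln _ ^+ 2); rewrite /cosh_dist; field; rewrite !lt0r_neq0.
rewrite ltr0_norm; last by rewrite subr_lt0; nra.
rewrite (_ : _ + _ = (r / r')^-1).
  by rewrite lnV ?posrE ?divr_gt0// sqrrN.
by rewrite /cosh_dist; field; rewrite !lt0r_neq0.
Qed.

Lemma powR_three_half (A : R) : 0 < A -> A `^ (3 / 2) = A * Num.sqrt A.
Proof.
move=> A0; have -> : 3 / 2 = 1 + 2^-1 :> R by field.
rewrite powRD; last by rewrite (gt_eqF A0) implybT.
by rewrite powRr1 ?powR12_sqrt// ltW.
Qed.

Definition heat_mass (r r' : R) : R :=
  r * r' * (expR (- t) / Num.sqrt (4 * pi * t)) * expR (- (ln (r / r') ^+ 2 / (4 * t))).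

(** Truncation at 0 keeps the argument of [heat_k] in [[1, +oo[], which yields a profile that is
    continuous on the whole line. *)
Lemma continuous_heat_radial (r r' : R) : 0 < r -> 0 < r' ->
  continuous (fun s : R => heat_k t (cosh_dist r r' (Num.max s 0))).
Proof.
move=> r0 r0'.
apply: (@continuous_comp_within _ (@heat_k R t) (fun s => cosh_dist r r' (Num.max s 0)) (@within_heat_k R t)).
  move=> s; apply: (@continuous_comp _ _ _ (fun s : R => Num.max s 0)).
    by apply: continuous_max; [exact: cvg_id|exact: cvg_cst].
  exact: continuous_cosh_dist.
by move=> s; rewrite /= in_itv/= andbT cosh_dist_ge1// le_max lexx orbT.
Qed.

Lemma measurable_heat_radial (r r' : R) (z : C) : 0 < r -> 0 < r' ->
  measurable_fun [set: R * R] (fun w => heat_k t (cosh_dist r r' (abs (cplx w - z) ^+ 2))).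
Proof.
move=> r0 r0'; have cG := continuous_heat_radial r0 r0'.
apply: (eq_measurable_fun (fun w : R * R => heat_k t (cosh_dist r r'
    (Num.max ((w.1 - complex.Re z) ^+ 2 + (w.2 - complex.Im z) ^+ 2) 0)))).
  move=> w _; rewrite max_l ?addr_ge0 ?sqr_ge0// sqr_normcE.
  by case: z w => z1 z2 [w1 w2].
apply: (measurableT_comp (continuous_measurable_fun cG)).
apply: measurable_funD; apply: measurable_funX; apply: measurable_funB => //.
Qed.

(** [delta] is affine in [s = |w - z|^2] with slope [1 / (2 r r')], so [2 r r'] times
    [heat_primitive] is a primitive in [s]. Its value at 0 contributes [4 pi t], which reduces the
    power 3/2 of [4 pi t] to 1/2. *)
Lemma heat_integral (r r' : R) (z : C) : 0 < r -> 0 < r' ->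
  (\int[mu2]_w (heat_k t (cosh_dist r r' (abs (cplx w - z) ^+ 2)))%:E =
   (heat_mass r r')%:E)%E.
Proof.
move=> r0 r0'; have d0 : 0 < 2 * r * r' by rewrite !mulr_gt0.
pose G (s : R) := heat_k t (cosh_dist r r' (Num.max s 0)).
pose H (s : R) := 2 * r * r' * heat_primitive t (cosh_dist r r' s).
have cd1 (s : R) : 0 <= s -> 1 <= cosh_dist r r' s by exact: cosh_dist_ge1.
have cG : continuous G by exact: continuous_heat_radial.
have G0 s : 0 <= G s by apply: heat_k_ge0 => //; rewrite cd1// le_max lexx orbT.
have dH (s : R) : 0 < s -> is_derive s 1 H (G s).
  move=> s0; have c1 : 1 < cosh_dist r r' s.
    rewrite ltr_pdivlMr// mul1r; have := sqr_ge0 (r - r'); lra.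
  have h1 : is_derive s 1 (cosh_dist r r') (2 * r * r')^-1.
    have -> : cosh_dist r r' = (2 * r * r')^-1 \*: (fun s : R => s + (r ^+ 2 + r' ^+ 2)).
      by apply/funext => y; transitivity ((2 * r * r')^-1 * (y + (r ^+ 2 + r' ^+ 2))) => //;
        rewrite /cosh_dist mulrC addrA.
    by apply: is_derive_eq; rewrite /GRing.scale/=; ring.
  have h2 := is_derive1_comp (is_derive_heat_primitive t_gt0 c1) h1.
  have -> : H = (2 * r * r') \*: (heat_primitive t \o cosh_dist r r') by [].
  apply: is_derive_eq; rewrite /GRing.scale/= /G max_l ?ltW//.
  by rewrite mulrCA divff ?mulr1// lt0r_neq0.
have cH0 : {for 0, continuous H}.
  apply: cvgM; first exact: cvg_cst.
  apply: continuous_comp; first exact: continuous_cosh_dist.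
  by apply: continuous_heat_primitive; apply: lt_le_trans (cd1 0 _).
have cHl : H s @[s --> +oo] --> 0.
  rewrite -[X in _ --> X](mulr0 (2 * r * r')); apply: cvgM; first exact: cvg_cst.
  apply: cvg_comp (heat_primitive_cvgy t_gt0).
  apply: gt0_cvgMly; first by rewrite invr_gt0.
  exact: (cvg_comp _ _ (cvg_addrr (r ^+ 2)) (cvg_addrr (r' ^+ 2))).
have HE : pi * (0 - H 0) = heat_mass r r'.
  rewrite /H /heat_primitive arcosh_cosh_dist// powR_three_half ?mulr_gt0 ?pi_gt0//.
  have q0 : 0 < Num.sqrt (4 * pi * t) by rewrite sqrtr_gt0 !mulr_gt0// pi_gt0.
  rewrite /heat_mass; move: (Num.sqrt _) q0 => q q0.
  move: (@pi_gt0 R); move: (pi : R) => p p0.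
  by field; rewrite !lt0r_neq0.
rewrite -HE.
pose f0 (w : R * R) := (G (w.1 ^+ 2 + w.2 ^+ 2))%:E.
have mf0 : measurable_fun [set: R * R] f0.
  apply/measurable_EFinP; apply: measurableT_comp; first exact: continuous_measurable_fun.
  by apply: measurable_funD; apply: measurable_funX.
have f00 w : (0 <= f0 w)%E by rewrite lee_fin.
have c1 : (1 : R) ^+ 2 + 0 ^+ 2 = 1 by rewrite expr1n expr0n addr0.
have e1 := ge0_integral_radial G0 cG dH cH0 cHl.
have e2 := ge0_integral_affine_rot (- complex.Re z) (- complex.Im z) c1 mf0 f00.
apply: (eq_trans _ (eq_trans e2 e1)); apply: eq_integral => w _.
have GE (s : R) : 0 <= s -> G s = heat_k t (cosh_dist r r' s).
  by rewrite /G => /max_l ->.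
rewrite /f0 GE; last exact: addr_ge0 (sqr_ge0 _) (sqr_ge0 _).
congr ((heat_k t (cosh_dist r r' _))%:E); rewrite sqr_normcE /rot.
by move: z w {f0 mf0 f00 e2} => [z1 z2] [w1 w2] /=; ring.
Qed.

End HeatIntegral.

(** * The mean value of the untwisted sum *)

Section CuspAsymptotics.
Variables (R : realType) (Gamma : set (PSL2 R)) (tau : R[i]).
Hypothesis G_sub : is_subgroup Gamma.
Hypothesis tau_nonreal : complex.Im tau != 0.
Hypothesis Gmax :
  max_tf_parabolic_subgroup (stab_infty Gamma) (@translation R @` lattice tau).
Variables (Y t : R).
Hypothesis Y_gt0 : 0 < Y.
Hypothesis t_gt0 : 0 < t.
Variable D : set (R * R).
Hypothesis D_fund : cusp_fundamental_domain Gamma D.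
Local Notation C := R[i].
Local Notation abs := (@Normc.normc R).
Local Notation G := (stab_infty Gamma).
Local Notation mu := (@lebesgue_measure R).
Local Notation mu2 := (mu \x mu)%E.
Local Notation T := (Tsum Gamma t).

Lemma stab_inv_bij : set_bij G G (fun g => g^-1)%g.
Proof.
split; first by move=> g Gg; exact: stabV.
  by move=> g h _ _ /invg_inj.
by move=> g Gg; exists (g^-1)%g; [exact: stabV|rewrite invgK].
Qed.

Let f (x : cusp_param R) (v : R * R) : R :=
  heat_k t (cosh_dist (cp_r x) (cp_r' x) (abs (cplx v - cp_z x) ^+ 2)).

Let hk_inv x g v : G g -> hk t x (cplx v) (g^-1)%g = f x (act2 g v).
Proof.
move=> Gg; rewrite /hk /f; congr (heat_k t (cosh_dist _ _ (_ ^+ 2))).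
have GV := stabV G_sub Gg.
rewrite /act2 of_cplxK -(abs_actzB G_sub tau_nonreal Gmax _ _ Gg).
by rewrite -(actzM _ (stab_fix Gg) (stab_fix GV)) mulgV actz1.
Qed.

Let f_ge0 x v : cp_ok Y x -> 0 <= f x v.
Proof.
move=> xok; have [r0 r0'] := cp_gt0 Y_gt0 xok; apply: heat_k_ge0 => //.
by apply: cosh_dist_ge1 => //; exact: sqr_ge0.
Qed.

Let esumT x v : cp_ok Y x ->
  ((\esum_(g in G) (f x (act2 g v))%:E) = (T x (cplx v))%:E)%E.
Proof.
move=> xok; have [A _ HA] := hk_sum G_sub tau_nonreal Gmax Y_gt0 t_gt0.
rewrite /Tsum -(sum_le_rsum _ (HA x (cplx v) xok)); last first.
  by move=> g _; exact: (hk_ge0 Y_gt0 t_gt0).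
rewrite (@reindex_esum R _ _ G G _ (fun g => (hk t x (cplx v) g)%:E) stab_inv_bij).
by apply: eq_esum => g Gg; rewrite hk_inv.
Qed.

Let measurable_f x : cp_ok Y x -> measurable_fun [set: R * R] (f x).
Proof. by move=> /(cp_gt0 Y_gt0)[r0 r0']; exact: measurable_heat_radial. Qed.

Let integral_T x : cp_ok Y x ->
  (\int[mu2]_(v in D) (T x (cplx v))%:E = (heat_mass t (cp_r x) (cp_r' x))%:E)%E.
Proof.
move=> xok; have [r0 r0'] := cp_gt0 Y_gt0 xok.
rewrite -(heat_integral t_gt0 (cp_z x) r0 r0').
rewrite -(integral_unfold G_sub tau_nonreal Gmax D_fund (measurable_f xok)); last first.
  by move=> v; exact: f_ge0.
by apply: eq_integral => v _; rewrite esumT.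
Qed.

Let measurable_T x : cp_ok Y x -> measurable_fun [set: R * R] (fun v => (T x (cplx v))%:E).
Proof.
move=> xok; apply: (eq_measurable_fun (fun v => \esum_(g in G) (f x (act2 g v))%:E)%E).
  by move=> v _; exact: esumT.
apply: (measurable_esum_stab G_sub tau_nonreal Gmax).
  by move=> g v; exact: f_ge0.
move=> g; apply: measurableT_comp; first exact: measurable_f.
exact: measurable_act2.
Qed.

(** Some lattice translate of [z'] lies within [1 + |tau|] of [w], and its term alone suffices. A
    positive lower bound on a function with finite integral over [D] is what makes the area
    finite. *)
Lemma Tsum_ge x : cp_ok Y x -> exists2 d : R, 0 < d & forall w, d <= T x w.
Proof.
move=> xok; have [r0 r0'] := cp_gt0 Y_gt0 xok.
have [A _ HA] := hk_sum G_sub tau_nonreal Gmax Y_gt0 t_gt0.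
have c1 (s : R) : 0 <= s -> 1 <= cosh_dist (cp_r x) (cp_r' x) s by exact: cosh_dist_ge1.
exists (heat_k t (cosh_dist (cp_r x) (cp_r' x) ((1 + abs tau) ^+ 2))).
  by apply: heat_k_gt0 => //; apply: c1; exact: sqr_ge0.
move=> w; have [b Lb hb] := lattice_near tau_nonreal (w - cp_z x).
have Gb := stab_translation Gmax Lb.
apply: (@le_trans _ _ (hk t x w (translation b))).
  apply: heat_k_nincr => //; first by apply: c1; exact: sqr_ge0.
  rewrite actz_translation ler_pM2r ?invr_gt0 ?mulr_gt0// !lerD2r.
  rewrite (_ : w - (cp_z x + b) = w - cp_z x - b); last by ring.
  rewrite lerXn2r ?nnegrE ?normc_ge0//.
  by rewrite addr_ge0 ?normc_ge0.
rewrite -lee_fin -(sum_le_rsum _ (HA x w xok)); last first.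
  by move=> g _; exact: (hk_ge0 Y_gt0 t_gt0).
apply: esum_ge; exists [set translation b].
  by split; [exact: finite_set1|move=> _ ->].
by rewrite fsbig_set1.
Qed.

Let mD : measurable D.
Proof. by apply: closed_measurable2; exact: (D_closed D_fund). Qed.

Lemma heat_mass_gt0 (r r' : R) : 0 < r -> 0 < r' -> 0 < heat_mass t r r'.
Proof.
move=> r0 r0'; apply: mulr_gt0; last exact: expR_gt0.
apply: mulr_gt0; first exact: mulr_gt0.
apply: divr_gt0; first exact: expR_gt0.
by rewrite sqrtr_gt0 !mulr_gt0// pi_gt0.
Qed.

(** [area] is a [fine], so an infinite measure would read as 0; finiteness follows by comparing a
    positive constant with [T] at one sample parameter. *)
Lemma area_fin : mu2 D = (area D)%:E.
Proof.
pose x := CuspParam 0 Y Y.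
have xok : cp_ok Y x by split; rewrite /= lexx.
have [d d0 hd] := Tsum_ge xok.
rewrite /area fineK// ge0_fin_numE ?measure_ge0//.
rewrite ltey; apply/eqP => a.
have : (\int[mu2]_(v in D) d%:E <= \int[mu2]_(v in D) (T x (cplx v))%:E)%E.
  apply: ge0_le_integral => //.
  - by move=> v _; rewrite lee_fin ltW.
  - by apply: measurable_funTS; exact: measurable_T.
  - by move=> v _; rewrite lee_fin.
rewrite integral_T// integral_cst//.
have mD' : measurable D by exact: mD.
by rewrite [X in (_ * X)%E](_ : _ = +oo%E)// gt0_muley// leye_eq.
Qed.

Lemma area_gt0 : 0 < area D.
Proof.
pose x := CuspParam 0 Y Y.
have xok : cp_ok Y x by split; rewrite /= lexx.
have a0 : 0 <= area D by rewrite -lee_fin -area_fin measure_ge0.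
rewrite lt_neqAle a0 andbT eq_sym; apply/eqP => a.
have := integral_T xok; rewrite null_set_integral//; last 2 first.
- by apply: measurable_funTS; exact: measurable_T.
- by apply: (etrans area_fin); rewrite a.
by move=> [] e; have := heat_mass_gt0 Y_gt0 Y_gt0; rewrite -e ltxx.
Qed.

Lemma Tsum_approx : exists K : R, forall x w, cp_ok Y x ->
  `|T x w - heat_mass t (cp_r x) (cp_r' x) / area D| <= K.
Proof.
have [K K0 HK] := Tsum_osc G_sub tau_nonreal Gmax Y_gt0 t_gt0.
exists K => x w xok.
have aD := area_gt0.
have hu v : T x (cplx v) <= T x w + K.
  by rewrite -lerBlDl; exact: le_trans (ler_norm _) (HK x (cplx v) w xok).
have hl v : T x w - K <= T x (cplx v).
  by rewrite lerBlDr -lerBlDl; exact: le_trans (ler_norm _) (HK x w (cplx v) xok).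
have [d d0 hd] := Tsum_ge xok.
have T0 v : 0 <= T x v by apply: ltW; exact: lt_le_trans (hd v).
have iT := integral_T xok.
have mT : measurable_fun D (fun v => (T x (cplx v))%:E).
  by apply: measurable_funTS; exact: measurable_T.
have upper : heat_mass t (cp_r x) (cp_r' x) <= (T x w + K) * area D.
  rewrite -lee_fin -iT EFinM -area_fin -integral_cst//.
  apply: ge0_le_integral => //.
  - by move=> v _; rewrite lee_fin.
  - by move=> v _; rewrite lee_fin.
(* Comparison of integrals is used for nonnegative functions only, whence the truncation of the
   lower bound. *)
have lower : Num.max (T x w - K) 0 * area D <= heat_mass t (cp_r x) (cp_r' x).
  rewrite -lee_fin -iT EFinM -area_fin -integral_cst//.
  apply: ge0_le_integral => //.
  - by move=> v _; rewrite lee_fin le_max lexx orbT.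
  - by move=> v _; rewrite lee_fin ge_max hl T0.
have lower' : (T x w - K) * area D <= heat_mass t (cp_r x) (cp_r' x).
  by apply: le_trans lower; rewrite ler_pM2r// le_max lexx.
rewrite -ler_pdivlMr// in lower'; rewrite -ler_pdivrMr// in upper.
by rewrite ler_norml; apply/andP; split; lra.
Qed.

End CuspAsymptotics.

(** * Elements that do not fix the cusp *)

Section Counting.
Variable R : realType.
Local Notation C := R[i].
Local Notation abs := (@Normc.normc R).
Implicit Types M N : SL2 R.

Lemma sl2_invE M : [/\ (M^-1)%g 0 0 = M 1 1, (M^-1)%g 0 1 = - M 0 1,
  (M^-1)%g 1 0 = - M 1 0 & (M^-1)%g 1 1 = M 0 0].
Proof.
have dM := sl2_detE M; pose N := (M^-1)%g.
have e i j : N i 0 * M 0 j + N i 1 * M 1 j = (i == j)%:R.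
  by rewrite -mulmx2E -[LHS]/((M^-1 * M)%g i j) mulVg /= mxE.
have col0 i : N i 0 = (i == 0)%:R * M 1 1 - (i == 1)%:R * M 1 0.
  by rewrite -!e -[LHS]mulr1 -dM; ring.
have col1 i : N i 1 = (i == 1)%:R * M 0 0 - (i == 0)%:R * M 0 1.
  by rewrite -!e -[LHS]mulr1 -dM; ring.
by rewrite -/N !col0 !col1 /= !mul1r !mul0r !subr0 !sub0r.
Qed.

(** The squared Hilbert-Schmidt norm, which is blind to the sign of [M]. *)
Definition hsn M : R :=
  abs (M 0 0) ^+ 2 + abs (M 0 1) ^+ 2 + abs (M 1 0) ^+ 2 + abs (M 1 1) ^+ 2.

Lemma normcN (z : C) : abs (- z) = abs z.
Proof. by case: z => x y; rewrite /= !sqrrN. Qed.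

Lemma hsn_repr M : hsn (repr (to_psl2 M)) = hsn M.
Proof.
by case: (psl2_repr M) => ->; rewrite /hsn//= !mxE !normcN.
Qed.

Lemma hsn_ge0 M : 0 <= hsn M.
Proof. by rewrite !addr_ge0 ?sqr_ge0. Qed.

Lemma entry_le_hsn M i j : abs (M i j) <= 1 + hsn M.
Proof.
have h (x y : R) : 0 <= y -> x ^+ 2 <= y -> x <= 1 + y.
  by move=> y0 xy; have := sqr_ge0 (x - 1); nra.
apply: h; first exact: hsn_ge0.
rewrite /hsn; have := (sqr_ge0 (abs (M 0 0)), sqr_ge0 (abs (M 0 1)),
  sqr_ge0 (abs (M 1 0)), sqr_ge0 (abs (M 1 1))) => -[[[]]].
by case: (ord2P i) => ->; case: (ord2P j) => ->; lra.
Qed.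

Definition cell (s : R) (z : C) : int * int :=
  (Num.floor (complex.Re z * s), Num.floor (complex.Im z * s)).

Definition mx_cell (s : R) M :=
  ((cell s (M 0 0), cell s (M 0 1)), (cell s (M 1 0), cell s (M 1 1))).

Lemma floor_eq_dist (x y : R) : Num.floor x = Num.floor y -> `|x - y| < 1.
Proof.
move=> e; have := floor_itv x; have := floor_itv y.
rewrite e ltr_norml => /andP[h1 h2] /andP[h3 h4].
rewrite intrD in h2 h4; apply/andP; split; lra.
Qed.

Lemma cell_eq_dist s z w : 0 < s -> cell s z = cell s w -> abs (z - w) * s < 2.
Proof.
move=> s0 [/floor_eq_dist eR /floor_eq_dist eI].
have h := ler_normc_ReIm (z - w).
apply: (le_lt_trans (ler_wpM2r (ltW s0) h)).
move: eR eI; rewrite -!mulrBl !normrM !(gtr0_norm s0) mulrDl {h}.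
case: z w => [z1 z2] [w1 w2] /= h1 h2; lra.
Qed.

Lemma mx_cell_dist s M N i j : 0 < s -> mx_cell s M = mx_cell s N ->
  abs (N i j - M i j) * s < 2.
Proof.
move=> s0 [] e1 e2 e3 e4 e5 e6 e7 e8; apply: cell_eq_dist => //.
by case: (ord2P i) => ->; case: (ord2P j) => ->; rewrite /cell; congr pair.
Qed.

Definition int_weight (m : int) : R := 1 / (1 ^+ 2 + m%:~R ^+ 2).

Definition dbl (I : Type) (u : I -> R) (p : I * I) : R := u p.1 * u p.2.

Lemma dbl_ge0 (I : Type) (u : I -> R) : (forall i, 0 <= u i) -> forall p, 0 <= dbl u p.
Proof. by move=> u0 p; rewrite mulr_ge0. Qed.

Lemma ler_dbl (I : Type) (u : I -> R) a p : 0 <= a -> a <= u p.1 -> a <= u p.2 ->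
  a ^+ 2 <= dbl u p.
Proof. by move=> a0 h1 h2; rewrite expr2 ler_pM. Qed.

Lemma sum_le_dbl (I : choiceType) (u : I -> R) A : (forall i, 0 <= u i) ->
  sum_le setT u A -> sum_le setT (dbl u) (A * A).
Proof. by move=> u0 h; exact: sum_le_prod. Qed.

Lemma int_weight_ge0 m : 0 <= int_weight m.
Proof. by rewrite divr_ge0// addr_ge0 ?sqr_ge0. Qed.

Lemma int_weight_floor (x B : R) : `|x| <= B ->
  ((B + 2) ^+ 2)^-1 <= int_weight (Num.floor x).
Proof.
move=> xB; have B0 : 0 <= B by exact: le_trans xB.
have h : `|(Num.floor x)%:~R : R| <= B + 1.
  have := floor_itv x; rewrite intrD => /andP[h1 h2].
  by move: xB; rewrite !ler_norml => /andP[h3 h4]; apply/andP; split; lra.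
rewrite /int_weight div1r lef_pV2 ?posrE ?exprn_gt0//; last 2 first.
- lra.
- by rewrite expr1n ltr_pwDl ?sqr_ge0.
rewrite -[_%:~R ^+ 2]real_normK ?num_real//.
by move: (`|_|) (normr_ge0 ((Num.floor x)%:~R : R)) h => u u0 h; nra.
Qed.

(** Three doublings: a matrix cell consists of eight integers, two for each complex entry. *)
Definition cell_weight := dbl (dbl (dbl int_weight)).

Lemma cell_weight_ge0 c : 0 <= cell_weight c.
Proof. by do 3!apply: dbl_ge0 => ?; exact: int_weight_ge0. Qed.

Lemma cell_weight_sum : exists A : R, sum_le setT cell_weight A.
Proof.
have h := sum_le_inv_sqr (@ltr01 R) (lexx 1).
have h1 := sum_le_dbl int_weight_ge0 h.
have h2 := sum_le_dbl (dbl_ge0 int_weight_ge0) h1.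
by eexists; exact: (sum_le_dbl (dbl_ge0 (dbl_ge0 int_weight_ge0)) h2).
Qed.

Lemma cell_weight_ge (s B : R) M : 0 <= s -> (forall i j, abs (M i j) * s <= B) ->
  ((B + 2) ^+ 2)^-1 ^+ 8 <= cell_weight (mx_cell s M).
Proof.
move=> s0 MB; set a := (_ ^+ 2)^-1.
have a0 : 0 <= a by rewrite invr_ge0 sqr_ge0.
have hc i j : a ^+ 2 <= dbl int_weight (cell s (M i j)).
  have hs (x : R) : `|x| <= abs (M i j) -> `|x * s| <= B.
    by move=> h; rewrite normrM (ger0_norm s0) (le_trans _ (MB i j))// ler_wpM2r.
  by apply: ler_dbl => //=; apply: int_weight_floor; apply: hs;
    [exact: ler_Re_normc|exact: ler_Im_normc].
rewrite (exprM a 4 2) (exprM a 2 2).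
have a20 : 0 <= a ^+ 2 by exact: sqr_ge0.
have a40 : 0 <= a ^+ 2 ^+ 2 by exact: sqr_ge0.
by apply: ler_dbl => //=; apply: ler_dbl => //=; apply: hc.
Qed.

Variable H : set (PSL2 R).
Hypothesis H_klein : kleinian H.

Lemma discrete_near1 : exists2 e : R, 0 < e & forall N, H (to_psl2 N) ->
  (forall i j, abs (N i j - (i == j)%:R) < e) -> N = 1%g.
Proof.
case: H_klein => -[H1 _ _] /(_ 1%g H1) [e e0 he]; exists e => // N HN h.
by apply: he => // i j; rewrite [X in _ - X]mxE.
Qed.

(** If [N] is close to [M] on the scale of the inverse of the size of [M], then
    [M^-1 N - 1 = M^-1 (N - M)] is small, and discreteness at the identity applies. The inverse has
    the same entries as [M] up to order and sign, hence the same bound [s]. *)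
Lemma discrete_separated : exists2 e : R, 0 < e & forall M N (s : R),
  H (to_psl2 M) -> H (to_psl2 N) -> (forall i j, abs (M i j) <= s) ->
  (forall i j, abs (N i j - M i j) * s * 2 < e) -> N = M.
Proof.
have [e e0 he] := discrete_near1; exists e => // M N s HM HN Ms NM.
have [_ HMul HV] := H_klein.1.
apply: (mulgI (M^-1)%g); rewrite mulVg; apply: he.
  rewrite to_psl2M; apply: HMul => //.
  have -> : to_psl2 (M^-1)%g = ((to_psl2 M)^-1)%g; last exact: HV.
  by apply: (mulgI (to_psl2 M)); rewrite mulgV -to_psl2M mulgV.
have [i00 i01 i10 i11] := sl2_invE M.
have Vs i j : abs ((M^-1)%g i j) <= s.
  by case: (ord2P i) => ->; case: (ord2P j) => ->;
    rewrite ?i00 ?i01 ?i10 ?i11 ?normcN.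
move=> i j.
have -> : (M^-1 * N)%g i j - (i == j)%:R =
    (M^-1)%g i 0 * (N 0 j - M 0 j) + (M^-1)%g i 1 * (N 1 j - M 1 j).
  have -> : (i == j)%:R = (M^-1)%g i 0 * M 0 j + (M^-1)%g i 1 * M 1 j.
    by rewrite -mulmx2E -[RHS]/((M^-1 * M)%g i j) mulVg /= mxE.
  by rewrite [X in X - _]mulmx2E; ring.
apply: (le_lt_trans (le_normcD _ _)); rewrite !Normc.normcM.
have hk k : abs ((M^-1)%g i k) * abs (N k j - M k j) <= abs (N k j - M k j) * s.
  by rewrite [leRHS]mulrC ler_wpM2r ?normc_ge0.
have := (hk 0, hk 1, NM 0 j, NM 1 j) => -[[[]]]; lra.
Qed.

(** An element of size about [n] is coded by [n] and by the cell of its entries for a mesh of order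
    [1 / n]. By [discrete_separated] the code is injective, and the sum is compared with a
    convergent sum over all codes. *)
Lemma sum_le_hsn : exists B : R, sum_le H (fun g => ((1 + hsn (repr g)) ^+ 34)^-1) B.
Proof.
have [e e0 he] := discrete_separated.
have [A HA] := cell_weight_sum.
(* In a common cell of mesh [1 / (L n)] two entries differ by less than [2 / (L n)], and [L > 4 / e]
   brings this below the separation [e / (2 n)]. *)
pose L : R := (Num.truncn (4 / e)).+1%:R.
have L4 : 4 < e * L by rewrite -ltr_pdivrMl// mulrC truncnS_gt.
have L1 : 1 <= L by rewrite ler1n.
pose nn (g : PSL2 R) : nat := (Num.truncn (1 + hsn (repr g))).+1.
have S1 (g : PSL2 R) : 1 <= 1 + hsn (repr g) by rewrite lerDl hsn_ge0.
have nS (g : PSL2 R) : 1 + hsn (repr g) < (nn g)%:R by exact: truncnS_gt.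
have Sn (g : PSL2 R) : (nn g)%:R <= 2 * (1 + hsn (repr g)).
  have : (Num.truncn (1 + hsn (repr g)))%:R <= 1 + hsn (repr g).
    by rewrite truncn_le addr_ge0 ?hsn_ge0.
  rewrite /nn -[X in _ -> X <= _]natr1; have := S1 g; lra.
pose code (g : PSL2 R) : int * _ := (nn g : int, mx_cell (L * (nn g)%:R) (repr g)).
have wt0 := int_weight_ge0.
have HW := sum_le_prod wt0 cell_weight_ge0 (sum_le_inv_sqr (@ltr01 R) (lexx 1)) HA.
(* The weight of [n] loses [2 n^2]. Entries scaled by [L n] are at most [L n^2], so the eight
   integers lose [((L + 2) n^2)^16]. Together this is the power 34 of [n], and [2 ^+ 34] replaces
   [n] by [1 + hsn]. *)
pose K : R := 2 * (L + 2) ^+ 16 * 2 ^+ 34.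
have K0 : 0 < K by rewrite !mulr_gt0 ?exprn_gt0//; lra.
exists (K * (4 * (1 + 1^-1) * A)); apply: (sum_le_inj (e := code) _ _ _ (sum_leZ (ltW K0) HW)).
- move=> g h /set_mem Hg /set_mem Hh ecode.
  have en : nn g = nn h by case: ecode => e1 *; rewrite /nn e1.
  have ec : mx_cell (L * (nn g)%:R) (repr g) = mx_cell (L * (nn h)%:R) (repr h).
    exact: (congr1 snd ecode).
  suff e1 : repr h = repr g by rewrite -(psl2_reprK g) -e1 psl2_reprK.
  apply: (he (repr g) (repr h) (nn g)%:R); rewrite ?psl2_reprK//.
    by move=> i j; apply: (le_trans (entry_le_hsn _ _ _)); exact: ltW.
  move=> i j; rewrite -en in ec.
  have n0 : 0 < (nn g)%:R :> R by rewrite ltr0n.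
  have Ln0 : 0 < L * (nn g)%:R by apply: mulr_gt0 => //; exact: lt_le_trans ltr01 L1.
  have := mx_cell_dist i j Ln0 ec; rewrite mulrCA.
  have := mulr_ge0 (normc_ge0 (repr h i j - repr g i j)) (ltW n0).
  move: (abs _ * _) => x; move: L4 L1 e0; clear; move: L => l; nra.
- by move=> c; exact: mulr_ge0 (ltW K0) (mulr_ge0 (wt0 _) (cell_weight_ge0 _)).
move=> g Hg /=.
have n1 : 1 <= (nn g)%:R :> R by rewrite ler1n.
have n0 : 0 < (nn g)%:R :> R by exact: lt_le_trans n1.
set n := (nn g)%:R in n0 n1 *.
have h1 : (2 * n ^+ 2)^-1 <= int_weight (nn g).
  have p1 : 0 < 1 ^+ 2 + (nn g : int)%:~R ^+ 2 :> R.
    by rewrite expr1n ltr_pwDl ?sqr_ge0.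
  have p2 : 0 < 2 * n ^+ 2 by rewrite mulr_gt0 ?exprn_gt0.
  rewrite /int_weight div1r lef_pV2 ?posrE// expr1n -[(nn g : int)%:~R]/n.
  by have := exprn_ege1 2 n1; lra.
have Mn i j : abs (repr g i j) * (L * n) <= L * n ^+ 2.
  rewrite mulrCA ler_pM2l; last lra.
  rewrite expr2 ler_pM2r//; apply: le_trans (entry_le_hsn _ _ _) _.
  exact: ltW (nS g).
have Ln0 : 0 <= L * n by rewrite mulr_ge0 ?ltW//; lra.
have h2 := cell_weight_ge Ln0 Mn.
have h3 : ((((L + 2) * n ^+ 2) ^+ 2)^-1) ^+ 8 <= cell_weight (mx_cell (L * n) (repr g)).
  apply: le_trans h2; rewrite lerXn2r ?nnegrE ?invr_ge0 ?sqr_ge0//.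
  rewrite lef_pV2 ?posrE ?exprn_gt0//; last 2 first.
  - by rewrite mulr_gt0 ?exprn_gt0//; lra.
  - have := exprn_gt0 2 n0; nra.
  rewrite lerXn2r ?nnegrE//; have := exprn_ege1 2 n1; nra.
have h4 : (2 * n ^+ 2)^-1 * ((((L + 2) * n ^+ 2) ^+ 2)^-1) ^+ 8 <=
    int_weight (nn g) * cell_weight (mx_cell (L * n) (repr g)).
  apply: ler_pM h1 h3; first by rewrite invr_ge0 mulr_ge0// sqr_ge0.
  by apply: exprn_ge0; rewrite invr_ge0 sqr_ge0.
apply: le_trans (ler_wpM2l (ltW K0) h4).
have L0 : 0 < L + 2 by lra.
have key (l m : R) : 0 < l -> 0 < m -> 2 * l ^+ 16 * 2 ^+ 34 *
    ((2 * m ^+ 2)^-1 * (((l * m ^+ 2) ^+ 2)^-1) ^+ 8) = ((m / 2) ^+ 34)^-1.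
  by move=> l0 m0; rewrite !exprVn !exprMn !exprVn; field; rewrite !lt0r_neq0.
rewrite /K key//.
have S0 : 0 < 1 + hsn (repr g) by exact: lt_le_trans ltr01 (S1 g).
have m0 : 0 < n / 2 by exact: divr_gt0.
rewrite lef_pV2 ?posrE ?exprn_gt0// lerXn2r ?nnegrE ?(ltW S0) ?(ltW m0)//.
by rewrite ler_pdivrMr// mulrC Sn.
Qed.

End Counting.

(** * Hyperbolic distance and the size of matrix entries *)

Section OffCusp.
Variable R : realType.
Local Notation C := R[i].
Local Notation abs := (@Normc.normc R).
Implicit Types (M : SL2 R) (z w : C).

(** The polynomial form of [2 r r' delta], as [delta_sl2] shows: the squared entries of the matrix
    obtained from [M] by translating both points to the vertical axis, weighted by the heights. *)
Definition dist_form M z z' (r r' : R) : R :=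
  abs (M 0 0 * z' + M 0 1 - z * (M 1 0 * z' + M 1 1)) ^+ 2
  + r' ^+ 2 * abs (M 0 0 - M 1 0 * z) ^+ 2
  + r ^+ 2 * (abs (M 1 0 * z' + M 1 1) ^+ 2 + abs (M 1 0) ^+ 2 * r' ^+ 2).

(** Lagrange's identity for the vectors [(u, s a)] and [(v, s c)]. *)
Lemma normc_lagrange (u v a c : C) (s : R) :
  abs (u * v^*%C + a * c^*%C * (s ^+ 2)%:C) ^+ 2 + s ^+ 2 * abs (a * v - c * u) ^+ 2 =
  (abs u ^+ 2 + s ^+ 2 * abs a ^+ 2) * (abs v ^+ 2 + abs c ^+ 2 * s ^+ 2).
Proof.
rewrite !sqr_normcE; case: u v a c => [u1 u2] [v1 v2] [a1 a2] [c1 c2] /=; ring.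
Qed.

Lemma sqr_normcC z : (abs z ^+ 2)%:C = z * z^*%C.
Proof.
by rewrite sqr_normcE; case: z => x y; apply/eqP; rewrite eq_complex /=;
  apply/andP; split; apply/eqP; ring.
Qed.

Lemma delta_sl2 M (P Q : R * R * R) : 0 < P.2 -> 0 < Q.2 ->
  delta P (h3_act_sl2 M Q) =
  dist_form M (cplx P.1) (cplx Q.1) P.2 Q.2 / (2 * P.2 * Q.2).
Proof.
case: P Q => [p r] [q s]; rewrite /delta /h3_act_sl2 /h3_z /h3_r !conjE.
cbn [fst snd] => r0 s0; have dM := sl2_detE M.
move: (cplx p) (cplx q) => z w {p q}; rewrite /dist_form.
 set a := M 0 0 in dM *; set b := M 0 1 in dM *.
set c := M 1 0 in dM *; set d := M 1 1 in dM *.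
set v := c * w + d; set u := a * w + b.
(* Translating by [- z] on the left preserves the determinant, so Lagrange's identity, with 1 as its
   determinant term, evaluates the squared numerator of the difference of [z]-coordinates. *)
pose u' := u - z * v; pose a' := a - c * z.
set DD := abs v ^+ 2 + _.
have det' : a' * v - c * u' = 1 by rewrite /a' /u' /v /u -dM; ring.
have := normc_lagrange u' v a' c s; rewrite det' Normc.normc1 expr1n mulr1 -/DD => HL.
have D0 : 0 < DD.
  have DD0 : 0 <= DD by exact: addr_ge0 (sqr_ge0 _) (mulr_ge0 (sqr_ge0 _) (sqr_ge0 _)).
  rewrite lt_neqAle DD0 andbT eq_sym; apply/eqP => D0.
  move: HL; rewrite D0 mulr0 => HL; have := exprn_gt0 2 s0.
  have := sqr_ge0 (abs (u' * v^*%C + a' * c^*%C * (s ^+ 2)%:C)).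
  lra.
have DC : DD%:C = v * v^*%C + c * c^*%C * (s ^+ 2)%:C.
  by rewrite -!sqr_normcC -rmorphM -rmorphD.
have DC0 : DD%:C != 0 by rewrite (fmorph_eq0 (real_complex R)) lt0r_neq0.
set X := u * v^*%C + a * c^*%C * (s ^+ 2)%:C.
have -> : z - cplx (of_cplx (X / DD%:C)) = - (u' * v^*%C + a' * c^*%C * (s ^+ 2)%:C) * (DD^-1)%:C.
  rewrite (_ : cplx (of_cplx _) = X / DD%:C); last by case: (X / _).
  rewrite fmorphV; apply: (mulIf DC0); rewrite mulrBl !mulfVK// DC /X /u' /a'; ring.
rewrite Normc.normcM normcN normc_ge0_real ?invr_ge0 ?ltW// exprMn.
have {HL} -> : abs (u' * v^*%C + a' * c^*%C * (s ^+ 2)%:C) ^+ 2 =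
  (abs u' ^+ 2 + s ^+ 2 * abs a' ^+ 2) * DD - s ^+ 2 by rewrite -HL addrK.
rewrite -/u' -/a'; move: (abs u' ^+ 2) (abs a' ^+ 2) DD D0 {DC DC0 X} => x y D D0.
by field; rewrite !lt0r_neq0.
Qed.

Lemma delta_ge1 (P Q : R * R * R) : 0 < P.2 -> 0 < Q.2 -> 1 <= delta P Q.
Proof.
move=> r0 s0; exact: (cosh_dist_ge1 r0 s0 (sqr_ge0 (abs (h3_z P - h3_z Q)))).
Qed.

Lemma h3_act_sl2_gt0 M (P : R * R * R) : 0 < P.2 -> 0 < (h3_act_sl2 M P).2.
Proof.
case: P => [p s]; rewrite /h3_act_sl2 /h3_z /h3_r; cbn [fst snd] => s0.
have dM := sl2_detE M; apply: divr_gt0 => //.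
set v2 := abs _ ^+ 2; set c2 := _ * s ^+ 2.
have v0 : 0 <= v2 by exact: sqr_ge0.
have c0 : 0 <= c2 by exact: mulr_ge0 (sqr_ge0 _) (sqr_ge0 _).
rewrite lt_neqAle addr_ge0// andbT eq_sym; apply/eqP => /eqP.
rewrite paddr_eq0// /v2 /c2 => /andP[].
rewrite sqrf_eq0 => /eqP/Normc.eq0_normc h1.
rewrite mulf_eq0 !sqrf_eq0 (gt_eqF s0) orbF => /eqP/Normc.eq0_normc h2.
move: dM h1; rewrite h2 mul0r mulr0 add0r subr0 => e d0.
by move: e; rewrite d0 mulr0 => /eqP; rewrite eq_sym oner_eq0.
Qed.

Lemma normc_sqrD z w : abs (z + w) ^+ 2 <= 2 * (abs z ^+ 2 + abs w ^+ 2).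
Proof.
rewrite !sqr_normcE; case: z w => [x y] [u v] /=.
by have := sqr_ge0 (x - u); have := sqr_ge0 (y - v); nra.
Qed.

Lemma sqr_normcM z w : abs (z * w) ^+ 2 = abs z ^+ 2 * abs w ^+ 2.
Proof. by rewrite Normc.normcM exprMn. Qed.

(* The four terms of [dist_form] control the entries of [M]: the last one gives
   [|c|^2 r r' <= 2 delta], so that [r r'] is itself at most of order [delta]. *)
Lemma hsn_le_delta (e k Y : R) : 0 < e -> 0 < Y -> exists2 K : R, 0 < K &
  forall M z z' (r r' x : R), e <= abs (M 1 0) ^+ 2 -> abs z ^+ 2 <= k ->
  abs z' ^+ 2 <= k -> Y <= r -> Y <= r' -> 1 <= x ->
  dist_form M z z' r r' = 2 * r * r' * x ->
  1 + hsn M <= K * x ^+ 2.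
Proof.
(* [A] bounds all four terms: [e <= |c|^2] gives [r r' <= 2 x / e], so the whole form is at most
   [4 x^2 / e]. Dividing a term by [r^2] or [r'^2] costs [1 / Y^2], and [|c|^2] is at most
   [2 x / Y^2]. *)
move=> e0 Y0; pose A := 4 / e + 4 / (e * Y ^+ 2) + 2 / Y ^+ 2.
have Y20 : 0 < Y ^+ 2 by rewrite exprn_gt0.
have A0 : 0 < A by rewrite !addr_gt0 ?divr_gt0// mulr_gt0.
pose k' := `|k|; have k0 : 0 <= k' by exact: normr_ge0.
exists (1 + A * (1 + 4 * (1 + k') + 4 * (1 + k' + k' * (2 * (1 + k'))))).
  rewrite addr_gt0// mulr_gt0//; have := mulr_ge0 k0 k0; lra.
move=> M z z' r r' x; rewrite /hsn /dist_form.
set a := M 0 0; set b := M 0 1; set c := M 1 0; set d := M 1 1.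
set v := c * z' + d; pose u' := a * z' + b - z * v; pose a' := a - c * z.
rewrite -/u' -/a' => ec zk z'k rY r'Y x1 HE.
have {}zk : abs z ^+ 2 <= k' by exact: le_trans (ler_norm _).
have {}z'k : abs z' ^+ 2 <= k' by exact: le_trans (ler_norm _).
have hd : abs d ^+ 2 <= 2 * (abs v ^+ 2 + k' * abs c ^+ 2).
  rewrite (_ : d = v + - (z' * c)); last by rewrite /v; ring.
  apply: le_trans (normc_sqrD _ _) _; rewrite normcN sqr_normcM.
  by rewrite ler_pM2l// lerD2l ler_wpM2r ?sqr_ge0.
have ha : abs a ^+ 2 <= 2 * (abs a' ^+ 2 + k' * abs c ^+ 2).
  rewrite (_ : a = a' + z * c); last by rewrite /a'; ring.
  apply: le_trans (normc_sqrD _ _) _; rewrite sqr_normcM.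
  by rewrite ler_pM2l// lerD2l ler_wpM2r ?sqr_ge0.
have hb : abs b ^+ 2 <= 4 * (abs u' ^+ 2 + k' * abs v ^+ 2 + k' * abs a ^+ 2).
  rewrite (_ : b = (u' + z * v) + - (z' * a)); last by rewrite /u'; ring.
  apply: le_trans (normc_sqrD _ _) _; rewrite normcN sqr_normcM.
  have := normc_sqrD u' (z * v); rewrite sqr_normcM.
  have := ler_wpM2r (sqr_ge0 (abs v)) zk; have := ler_wpM2r (sqr_ge0 (abs a)) z'k.
  have := sqr_ge0 (abs a); have := sqr_ge0 (abs v); have := sqr_ge0 (abs u'); nra.
have r0 : 0 < r by exact: lt_le_trans rY.
have r'0 : 0 < r' by exact: lt_le_trans r'Y.
move: ec HE hd ha hb.
move: (sqr_ge0 (abs u')) (sqr_ge0 (abs v)) (sqr_ge0 (abs a')) (sqr_ge0 (abs c)).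
move: (sqr_ge0 (abs a)).
move: (abs u' ^+ 2) (abs v ^+ 2) (abs a' ^+ 2) (abs c ^+ 2) (abs a ^+ 2) (abs b ^+ 2) (abs d ^+ 2).
move=> U V A' Cc Aa Bb Dd Aa0 U0 V0 A'0 C0 ec HE hd ha hb.
have p0 : 0 < r * r' by exact: mulr_gt0.
have Yr : Y ^+ 2 <= r ^+ 2 by rewrite lerXn2r// nnegrE ltW.
have Yr' : Y ^+ 2 <= r' ^+ 2 by rewrite lerXn2r// nnegrE ltW.
have Yp : Y ^+ 2 <= r * r' by rewrite expr2; apply: ler_pM => //; exact: ltW.
have t1 : 0 <= r' ^+ 2 * A' by rewrite mulr_ge0// sqr_ge0.
have t2 : 0 <= r ^+ 2 * V by rewrite mulr_ge0// sqr_ge0.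
have t3 : 0 <= r ^+ 2 * (Cc * r' ^+ 2).
  exact: mulr_ge0 (sqr_ge0 _) (mulr_ge0 C0 (sqr_ge0 _)).
have cp : Cc * (r * r') <= 2 * x.
  rewrite -(ler_pM2l p0) (_ : r * r' * (Cc * (r * r')) = r ^+ 2 * (Cc * r' ^+ 2)); last by ring.
  by rewrite (_ : r * r' * (2 * x) = 2 * r * r' * x); [rewrite -HE; lra|ring].
have x0 : 0 < x by exact: lt_le_trans x1.
have xx : x <= x ^+ 2 by rewrite expr2 ler_peMl// ltW.
have px : r * r' <= 2 * x / e.
  rewrite ler_pdivlMr// mulrC; apply: le_trans cp; by rewrite ler_pM2r.
have q4 : 2 * r * r' * x <= 4 / e * x ^+ 2.
  rewrite (_ : 2 * r * r' * x = r * r' * (2 * x)); last by ring.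
  apply: (@le_trans _ _ (2 * x / e * (2 * x))); first by rewrite ler_pM2r// mulr_gt0.
  by rewrite le_eqVlt; apply/orP; left; apply/eqP; ring.
have e1 : 0 < 4 / e by exact: divr_gt0.
have x20 : 0 < x ^+ 2 by exact: exprn_gt0.
have A1 : 4 / e <= A by rewrite /A -addrA lerDl addr_ge0// divr_ge0 ?mulr_ge0// ltW.
have A2 : 4 / e / Y ^+ 2 <= A.
  rewrite /A (_ : 4 / (e * Y ^+ 2) = 4 / e / Y ^+ 2); last by field; rewrite !lt0r_neq0.
  by rewrite addrAC lerDr addr_ge0// divr_ge0// ltW.
have A3 : 2 / Y ^+ 2 <= A.
  by rewrite /A lerDr addr_ge0// divr_ge0 ?mulr_ge0// ltW.
have hU : U <= A * x ^+ 2.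
  apply: (@le_trans _ _ (4 / e * x ^+ 2)); last by rewrite ler_pM2r.
  by apply: le_trans q4; rewrite -HE; lra.
have hYY (w s : R) : 0 <= w -> Y ^+ 2 <= s -> s * w <= 2 * r * r' * x -> w <= A * x ^+ 2.
  move=> w0 Ys sw; apply: (@le_trans _ _ (4 / e / Y ^+ 2 * x ^+ 2)); last by rewrite ler_pM2r.
  rewrite mulrAC ler_pdivlMr// mulrC; apply: le_trans q4.
  by apply: le_trans sw; rewrite ler_wpM2r.
have hV : V <= A * x ^+ 2 by apply: (hYY _ (r ^+ 2)) => //; rewrite -HE; lra.
have hA : A' <= A * x ^+ 2 by apply: (hYY _ (r' ^+ 2)) => //; rewrite -HE; lra.
have hC : Cc <= A * x ^+ 2.
  apply: (@le_trans _ _ (2 / Y ^+ 2 * x ^+ 2)); last by rewrite ler_pM2r.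
  rewrite mulrAC ler_pdivlMr//; apply: (@le_trans _ _ (2 * x)); last by rewrite ler_pM2l.
  by apply: le_trans cp; rewrite ler_wpM2l.
have kC := ler_wpM2l k0 hC; have kV := ler_wpM2l k0 hV.
have AB : Aa <= 2 * (1 + k') * (A * x ^+ 2) by lra.
have kA := ler_wpM2l k0 AB.
have x21 : 1 <= x ^+ 2 by exact: exprn_ege1.
rewrite [leRHS](_ : _ = x ^+ 2 + (1 + 4 * (1 + k') + 4 * (1 + k' + k' * (2 * (1 + k')))) * (A * x ^+ 2)); last by ring.
move: (A * x ^+ 2) (x ^+ 2) x21 hU hV hC kC kV AB kA hd hb => y x2 x21 hU hV hC kC kV AB kA hd hb.
lra.
Qed.

Variables (Gamma : set (PSL2 R)) (tau : R[i]).
Hypothesis Gamma_klein : kleinian Gamma.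
Hypothesis tau_nonreal : complex.Im tau != 0.
Hypothesis Gmax :
  max_tf_parabolic_subgroup (stab_infty Gamma) (@translation R @` lattice tau).
Local Notation G := (stab_infty Gamma).
Local Notation L := (lattice tau).

Definition trans_sl2 (b : C) : SL2 R := MkSL2 (translation_det b).

Definition shift (b c : C) M : SL2 R := (trans_sl2 b * M * trans_sl2 c)%g.

Lemma shiftE b c M : [/\ shift b c M 0 0 = M 0 0 + b * M 1 0,
  shift b c M 0 1 = (M 0 0 + b * M 1 0) * c + (M 0 1 + b * M 1 1),
  shift b c M 1 0 = M 1 0 & shift b c M 1 1 = M 1 0 * c + M 1 1].
Proof.
by split; rewrite [LHS]mulmx2E !(mulmx2E (translation_mx b)) !mxE /=; ring.
Qed.

Lemma to_psl2_shift b c M :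
  to_psl2 (shift b c M) = (translation b * to_psl2 M * translation c)%g.
Proof. by rewrite !to_psl2M. Qed.

Lemma dist_form_shift b c M z z' r r' :
  dist_form (shift b c M) (z + b) (z' - c) r r' = dist_form M z z' r r'.
Proof.
have [e00 e01 e10 e11] := shiftE b c M; rewrite /dist_form e00 e01 e10 e11.
by congr (abs _ ^+ 2 + _ * abs _ ^+ 2 + _ * (abs _ ^+ 2 + _)); ring.
Qed.

Let Gamma_translation b : L b -> Gamma (translation b).
Proof. by move=> /(stab_translation Gmax)[]. Qed.

(* Left translations reduce [a] modulo [c]; conjugating the unit translation by
   the reduced matrix gives an element within O(|c|^2) of the identity. *)
Lemma lower_left_gap : exists2 e : R, 0 < e & forall M, Gamma (to_psl2 M) ->
  M 1 0 != 0 -> e <= abs (M 1 0) ^+ 2.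
Proof.
have [e e0 he] := discrete_near1 Gamma_klein.
have [_ GM GV] := Gamma_klein.1.
pose k := 1 + abs tau.
have k1 : 1 <= k by rewrite lerDl normc_ge0.
have k0 : 0 < k by exact: lt_le_trans k1.
exists (e / k ^+ 2); first by rewrite divr_gt0// exprn_gt0.
move=> M HM c0; rewrite leNgt; apply/negP; rewrite ltr_pdivlMr ?exprn_gt0// => ce.
have [b Lb hb] := lattice_near tau_nonreal (M 0 0 / M 1 0).
pose N := shift (- b) 0 M; have [N00 _ N10 _] := shiftE (- b) 0 M.
rewrite -/N in N00 N10.
have dN := sl2_detE N.
have GN : Gamma (to_psl2 N).
  rewrite to_psl2_shift translation0 mulg1; apply: (GM) => //.
  by apply: Gamma_translation; apply: latticeN.
have aN : abs (N 0 0) <= k * abs (M 1 0).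
  rewrite N00 (_ : _ + _ = (M 0 0 / M 1 0 - b) * M 1 0); last by field.
  by rewrite Normc.normcM ler_wpM2r ?normc_ge0.
pose Q := (N * trans_sl2 1%R * N^-1)%g.
have GQ : Gamma (to_psl2 Q).
  rewrite (to_psl2M (N * _)%g) (to_psl2M N) (_ : to_psl2 (N^-1)%g = ((to_psl2 N)^-1)%g); last first.
    by apply: (mulgI (to_psl2 N)); rewrite mulgV -to_psl2M mulgV.
  apply: (GM); last exact: GV.
  by apply: (GM) => //; exact: (Gamma_translation (lattice1 tau)).
have [i00 i01 i10 i11] := sl2_invE N.
have QE i j : Q i j = N i 0 * (N^-1)%g 0 j + (N i 0 + N i 1) * (N^-1)%g 1 j.
  rewrite [LHS]mulmx2E !(mulmx2E N) !mxE /=; ring.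
(* [Q - 1] is the conjugate of a matrix of rank one: up to sign its entries are products of two
   entries of the first column of [N], both of size O(|c|). *)
have Q1 i j : abs (Q i j - (i == j)%:R) <= abs (N i 0) * abs (if j == 0 then N 1 0 else N 0 0).
  rewrite QE -Normc.normcM -[leRHS]normcN.
  case: (ord2P i) => ->; case: (ord2P j) => ->; rewrite /= ?i00 ?i01 ?i10 ?i11.
  - by rewrite le_eqVlt; apply/orP; left; apply/eqP; congr abs; rewrite -{1}dN; ring.
  - by rewrite -normcN le_eqVlt; apply/orP; left; apply/eqP; congr abs; ring.
  - by rewrite le_eqVlt; apply/orP; left; apply/eqP; congr abs; ring.
  - by rewrite -normcN le_eqVlt; apply/orP; left; apply/eqP; congr abs; rewrite -{1}dN; ring.
have small i : abs (N i 0) <= k * abs (M 1 0).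
  by case: (ord2P i) => -> //; rewrite N10 ler_peMl ?normc_ge0.
have Q_eq1 : Q = 1%g.
  apply: he => // i j; apply: (le_lt_trans (Q1 i j)).
  apply: le_lt_trans ce; rewrite (_ : abs (M 1 0) ^+ 2 * k ^+ 2 = k * abs (M 1 0) * (k * abs (M 1 0))); last by ring.
  apply: ler_pM; rewrite ?normc_ge0 ?small//.
  by case: (j == 0); exact: small.
have Q10 : Q 1 0 = 0 by rewrite Q_eq1 [LHS]mxE.
have /eqP : N 1 0 ^+ 2 = 0.
  by rewrite -[RHS]oppr0 -[in RHS]Q10 QE i00 i10; ring.
by rewrite sqrf_eq0 N10 (negPf c0).
Qed.

Local Notation Goff := (Gamma `&` ~` G).

Lemma offcusp_c M : Goff (to_psl2 M) -> M 1 0 != 0.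
Proof. by move=> [GM nG]; apply/eqP => c0; apply: nG; split => //; exact/mobius_inftyP. Qed.

Lemma shift_bij b c : L b -> L c ->
  set_bij Goff Goff (fun g => translation b * g * translation c)%g.
Proof.
have [_ GM GV] := Gamma_klein.1.
have sub u v g : L u -> L v -> Goff g -> Goff (translation u * g * translation v)%g.
  move=> Lb Lc Gg; have [GG _] := Gg; split.
    by apply: (GM); [apply: (GM) => //|]; exact: Gamma_translation.
  move=> [_]; rewrite -(psl2_reprK g) -to_psl2_shift => /mobius_inftyP.
  have [_ _ -> _] := shiftE u v (repr g); apply/eqP; apply: offcusp_c.
  by rewrite psl2_reprK.
move=> Lb Lc; split; first by move=> g; exact: sub.
  by move=> g h _ _ /mulIg/mulgI.
move=> g Gg; exists (translation (- b) * g * translation (- c))%g.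
  by apply: sub => //; exact: latticeN.
by rewrite !mulgA translationD subrr translation0 mul1g -mulgA translationD addNr translation0 mulg1.
Qed.

Variables (Y t : R).
Hypothesis Y_gt0 : 0 < Y.
Hypothesis t_gt0 : 0 < t.

(** The bound on entries requires [z] and [z'] in a bounded region. Lattice translations on both
    sides of [g] achieve this while leaving heights and [delta] unchanged and permuting the elements
    that do not fix the cusp. *)
Lemma offcusp_sum : exists B : R, forall P Q : R * R * R, Y <= P.2 -> Y <= Q.2 ->
  sum_le Goff (fun g => heat_k t (delta P (h3_act g Q))) B.
Proof.
have [e e0 he] := lower_left_gap.
have [B HB] := sum_le_hsn Gamma_klein.
(* 68 is twice 34: [1 + hsn] is bounded by a multiple of [delta ^+ 2], and its power 34 makes the
   count summable. *)
have [A A0 HA] := heat_k_decay t_gt0 68.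
have [K K0 HK] := hsn_le_delta ((1 + abs tau) ^+ 2) e0 Y_gt0.
have AK0 : 0 <= A * K ^+ 34 by rewrite mulr_ge0 ?exprn_ge0// ltW.
exists (A * K ^+ 34 * B) => P Q PY QY.
have P0 : 0 < P.2 by exact: lt_le_trans PY.
have Q0 : 0 < Q.2 by exact: lt_le_trans QY.
have [b Lb hb] := lattice_near tau_nonreal (cplx P.1).
have [c Lc hc] := lattice_near tau_nonreal (cplx Q.1).
have H1 : sum_le Goff (fun g => A * K ^+ 34 * ((1 + hsn (repr g)) ^+ 34)^-1) (A * K ^+ 34 * B).
  apply: sum_le_subset (sum_leZ AK0 HB); first by move=> g [].
  by move=> g _; rewrite mulr_ge0 ?invr_ge0 ?exprn_ge0// addr_ge0 ?hsn_ge0.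
(* After reindexing, the counting weight of the translated matrix stands opposite the kernel term of
   [g] itself. *)
have /(sum_le_reindex _ _ (shift_bij (latticeN Lb) Lc)) := H1.
apply: sum_le_mono => g Gg /=.
set x := delta P _; have xE : x = delta P (h3_act_sl2 (repr g) Q) by [].
have x1 : 1 <= x by rewrite xE delta_ge1// h3_act_sl2_gt0.
have x0 : 0 < x by exact: lt_le_trans x1.
apply: le_trans (HA x x1) _.
rewrite -mulrA ler_pM2l//.
pose M := shift (- b) c (repr g).
have ME : to_psl2 M = (translation (- b) * g * translation c)%g.
  by rewrite to_psl2_shift psl2_reprK.
rewrite -ME hsn_repr.
have k0 : 0 <= 1 + abs tau by rewrite addr_ge0 ?normc_ge0.
have hM : 1 + hsn M <= K * x ^+ 2.
  apply: (HK M (cplx P.1 + - b) (cplx Q.1 - c) P.2 Q.2) => //.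
  - have [_ _ -> _] := shiftE (- b) c (repr g).
    by apply: he; [rewrite psl2_reprK; case: Gg|apply: offcusp_c; rewrite psl2_reprK].
  - by rewrite lerXn2r ?nnegrE ?normc_ge0.
  - by rewrite lerXn2r ?nnegrE ?normc_ge0.
  rewrite dist_form_shift xE delta_sl2// mulrC divfK//.
  by rewrite lt0r_neq0// !mulr_gt0.
have S0 : 0 < 1 + hsn M by rewrite ltr_pwDl ?hsn_ge0.
rewrite (exprM x 2 34) ler_pdivlMr ?exprn_gt0// mulrC ler_pdivrMr ?exprn_gt0//.
rewrite -exprMn lerXn2r ?nnegrE ?(ltW S0)//.
by rewrite mulr_ge0 ?sqr_ge0// ltW.
Qed.

End OffCusp.

(** The error is bounded entrywise and uniformly over both points of the cusp sector, which contains
    boundedness as [r] tends to infinity. *)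
Theorem theorem3p6 (R : realType) (Gamma : set (PSL2 R))
  (Gamma_kleinian : kleinian Gamma)
  (Gamma_cofinite : cofinite Gamma)
  (Gamma_cusp : one_cusp_class_at_infty Gamma)
  (tau : R[i]) (tau_nonreal : complex.Im tau != 0)
  (Gamma_infty' :
     max_tf_parabolic_subgroup (stab_infty Gamma) (@translation R @` lattice tau))
  (D : set (R * R)) (D_fundamental : cusp_fundamental_domain Gamma D)
  (Y : R) (Y_gt0 : 0 < Y) (FY : set (R * R * R)) (FY_compact : compact FY)
  (F_fundamental : h3_fundamental_domain Gamma (FY `|` cusp_sector D Y))
  (n : nat) (chi : PSL2 R -> 'M[R[i]]_n) (chi_unitary : unitary_rep Gamma chi)
  (Pinf : 'M[R[i]]_n)
  (Pinf_proj :
     orthogonal_projection (fixed_vectors (stab_infty Gamma) chi) Pinf)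
  (t : R) (t_gt0 : 0 < t) :
  exists B : R, forall P P' : R * R * R,
    cusp_sector D Y P -> cusp_sector D Y P' ->
    let r := h3_r P in let r' := h3_r P' in
    forall i j : 'I_n,
      Normc.normc ((heat_kernel Gamma chi t P P' -
        (r * r' * (expR (- t) / (area D * Num.sqrt (4 * pi * t)))
           * expR (- (ln (r / r') ^+ 2 / (4 * t))))%:C *: Pinf) i j) <= B.
Proof.
have G_sub := Gamma_kleinian.1.
have [KM HM] := Msum_approx G_sub tau_nonreal Gamma_infty' Y_gt0 t_gt0 chi_unitary Pinf_proj.
have [KT HT] := Tsum_approx G_sub tau_nonreal Gamma_infty' Y_gt0 t_gt0 D_fundamental.
have [B0 HB] := offcusp_sum Gamma_kleinian tau_nonreal Gamma_infty' Y_gt0 t_gt0.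
have [A _ HA] := hk_sum G_sub tau_nonreal Gamma_infty' Y_gt0 t_gt0.
have area0 := area_gt0 G_sub tau_nonreal Gamma_infty' Y_gt0 t_gt0 D_fundamental.
pose S : R := \sum_i \sum_j Normc.normc (Pinf i j).
have PS i j : Normc.normc (Pinf i j) <= S.
  rewrite /S (bigD1 i)//= (bigD1 j)//= -addrA lerDl addr_ge0 ?sumr_ge0// => k _.
    exact: normc_ge0.
  by apply: sumr_ge0 => l _; exact: normc_ge0.
(* The three errors: the twisted sum against [T] times the projection, [T] against its mean, and the
   elements that do not fix the cusp. [S] bounds the entries of the projection. *)
exists (KM + KT * S + 2 * B0) => -[p r] [p' r'] [_ Yr] [_ Yr'] /= i j.
rewrite /h3_r /= in Yr Yr' *.
pose x := CuspParam (cplx p') r r'; pose w := cplx p.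
have xok : cp_ok Y x by split.
pose k g := heat_k t (delta (p, r) (h3_act g (p', r'))).
pose f g : R[i] := chi g i j * (k g)%:C.
have kE g : stab_infty Gamma g -> k g = hk t x w g.
  by move=> Gg; rewrite /k (delta_stab G_sub tau_nonreal Gamma_infty').
have r0 : 0 < r by exact: lt_le_trans Yr.
have r'0 : 0 < r' by exact: lt_le_trans Yr'.
have k0 g : 0 <= k g.
  by apply: heat_k_ge0 => //; apply: delta_ge1 => //; exact: h3_act_sl2_gt0.
have Hoff : sum_le (Gamma `&` ~` stab_infty Gamma) k B0 by exact: HB.
have GE : Gamma `&` stab_infty Gamma = stab_infty Gamma.
  by apply: setIidr => g [].
have Hon : sum_le (Gamma `&` stab_infty Gamma) k (A * rho x ^+ 2).
  by rewrite GE; apply: sum_le_mono (HA x w xok) => g Gg; rewrite kE.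
have fk g : Gamma g -> Normc.normc (f g) <= k g.
  move=> Gg; rewrite Normc.normcM normc_ge0_real// -[leRHS]mul1r ler_wpM2r//.
  by apply: unitary_entry; exact: chi_unitary.1.
have Hf : cabs_le Gamma f (A * rho x ^+ 2 + B0).
  by apply: sum_le_mono (sum_le_split (fun g _ => k0 g) Hon Hoff) => g; exact: fk.
have foff : Normc.normc (csum (Gamma `&` ~` stab_infty Gamma) f) <= 2 * B0.
  by apply: ler_normc_csum; apply: sum_le_mono Hoff => g [Gg _]; exact: fk.
have fon : csum (Gamma `&` stab_infty Gamma) f = Msum Gamma t chi x w i j.
  by rewrite GE mxE; apply: eq_csum => g Gg; rewrite /f kE.
have HE : heat_kernel Gamma chi t (p, r) (p', r') i j =
    Msum Gamma t chi x w i j + csum (Gamma `&` ~` stab_infty Gamma) f.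
  have HK : heat_kernel Gamma chi t (p, r) (p', r') i j = csum Gamma f.
    exact: (mxE matrix_key (fun i j => csum Gamma (fun g => chi g i j * (k g)%:C))).
  exact: (etrans HK (etrans (csum_split _ Hf) (congr1 (fun y => y + _) fon))).
have mE : r * r' * (expR (- t) / (area D * Num.sqrt (4 * pi * t))) *
    expR (- (ln (r / r') ^+ 2 / (4 * t))) = heat_mass t r r' / area D.
  by rewrite /heat_mass invfM; ring.
have subZ (U V : 'M[R[i]]_n) c : (U - c *: V) i j = U i j - c * V i j by rewrite !mxE.
have MT := HM x w i j xok; rewrite subZ in MT.
have Tm : `|Tsum Gamma t x w - heat_mass t r r' / area D| <= KT by exact: HT x w xok.
rewrite mE; move: (heat_kernel _ _ _ _ _) HE => H; rewrite subZ => -> {subZ mE}.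
move: (heat_mass t r r' / area D) (Tsum Gamma t x w) (Msum Gamma t chi x w i j) MT Tm.
move=> m T M MT Tm.
rewrite [X in Normc.normc X](_ : _ = (M - T%:C * Pinf i j) + (T - m)%:C * Pinf i j +
  csum (Gamma `&` ~` stab_infty Gamma) f); last by rewrite rmorphB/=; ring.
apply: le_trans (le_normcD _ _) _; apply: lerD foff.
apply: le_trans (le_normcD _ _) _; apply: lerD => //.
rewrite Normc.normcM normc_real; apply: ler_pM => //; exact: normc_ge0.
Qed.
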